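(* Let $\mu=\mu(F,\theta)>0$, $k=k(F,\theta)>0$ and let $U_{\mu,k}=(\xi,v,\theta)^T$, $\xi=(F,\zeta,w)$, be a strong solution, with initial data $U^0_{\mu,k}$, defined on $\mathbb{T}^3\times[0,T^* )$, of $$\partial_t\xi^B-\partial_\alpha\Big(\tfrac{\partial\Phi^B}{\partial F_{i\alpha}}(F)v_i\Big)=0,\qquad \partial_t v_i-\partial_\alpha\Big(\tfrac{\partial\hat\psi}{\partial\xi^B}(\xi,\theta)\tfrac{\partial\Phi^B}{\partial F_{i\alpha}}(F)\Big)=\partial_\alpha(\mu\,\partial_\alpha v_i),$$ $$\partial_t\Big(\tfrac12|v|^2+\hat e(\xi,\theta)\Big)-\partial_\alpha\Big(\tfrac{\partial\hat\psi}{\partial\xi^B}(\xi,\theta)\tfrac{\partial\Phi^B}{\partial F_{i\alpha}}(F)v_i\Big)=\partial_\alpha(\mu\, v_i\partial_\alpha v_i)+\partial_\alpha(k\,\partial_\alpha\theta),\qquad \partial_\alpha F_{i\beta}-\partial_\beta F_{i\alpha}=0.$$ Let $\bar U_k=(\bar\xi,\bar v,\bar\theta)^T$, $\bar\xi=(\bar F,\bar\zeta,\bar w)$, be a smooth solution on $\mathbb{T}^3\times[0,T]$, $0<T<T^*$, with initial data $\bar U^0_k$, of the augmented thermoelasticity system (zero viscosity, heat flux $\bar k\nabla\bar\theta$ with $\bar k=k(\bar F,\bar\theta)$) $$\partial_t\bar\xi^B-\partial_\alpha\Big(\tfrac{\partial\Phi^B}{\partial F_{i\alpha}}(\bar F)\bar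 v_i\Big)=0,\qquad \partial_t\bar v_i-\partial_\alpha\Big(\tfrac{\partial\hat\psi}{\partial\xi^B}(\bar\xi,\bar\theta)\tfrac{\partial\Phi^B}{\partial F_{i\alpha}}(\bar F)\Big)=0,$$ $$\partial_t\Big(\tfrac12|\bar v|^2+\hat e(\bar\xi,\bar\theta)\Big)-\partial_\alpha\Big(\tfrac{\partial\hat\psi}{\partial\xi^B}(\bar\xi,\bar\theta)\tfrac{\partial\Phi^B}{\partial F_{i\alpha}}(\bar F)\bar v_i\Big)=\partial_\alpha(\bar k\,\partial_\alpha\bar\theta),\qquad \partial_\alpha\bar F_{i\beta}-\partial_\beta\bar F_{i\alpha}=0.$$ Suppose that $\nabla^2_\xi\hat\psi(\xi,\theta)>0$ (positive definite) and $\hat\eta_\theta(\xi,\theta)>0$ and that the growth conditions (G1), (G2), (G3) stated in the context hold for some $p\ge4$, $q,r,\ell>1$. Suppose additionally that $$0<\underline\delta\le\theta(x,t),\qquad k(\xi,\theta)+\frac{\theta^2}{k(\xi,\theta)}\le C'\,\hat e(\xi,\theta),\qquad |\mu(\xi,\theta)\,\theta|\le C'\mu_0|\hat e(\xi,\theta)|,$$ for some constant $C'=C'(k_0)$ (independent of $\mu_0$), where $\mu_0,k_0>0$ are parameters measuring the amplitudes of $\mu=\mu(F,\theta;\mu_0)$ and $k=k(F,\theta;k_0)$. If $\bar U_k(x,t)\in\Gamma_{M,\delta}$ for all $(x,t)\in\mathbb{T}^3\times[0,T)$ and some $M,\delta>0$, then there exists a constant $C=C(T,\underline\delta)$ (independent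 of $\mu$ and $\mu_0$) such that for $t\in[0,T]$ $$\int_{\mathbb{T}^3} I(U_{\mu,k}(t)|\bar U_k(t))\,dx\le C\left(\int_{\mathbb{T}^3} I(U^0_{\mu,k}|\bar U^0_k)\,dx+\int_0^T\!\!\int_{\mathbb{T}^3}\mu\,\theta(s)\frac{|\nabla\bar v(s)|^2}{\bar\theta(s)}\,dx\,ds\right).$$ Also, whenever $$\lim_{\mu_0\to0}\int_{\mathbb{T}^3} I(U^0_{\mu,k}|\bar U^0_k)\,dx=0,$$ we have $$\sup_{t\in[0,T)}\int_{\mathbb{T}^3} I(U_{\mu,k}(t)|\bar U_k(t))\,dx\to0\quad\text{as }\mu_0\to0^+.$$
   Context: Notation. Space dimension is $3$, $\mathbb{T}^3$ is the torus (periodic domain); Latin/Greek indices $i,\alpha,\beta$ run over $1,2,3$; $B$ runs over $1,\dots,19$; repeated indices are summed. $\mathbb{M}^{3\times3}$ denotes real $3\times3$ matrices. $\Phi(F)=(F,\operatorname{cof}F,\det F)\in\mathbb{M}^{3\times3}\times\mathbb{M}^{3\times3}\times\mathbb{R}\simeq\mathbb{R}^{19}$ with components $\Phi^B(F)$, where $\operatorname{cof}F$ is the cofactor matrix. $\xi=(F,\zeta,w)\in\mathbb{M}^{3\times3}\times\mathbb{M}^{3\times3}\times\mathbb{R}\simeq\mathbb{R}^{19}$ with components $\xi^B$; $v\in\mathbb{R}^3$ is the velocity and $\theta$ the temperature. In the system, $F$ is the first component of $\xi$. Constitutive functions. $\hat\psi=\hat\psi(\xi,\theta)$ is a given $C^3$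 function on $\mathbb{R}^{19}\times[0,\infty)$ (extended free energy), and $$\hat\eta(\xi,\theta)=-\frac{\partial\hat\psi}{\partial\theta}(\xi,\theta),\qquad \hat e(\xi,\theta)=\hat\psi(\xi,\theta)-\theta\frac{\partial\hat\psi}{\partial\theta}(\xi,\theta).$$ The coefficients $\mu,k$ are smooth functions, written $\mu(\xi,\theta)=\mu(F,\theta)$, $k(\xi,\theta)=k(F,\theta)$. In the zero-viscosity limit $\mu_0\to0$ the function $k$ (and $k_0$) is kept fixed. Smooth solutions of the two systems satisfy respectively the entropy identities $\partial_t\hat\eta-\partial_\alpha(k\,\partial_\alpha\theta/\theta)=k|\nabla\theta|^2/\theta^2+\mu|\nabla v|^2/\theta$ and $\partial_t\hat\eta(\bar\xi,\bar\theta)-\partial_\alpha(\bar k\,\partial_\alpha\bar\theta/\bar\theta)=\bar k|\nabla\bar\theta|^2/\bar\theta^2$. Growth conditions. With $|\xi|_{p,q,r}:=|F|^p+|\zeta|^q+|w|^r$, for some constant $c>0$: (G1) $c(|\xi|_{p,q,r}+\theta^\ell)-c\le\hat e(\xi,\theta)\le c(|\xi|_{p,q,r}+\theta^\ell)+c$; (G2) $\displaystyle\lim_{|\xi|_{p,q,r}+\theta^\ell\to\infty}\frac{|\partial_F\hat\psi|+|\partial_\zeta\hat\psi|^{\frac{p}{p-1}}+|\partial_w\hat\psi|^{\frac{p}{p-2}}}{|\xi|_{p,q,r}+\theta^\ell}=0$; (G3) $\displaystyle\lim_{|\xi|_{p,q,r}+\theta^\ell\to\infty}\frac{|\partial_\theta\hat\psi|}{|\xi|_{p,q,r}+\theta^\ell}=0$.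 The compact set is $\Gamma_{M,\delta}:=\{(\bar\xi,\bar v,\bar\theta): |\bar F|\le M,|\bar\zeta|\le M,|\bar w|\le M,|\bar v|\le M,\ 0<\delta\le\bar\theta\le M\}$. Relative entropy. For $U=(\xi,v,\theta)$, $\bar U=(\bar\xi,\bar v,\bar\theta)$, $$I(U|\bar U)=I(\xi,v,\theta|\bar\xi,\bar v,\bar\theta)=\hat\psi(\xi,\theta|\bar\xi,\bar\theta)+\tfrac12|v-\bar v|^2+(\hat\eta(\xi,\theta)-\hat\eta(\bar\xi,\bar\theta))(\theta-\bar\theta),$$ $$\hat\psi(\xi,\theta|\bar\xi,\bar\theta)=\hat\psi(\xi,\theta)-\hat\psi(\bar\xi,\bar\theta)-\frac{\partial\hat\psi}{\partial\xi^B}(\bar\xi,\bar\theta)(\xi^B-\bar\xi^B)+\hat\eta(\bar\xi,\bar\theta)(\theta-\bar\theta).$$ *)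

(* Defs.v *)
From HB Require Import structures.
From mathcomp Require Import all_boot all_order all_algebra.
From mathcomp Require Import all_classical all_reals all_analysis.

Set Implicit Arguments.
Unset Strict Implicit.
Unset Printing Implicit Defensive.

Import Order.TTheory GRing.Theory Num.Theory.
Import numFieldNormedType.Exports.

Local Open Scope classical_set_scope.
Local Open Scope ring_scope.

(* Euclidean (Frobenius) norm; the library norm on matrices is the max norm. *)
Definition frob (R : realType) (m n : nat) (A : 'M[R]_(m, n)) : R :=
  Num.sqrt (\sum_i \sum_j A i j ^+ 2).

(* On an open set O: all iterated directional derivatives of order <= n exist
   and are continuous, which in finite dimension is the usual C^n. *)
Fixpoint Cdiff (R : realType) (V : normedModType R) (n : nat) (O : set V)
    (f : V -> R) : Prop :=
  (forall x, O x -> {for x, continuous f}) /\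
  (if n is m.+1 then
     forall v, (forall x, O x -> derivable f x v) /\
               Cdiff m O (fun x => 'D_v f x)
   else True).

(* On an arbitrary set D: restrictions of C^n functions defined on an open
   neighbourhood of D. *)
Definition Cdiff_on (R : realType) (V : normedModType R) (n : nat) (D : set V)
    (f : V -> R) : Prop :=
  exists (O : set V) (g : V -> R),
    [/\ open O, D `<=` O, Cdiff n O g & forall x, D x -> f x = g x].

Definition smooth_on (R : realType) (V : normedModType R) (D : set V)
    (f : V -> R) : Prop :=
  exists (O : set V) (g : V -> R),
    [/\ open O, D `<=` O, forall n, Cdiff n O g & forall x, D x -> f x = g x].

(* xi = (F, zeta, w), the coordinates of F and zeta being listed row by row. *)
Definition Fpart (R : realType) (x : 'rV[R]_19) : 'M[R]_3 :=
  vec_mx (lsubmx (lsubmx (x : 'rV[R]_(3 * 3 + 3 * 3 + 1)))).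

Definition zpart (R : realType) (x : 'rV[R]_19) : 'M[R]_3 :=
  vec_mx (rsubmx (lsubmx (x : 'rV[R]_(3 * 3 + 3 * 3 + 1)))).

Definition wpart (R : realType) (x : 'rV[R]_19) : R :=
  rsubmx (x : 'rV[R]_(3 * 3 + 3 * 3 + 1)) 0 0.

Definition cof (R : realType) (F : 'M[R]_3) : 'M[R]_3 :=
  \matrix_(i, a) cofactor F i a.

Definition Phi (R : realType) (F : 'M[R]_3) : 'rV[R]_19 :=
  row_mx (row_mx (mxvec F) (mxvec (cof F))) (const_mx (\det F) : 'rV[R]_1).

Definition dPhi (R : realType) (B : 'I_19) (i a : 'I_3) (F : 'M[R]_3) : R :=
  'D_(delta_mx i a) (fun G : 'M[R]_3 => Phi G 0 B) F.

(* psi xi th is only meaningful for th >= 0.  The temperature derivative is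
   therefore the right derivative: for a C^1 function on R^19 x [0, +oo[ it is
   the ordinary derivative when th > 0 and the one-sided one when th = 0. *)
Definition dth (R : realType) (f : 'rV[R]_19 -> R -> R)
    (x : 'rV[R]_19) (th : R) : R :=
  lim (h^-1 * (f x (th + h) - f x th) @[h --> 0^'+]).

Definition dxi (R : realType) (f : 'rV[R]_19 -> R -> R) (B : 'I_19)
    (x : 'rV[R]_19) (th : R) : R :=
  'D_(delta_mx 0 B) (fun y => f y th) x.

Definition grad_xi (R : realType) (f : 'rV[R]_19 -> R -> R)
    (x : 'rV[R]_19) (th : R) : 'rV[R]_19 :=
  \row_B dxi f B x th.

Definition hess_xi (R : realType) (f : 'rV[R]_19 -> R -> R)
    (x : 'rV[R]_19) (th : R) : 'M[R]_19 :=
  \matrix_(B, C) dxi (dxi f C) B x th.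

Definition eta (R : realType) (psi : 'rV[R]_19 -> R -> R)
    (x : 'rV[R]_19) (th : R) : R := - dth psi x th.

Definition energy (R : realType) (psi : 'rV[R]_19 -> R -> R)
    (x : 'rV[R]_19) (th : R) : R := psi x th - th * dth psi x th.

Definition free_energy_C3 (R : realType) (psi : 'rV[R]_19 -> R -> R) : Prop :=
  Cdiff_on 3 [set z : 'rV[R]_19 * R | 0 <= z.2] (fun z => psi z.1 z.2).

Definition hess_xi_posdef (R : realType) (psi : 'rV[R]_19 -> R -> R) : Prop :=
  forall x th, 0 <= th -> forall h : 'rV[R]_19, h != 0 ->
    0 < (h *m hess_xi psi x th *m h^T) 0 0.

Definition eta_th_pos (R : realType) (psi : 'rV[R]_19 -> R -> R) : Prop :=
  forall x th, 0 <= th -> 0 < dth (eta psi) x th.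

Definition size_pqrl (R : realType) (p q r l : R)
    (x : 'rV[R]_19) (th : R) : R :=
  frob (Fpart x) `^ p + frob (zpart x) `^ q + `|wpart x| `^ r + th `^ l.

Definition growth1 (R : realType) (p q r l : R)
    (psi : 'rV[R]_19 -> R -> R) : Prop :=
  exists2 c : R, 0 < c & forall x th, 0 <= th ->
    c * size_pqrl p q r l x th - c <= energy psi x th
    <= c * size_pqrl p q r l x th + c.

(* f / (|xi|_{p,q,r} + th^l) --> 0 as |xi|_{p,q,r} + th^l --> +oo *)
Definition negligible_growth (R : realType) (p q r l : R)
    (f : 'rV[R]_19 -> R -> R) : Prop :=
  forall eps : R, 0 < eps -> exists N : R, forall x th, 0 <= th ->
    N < size_pqrl p q r l x th ->
    `|f x th / size_pqrl p q r l x th| < eps.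

Definition growth2 (R : realType) (p q r l : R)
    (psi : 'rV[R]_19 -> R -> R) : Prop :=
  negligible_growth p q r l (fun x th =>
    frob (Fpart (grad_xi psi x th))
    + frob (zpart (grad_xi psi x th)) `^ (p / (p - 1))
    + `|wpart (grad_xi psi x th)| `^ (p / (p - 2))).

Definition growth3 (R : realType) (p q r l : R)
    (psi : 'rV[R]_19 -> R -> R) : Prop :=
  negligible_growth p q r l (fun x th => `|dth psi x th|).

Definition coefficient (R : realType) (m : 'M[R]_3 -> R -> R) : Prop :=
  smooth_on [set z : 'M[R]_3 * R | 0 < z.2] (fun z => m z.1 z.2) /\
  (forall F th, 0 < th -> 0 < m F th).

Record state (R : realType) :=
  State { xi : 'rV[R]_19 ; vel : 'rV[R]_3 ; temp : R }.

Definition state_field (R : realType) := 'rV[R]_3 -> R -> state R.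

Definition rel_psi (R : realType) (psi : 'rV[R]_19 -> R -> R)
    (x : 'rV[R]_19) (th : R) (xb : 'rV[R]_19) (thb : R) : R :=
  psi x th - psi xb thb - \sum_B dxi psi B xb thb * (x 0 B - xb 0 B)
  + eta psi xb thb * (th - thb).

Definition rel_entropy (R : realType) (psi : 'rV[R]_19 -> R -> R)
    (U Ub : state R) : R :=
  rel_psi psi (xi U) (temp U) (xi Ub) (temp Ub)
  + 2^-1 * frob (vel U - vel Ub) ^+ 2
  + (eta psi (xi U) (temp U) - eta psi (xi Ub) (temp Ub))
    * (temp U - temp Ub).

Definition Gamma (R : realType) (M d : R) : set (state R) :=
  [set U | [/\ frob (Fpart (xi U)) <= M, frob (zpart (xi U)) <= M,
               `|wpart (xi U)| <= M, frob (vel U) <= M & d <= temp U <= M]].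

(* Fields on the torus T^3 = R^3 / Z^3 are 1-periodic fields on R^3. *)
Definition periodic_on (R : realType) (J : set R) (U : state_field R) : Prop :=
  forall x t (a : 'I_3), J t -> U (x + delta_mx 0 a) t = U x t.

Definition point3 (R : realType) (z : R * R * R) : 'rV[R]_3 :=
  \row_(a < 3) [:: z.1.1; z.1.2; z.2]`_a.

Definition torus_int (R : realType) (f : 'rV[R]_3 -> R) : \bar R :=
  \int[((@lebesgue_measure R \x @lebesgue_measure R) \x @lebesgue_measure R)%E]_(z
     in (`[0, 1] `*` `[0, 1]) `*` `[0, 1]) (f (point3 z))%:E.

Definition dt (R : realType) (f : 'rV[R]_3 -> R -> R) (x : 'rV[R]_3) (t : R)
  : R := derive1 (f x) t.

Definition dx (R : realType) (a : 'I_3) (f : 'rV[R]_3 -> R -> R)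
    (x : 'rV[R]_3) (t : R) : R :=
  'D_(delta_mx 0 a) (fun y => f y t) x.

Definition grad_vel_sq (R : realType) (U : state_field R) (x : 'rV[R]_3) (t : R)
  : R := \sum_(i < 3) \sum_(a < 3) dx a (fun y s => vel (U y s) 0 i) x t ^+ 2.

(* The viscous system holds pointwise for all times in J.  With mu = 0 it is
   the augmented thermoelasticity system with heat conduction. *)
Definition thermoviscoelastic (R : realType) (psi : 'rV[R]_19 -> R -> R)
    (mu k : 'M[R]_3 -> R -> R) (J : set R) (U : state_field R) : Prop :=
  let F y s := Fpart (xi (U y s)) in
  let v i y s := vel (U y s) 0 i in
  let th y s := temp (U y s) in
  let stress i a y s :=
    \sum_(B < 19) dxi psi B (xi (U y s)) (th y s) * dPhi B i a (F y s) in
  let muU y s := mu (F y s) (th y s) in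
  let kU y s := k (F y s) (th y s) in
  forall x t, J t ->
  [/\ forall B : 'I_19,
        dt (fun y s => xi (U y s) 0 B) x t
        - \sum_(a < 3)
            dx a (fun y s => \sum_(i < 3) dPhi B i a (F y s) * v i y s) x t
        = 0,
      forall i : 'I_3,
        dt (v i) x t - \sum_(a < 3) dx a (stress i a) x t
        = \sum_(a < 3) dx a (fun y s => muU y s * dx a (v i) y s) x t,
      dt (fun y s => 2^-1 * frob (vel (U y s)) ^+ 2
                     + energy psi (xi (U y s)) (th y s)) x t
      - \sum_(a < 3)
          dx a (fun y s => \sum_(i < 3) stress i a y s * v i y s) x t
      = \sum_(a < 3)
          dx a (fun y s => \sum_(i < 3) muU y s * v i y s * dx a (v i) y s) x t
        + \sum_(a < 3) dx a (fun y s => kU y s * dx a th y s) x t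
    & forall i a b : 'I_3,
        dx a (fun y s => F y s i b) x t - dx b (fun y s => F y s i a) x t = 0].

Definition slab (R : realType) (J : set R) : set ('rV[R]_3 * R) :=
  [set z | J z.2].

(* C^1 in space-time, with continuous second space derivatives (J open). *)
Definition C1_C2space (R : realType) (J : set R) (f : 'rV[R]_3 -> R -> R)
  : Prop :=
  Cdiff 1 (slab J) (fun z => f z.1 z.2) /\
  forall a b : 'I_3,
    (forall z, slab J z ->
       derivable (fun y => dx a f y z.2) z.1 (delta_mx 0 b)) /\
    Cdiff 0 (slab J) (fun z => dx b (dx a f) z.1 z.2).

(* A strong solution is a classical one: continuous up to t = 0, and with all
   derivatives occurring in the system continuous for t > 0. *)
Definition strong_solution (R : realType) (psi : 'rV[R]_19 -> R -> R)
    (mu k : 'M[R]_3 -> R -> R) (Tstar : R) (U : state_field R) : Prop :=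
  [/\ periodic_on `[0, Tstar[ U,
      [/\ forall B, {within slab `[0, Tstar[,
            continuous (fun z => xi (U z.1 z.2) 0 B)},
          forall i, {within slab `[0, Tstar[,
            continuous (fun z => vel (U z.1 z.2) 0 i)}
        & {within slab `[0, Tstar[, continuous (fun z => temp (U z.1 z.2))}],
      [/\ forall B, Cdiff 1 (slab `]0, Tstar[) (fun z => xi (U z.1 z.2) 0 B),
          forall i, C1_C2space `]0, Tstar[ (fun x t => vel (U x t) 0 i)
        & C1_C2space `]0, Tstar[ (fun x t => temp (U x t))]
    & thermoviscoelastic psi mu k `]0, Tstar[ U].

Definition smooth_inviscid_solution (R : realType)
    (psi : 'rV[R]_19 -> R -> R) (k : 'M[R]_3 -> R -> R) (T : R) (U : state_field R)
  : Prop :=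
  [/\ periodic_on `[0, T] U,
      [/\ forall B, smooth_on (slab `[0, T]) (fun z => xi (U z.1 z.2) 0 B),
          forall i, smooth_on (slab `[0, T]) (fun z => vel (U z.1 z.2) 0 i)
        & smooth_on (slab `[0, T]) (fun z => temp (U z.1 z.2))]
    & thermoviscoelastic psi (fun _ _ => 0) k `]0, T[ U].

Definition viscous_bounds (R : realType) (psi : 'rV[R]_19 -> R -> R)
    (mu k : 'M[R]_3 -> R -> R) (mu0 C' dlow Tstar : R) (U : state_field R) : Prop :=
  forall x t, 0 <= t < Tstar ->
    let X := xi (U x t) in let th := temp (U x t) in
    [/\ dlow <= th,
        k (Fpart X) th + th ^+ 2 / k (Fpart X) th <= C' * energy psi X th
      & `|mu (Fpart X) th * th| <= C' * mu0 * `|energy psi X th|].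

Definition viscous_solution (R : realType) (psi : 'rV[R]_19 -> R -> R)
    (k : 'M[R]_3 -> R -> R) (C' dlow T mu0 : R)
    (mu : 'M[R]_3 -> R -> R) (Tstar : R) (U : state_field R) : Prop :=
  [/\ coefficient mu, T < Tstar, strong_solution psi mu k Tstar U
    & viscous_bounds psi mu k mu0 C' dlow Tstar U].

Definition rel_entropy_int (R : realType) (psi : 'rV[R]_19 -> R -> R)
    (U Ub : state_field R) (t : R) : \bar R :=
  torus_int (fun x => rel_entropy psi (U x t) (Ub x t)).

Definition viscous_error (R : realType) (mu : 'M[R]_3 -> R -> R) (T : R)
    (U Ub : state_field R) : \bar R :=
  \int[@lebesgue_measure R]_(s in `[0, T])
    torus_int (fun x =>
      (mu (Fpart (xi (U x s))) (temp (U x s)) * temp (U x s)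
       * (grad_vel_sq Ub x s / temp (Ub x s)))%R).

(* Main.v *)
Require Import Defs.
From HB Require Import structures.
From mathcomp Require Import all_boot all_order all_algebra.
From mathcomp Require Import all_classical all_reals all_analysis.
From mathcomp Require Import measurable_realfun.
From mathcomp Require Import ring lra.

Set Implicit Arguments.
Unset Strict Implicit.
Unset Printing Implicit Defensive.

Import Order.TTheory GRing.Theory Num.Theory.
Import numFieldNormedType.Exports.

Local Open Scope classical_set_scope.
Local Open Scope ring_scope.

(** The relative entropy measures the distance between the two solutions. Its thermal part [Jrel] is
    split through the intermediate state that has the [xi] of the first state and the temperature of
    the second. One piece is a Taylor remainder in [xi], positive because psi is convex in [xi]; the
    other is a Taylor remainder in temperature, positive because a positive temperature derivative
    of the entropy makes psi concave in temperature. On bounded sets [Jrel] therefore dominates the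
    squared distance of the states ([Jrel_near]). For large states (G1) and (G3) make it dominate
    the size |xi|_{p,q,r} + theta^l ([Jrel_far]). Hence whatever is quadratic near the reference
    states and at most linear in the size far from them is bounded by a multiple of [Jrel]
    ([Jrel_control]).

    Along a solution the Piola identity removes the derivatives of the minors, the balance laws take
    a nonconservative form, and the entropy balance follows ([entropy_balance]). Differentiating the
    relative entropy in time and inserting these laws for both solutions gives a divergence plus a
    residual ([relative_entropy_identity]). The residual consists of Taylor remainders of the
    gradient of psi, products of differences of stresses, velocities and minors, a viscous part, and
    a quadratic form in the logarithmic temperature gradients. The first two kinds fall under the
    comparison principle: the exponents of (G2) are conjugate to the growth of the differentiated
    minors, and [4 <= p] handles the square of a quadratic minor. In the viscous part the
    dissipation of the first solution absorbs the cross term and leaves exactly the integrand of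
    [viscous_error]. In the heat part a square is completed, and what is left is controlled through
    the bound of k + theta^2 / k by the energy. [residual_le] collects all this with a constant that
    depends on the reference solution and on [k], but not on the viscosity.

    Integration over the torus removes the divergence ([Tint_derive_eq0]), and Gronwall's inequality
    gives the stability estimate. For the limit, the bound of mu theta by mu0 times the energy, and
    of the energy by one plus the relative entropy, turn the viscous error into a term of order mu0
    times one plus the relative entropy. A second use of Gronwall then bounds the relative entropy,
    uniformly in time, by the initial one plus a quantity of order mu0. *)

(** * Mean value theorem along lines *)

Section lines.
Context {R : realType} {V : normedModType R}.
Implicit Types (f : V -> R) (x v : V).

Lemma is_derive_line f x v (s : R) df :
  is_derive (x + s *: v) v f df -> is_derive s 1 (fun h : R => f (x + h *: v)) df.
Proof.
have E : (fun h : R => h^-1 *: (((fun h : R => f (x + h *: v)) \o shift s) (h *: 1)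
           - f (x + s *: v)))
       = (fun h : R => h^-1 *: ((f \o shift (x + s *: v)) (h *: v) - f (x + s *: v))).
  by apply/funext => h /=; rewrite [h *: 1]mulr1 scalerDl addrCA.
by move=> [dfx dfE]; split; [rewrite /derivable E | rewrite /derive E].
Qed.

Lemma MVT_line f x v (c : R) :
  (forall s : R, `|s| <= `|c| -> derivable f (x + s *: v) v) ->
  exists2 s : R, `|s| <= `|c| & f (x + c *: v) - f x = c * 'D_v f (x + s *: v).
Proof.
move=> df.
have dl (s : R) : `|s| <= `|c| ->
    is_derive s 1 (fun h : R => f (x + h *: v)) ('D_v f (x + s *: v)).
  by move=> /df ?; apply: is_derive_line; apply: derivableP.
have cl a b : (forall s, a <= s <= b -> `|s| <= `|c|) ->
    {within `[a, b], continuous (fun h : R => f (x + h *: v))}.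
  move=> h; apply: derivable_within_continuous => s; rewrite in_itv/= => /h /dl ?.
  exact: ex_derive.
have [c0|c0] := leP 0 c.
  have [||s] := @MVT_segment R (fun h : R => f (x + h *: v)) (fun s => 'D_v f (x + s *: v)) 0 c c0.
  - move=> s; rewrite in_itv/= => /andP[s0 sc]; apply: dl.
    by rewrite !ger0_norm// ltW.
  - by apply: cl => s /andP[s0 sc]; rewrite !ger0_norm.
  rewrite in_itv/= => /andP[s0 sc]; rewrite scale0r addr0 subr0 => ->.
  by exists s; rewrite ?[c * _]mulrC// !ger0_norm.
have [||s] := @MVT_segment R (fun h : R => f (x + h *: v)) (fun s => 'D_v f (x + s *: v)) c 0 (ltW c0).
- move=> s; rewrite in_itv/= => /andP[s0 sc]; apply: dl.
  by rewrite !ler0_norm ?lerN2// ltW.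
- by apply: cl => s /andP[s0 sc]; rewrite !ler0_norm ?lerN2// ltW.
rewrite in_itv/= => /andP[s0 sc]; rewrite scale0r addr0 sub0r => E.
by exists s; [rewrite !ler0_norm ?lerN2// ltW | rewrite -opprB E mulrN opprK mulrC].
Qed.

Lemma MVT01 f x v :
  (forall s : R, 0 <= s <= 1 -> derivable f (x + s *: v) v) ->
  exists2 s : R, 0 <= s <= 1 & f (x + v) - f x = 'D_v f (x + s *: v).
Proof.
move=> df.
have dl (s : R) : 0 <= s <= 1 ->
    is_derive s 1 (fun h : R => f (x + h *: v)) ('D_v f (x + s *: v)).
  by move=> /df ?; apply: is_derive_line; apply: derivableP.
have [||s] := @MVT_segment R (fun h : R => f (x + h *: v))
    (fun s => 'D_v f (x + s *: v)) 0 1 ler01.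
- by move=> s; rewrite in_itv/= => /andP[s0 sc]; apply: dl; rewrite !ltW.
- by apply: derivable_within_continuous => s; rewrite in_itv/= => /dl ?; exact: ex_derive.
rewrite in_itv/= => s01; rewrite scale0r addr0 subr0 scale1r mulr1 => ->.
by exists s.
Qed.

End lines.


(** * Differentiability from continuous directional derivatives *)

Section coordinates.
Context {R : realType}.

(** The increment is travelled one direction at a time, with the mean value theorem on each leg. The
    base point [y] varies near [x] because the induction restarts from the end of the first leg,
    while the derivatives stay frozen at [x]. *)
Lemma telescoping_increment {V : normedModType R} (I : Type) (e : I -> V)
    (f : V -> R) (x : V) (r : seq I) :
  (forall i, \forall y \near x, derivable f y (e i)) ->
  (forall i, {for x, continuous (fun y => 'D_(e i) f y)}) ->
  forall eps : R, 0 < eps -> exists2 d : R, 0 < d &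
    forall (t : I -> R) (y : V), (forall i, `|t i| <= d) -> `|y - x| <= d ->
      `|f (y + \sum_(i <- r) t i *: e i) - f y
        - \sum_(i <- r) t i * 'D_(e i) f x| <= eps * \sum_(i <- r) `|t i|.
Proof.
move=> df cf eps eps0; elim: r => [|a r [d d0 IH]].
  exists 1 => // t y _ _; rewrite !big_nil addr0 subrr subrr normr0 mulr0 //.
have /(@nbhs_ballP R V) [rho /= rho0 Hrho] : \forall y \near x,
    derivable f y (e a) /\ `|'D_(e a) f x - 'D_(e a) f y| <= eps.
  near=> y; split; first by near: y; exact: df.
  by near: y; move: (cf a) => /cvgrPdist_le; exact.
(* Dividing the radius by [E] keeps the whole leg from [y] within [Num.min d (rho / 2)] of [x]; the
   half keeps it strictly inside the ball of radius [rho]. *)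
pose E := 1 + `|e a|.
have E0 : 0 < E by rewrite /E ltr_pwDl.
exists (Num.min d (rho / 2) / E).
  by rewrite divr_gt0// lt_min d0/= divr_gt0.
move=> t y td yd.
have bnd (s : R) : `|s| <= Num.min d (rho / 2) / E ->
    `|y + s *: e a - x| <= Num.min d (rho / 2).
  move=> hs; rewrite addrAC (le_trans (ler_normD _ _))// normrZ.
  rewrite (@le_trans _ _ (Num.min d (rho / 2) / E * E))//; last by rewrite divfK ?gt_eqF.
  rewrite /E mulrDr mulr1 lerD//.
  by rewrite ler_wpM2r.
have minE : Num.min d (rho / 2) / E <= d.
  rewrite ler_pdivrMr//; apply: (@le_trans _ _ d); first by rewrite ge_min lexx.
  by apply: ler_peMr; [exact: ltW | rewrite /E lerDl].
rewrite !big_cons addrA.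
have [s st fE] : exists2 s : R, `|s| <= `|t a| &
    f (y + t a *: e a) - f y = t a * 'D_(e a) f (y + s *: e a).
  apply: MVT_line => s st; apply: (Hrho _ _).1; rewrite -ball_normE /= distrC.
  rewrite (le_lt_trans (bnd _ _))//; first exact: le_trans st (td a).
  by rewrite gt_min; apply/orP; right; rewrite ltr_pdivrMr// ltr_pMr// ltr1n.
have Hd : `|'D_(e a) f x - 'D_(e a) f (y + s *: e a)| <= eps.
  apply: (Hrho _ _).2; rewrite -ball_normE /= distrC.
  rewrite (le_lt_trans (bnd _ _))//; first exact: le_trans st (td a).
  by rewrite gt_min; apply/orP; right; rewrite ltr_pdivrMr// ltr_pMr// ltr1n.
have := IH t (y + t a *: e a) (fun i => le_trans (td i) minE).
move=> /(_ (le_trans (bnd _ (td a)) _)); rewrite ge_min lexx => /(_ isT) IH1.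
set S := \sum_(_ <- r) _ *: _ in IH1 *; set S2 := \sum_(_ <- r) _ * _ in IH1 *.
have -> : f (y + t a *: e a + S) - f y - (t a * 'D_(e a) f x + S2) =
  (f (y + t a *: e a + S) - f (y + t a *: e a) - S2)
  + t a * ('D_(e a) f (y + s *: e a) - 'D_(e a) f x).
  by rewrite mulrBr -fE; ring.
rewrite (le_trans (ler_normD _ _))// [leRHS]mulrDr [leRHS]addrC lerD// normrM.
rewrite [eps * _]mulrC.
by rewrite ler_wpM2l// distrC.
Unshelve. all: by end_near. Qed.

Variable n : nat.
Local Notation V := ('rV[R]_n * R)%type.
Implicit Types (f : V -> R) (x v : V).

Definition ebase (j : 'I_n) : V := (delta_mx 0 j, 0).
Definition etime : V := (0, 1).

Lemma pair_coordE v : v = \sum_j v.1 0 j *: ebase j + v.2 *: etime.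
Proof.
have fstE (I : Type) (r : seq I) (F : I -> V) :
    (\sum_(i <- r) F i).1 = \sum_(i <- r) (F i).1.
  by elim: r => [|a r IH]; rewrite ?big_nil ?big_cons //= IH.
have sndE (I : Type) (r : seq I) (F : I -> V) :
    (\sum_(i <- r) F i).2 = \sum_(i <- r) (F i).2.
  by elim: r => [|a r IH]; rewrite ?big_nil ?big_cons //= IH.
apply/eqP; rewrite -pair_eqE; apply/andP; split; apply/eqP => /=.
  by rewrite fstE /= scaler0 addr0 [LHS]row_sum_delta.
rewrite sndE /= big1 ?add0r//; first by rewrite [_ *: _]mulr1.
by move=> i _; rewrite scaler0.
Qed.

Lemma normr_coord v j : `|v.1 0 j| <= `|v|.
Proof.
rewrite [leRHS]prod_normE le_max; apply/orP; left.
by rewrite [leRHS]/Num.Def.normr/= mx_normrE; exact: (le_bigmax _ _ (0, j)).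
Qed.

Lemma normr_time v : `|v.2| <= `|v|.
Proof. by rewrite [leRHS]prod_normE le_max lexx orbT. Qed.

Definition pgrad f x v : R :=
  \sum_j v.1 0 j * 'D_(ebase j) f x + v.2 * 'D_etime f x.

Lemma pgrad_linear f x : linear (pgrad f x).
Proof.
move=> a u v; rewrite /pgrad /= mulrDl.
have -> : \sum_j (a *: u + v).1 0 j * 'D_(ebase j) f x =
  a * (\sum_j u.1 0 j * 'D_(ebase j) f x) + \sum_j v.1 0 j * 'D_(ebase j) f x.
  rewrite mulr_sumr -big_split/=; apply: eq_bigr => j _.
  by rewrite !mxE mulrDl mulrA.
by rewrite -mulrA /GRing.scale /=; ring.
Qed.

Definition pgradL f x : {linear V -> R} :=
  HB.pack (pgrad f x) (GRing.isLinear.Build _ _ _ _ (pgrad f x) (pgrad_linear f x)).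

Lemma normr_pgrad_le f x v : `|pgrad f x v| <=
  (\sum_j `|'D_(ebase j) f x| + `|'D_etime f x|) * `|v|.
Proof.
rewrite (le_trans (ler_normD _ _))// mulrDl lerD//; last first.
  by rewrite normrM mulrC ler_wpM2l// normr_time.
rewrite (le_trans (ler_norm_sum _ _ _))// mulr_suml ler_sum// => j _.
by rewrite normrM mulrC ler_wpM2l// normr_coord.
Qed.

Lemma pgrad_continuous f x : continuous (pgrad f x).
Proof.
apply: (@bounded_linear_continuous _ _ _ (pgradL f x)).
apply/linear_boundedP; near=> r => v.
by apply: le_trans (normr_pgrad_le f x v) _; apply: ler_wpM2r => //.
Unshelve. all: by end_near. Qed.

(** The candidate differential is assembled from the partial derivatives; telescoping over the
    coordinates shows that its error is small compared with the increment. *)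
Lemma is_diff_pgrad f x :
  (forall v, \forall y \near x, derivable f y v) ->
  (forall v, {for x, continuous (fun y => 'D_v f y)}) ->
  is_diff x f (pgrad f x).
Proof.
move=> df cf.
pose e (i : option 'I_n) := if i is Some j then ebase j else etime.
pose r := None :: map Some (enum 'I_n).
pose t (v : V) (i : option 'I_n) := if i is Some j then v.1 0 j else v.2.
have rE (F : option 'I_n -> V) : \sum_(i <- r) F i = \sum_j F (Some j) + F None.
  by rewrite big_cons big_map big_enum addrC.
have rE' (F : option 'I_n -> R) : \sum_(i <- r) F i = \sum_j F (Some j) + F None.
  by rewrite big_cons big_map big_enum addrC.
have Lo : (f : V -> R^o) \o shift x = (cst (f x) : V -> R^o) + (pgradL f x : V -> R^o) +o_ (0 : V) (id : V -> V).
  apply/(@eqaddoP R V R^o V _ (f \o shift x) (cst (f x) + pgradL f x) id).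
  move=> _/posnumP[eps].
  (* There are [n.+1] coordinates, time included, each bounded by the norm of the increment; this is
     why the tolerance is divided by [n.+1]. *)
  have [d d0 Hd] := @telescoping_increment _ _ e f x r (fun i => df (e i))
    (fun i => cf (e i)) (eps%:num / n.+1%:R) (divr_gt0 [gt0 of eps%:num] (ltr0Sn _ _)).
  near=> v.
  have := Hd (t v) x _ _; rewrite subrr normr0 rE !rE' /= -pair_coordE.
  rewrite (_ : (_ - (_ + _)) v = f (x + v) - f x - pgrad f x v); last first.
    by rewrite [x + v]addrC -addrA -opprD.
  have vd : `|v| <= d by near: v; exact: (@nbhs0_le _ V _ d0).
  move=> /(_ _ (ltW d0)) H; apply: le_trans (H _) _ => {H}.
    case=> [j|] /=; first exact: le_trans (normr_coord _ _) vd.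
    exact: le_trans (normr_time _) vd.
  rewrite -mulrA ler_wpM2l// ler_pdivrMl ?ltr0Sn//.
  rewrite -natr1 mulrDl mul1r lerD ?normr_time//.
  rewrite (@le_trans _ _ (\sum_(j < n) `|v|))//.
    by apply: ler_sum => j _; exact: normr_coord.
  by rewrite sumr_const card_ord mulr_natl.
have E : 'd f x = pgrad f x :> (V -> R).
  exact: (@diff_unique _ _ _ f (pgradL f x) x (@pgrad_continuous f x) Lo).
apply: DiffDef; last exact: E.
apply/diff_locallyP; rewrite E; split; first exact: pgrad_continuous.
exact: Lo.
Unshelve. all: by end_near. Qed.

Lemma open_near (T : topologicalType) (O : set T) (x : T) (P : T -> Prop) :
  open O -> O x -> (forall y, O y -> P y) -> \forall y \near x, P y.
Proof. by move=> oO Ox h; apply: filterS h _; exact: open_nbhs_nbhs. Qed.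

Lemma Cdiff_is_diff (m : nat) (O : set V) f x :
  open O -> Cdiff m.+1 O f -> O x -> is_diff x f (pgrad f x).
Proof.
move=> oO [_ /= cf] Ox; apply: is_diff_pgrad => v.
  by apply: open_near oO Ox _ => y Oy; exact: (cf v).1.
by have [_] := cf v; case: m {cf} => [|m] [cD _]; exact: cD.
Qed.

Lemma Cdiff_deriveE (m : nat) (O : set V) f x v :
  open O -> Cdiff m.+1 O f -> O x -> 'D_v f x = pgrad f x v.
Proof.
by move=> oO Cf Ox; have [df dE] := Cdiff_is_diff oO Cf Ox; rewrite deriveE// dE.
Qed.

End coordinates.
Arguments ebase {R n} j.
Arguments etime {R n}.

(** * Chain rule for directional derivatives *)

Lemma derive_lineE {R : realType} {V W : normedModType R} (f : V -> W) x v :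
  'D_v f x = 'D_1 (fun h : R => f (h *: v + x)) 0.
Proof.
rewrite /derive; set g1 := fun h => h^-1 *: _; set g2 := fun h => h^-1 *: _.
suff -> : g1 = g2 by [].
by rewrite funeqE /g1 /g2 => h /=; rewrite addr0 scale0r add0r [_%:A]mulr1.
Qed.

Section chain.
Context {R : realType} {n : nat} {W : normedModType R}.
Local Notation V := ('rV[R]_n * R)%type.


Lemma is_derive_pair (a : W -> 'rV[R]_n) (b : W -> R) (y v : W)
    (da : 'I_n -> R) (db : R) :
  (forall j, is_derive y v (fun z => a z 0 j) (da j)) ->
  is_derive y v b db ->
  is_derive y v (fun z => (a z, b z) : V) (\row_j da j, db).
Proof.
move=> Ha Hb.
have dda : derivable a y v.
  by apply/derivable_mxP => i j; rewrite ord1; exact: ex_derive.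
have aE : 'D_v a y = \row_j da j.
  rewrite derive_mx//; apply/matrixP => i j; rewrite !mxE ord1.
  exact: derive_val.
have C : h^-1 *: ((((fun z => (a z, b z)) : W -> V) \o shift y) (h *: v)
    - (a y, b y)) @[h --> 0^'] --> ((\row_j da j, db) : V).
  have Ca : h^-1 *: ((a \o shift y) (h *: v) - a y) @[h --> 0^'] --> \row_j da j.
    by rewrite -aE; exact: dda.
  have Cb : h^-1 *: ((b \o shift y) (h *: v) - b y) @[h --> 0^'] --> db.
    by rewrite -(@derive_val _ _ _ _ _ _ _ Hb); exact: ex_derive.
  exact: (cvg_pair Ca Cb).
by split; [apply/cvg_ex; eexists; exact: C | exact: (cvg_lim _ C)].
Qed.

(** Only the outer function has to be differentiable in the strong sense: the inner one is
    restricted to a line through [y], and in one variable derivability is already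
    differentiability. *)
Lemma is_derive_chain (O : set V) (f : V -> R) (m : nat)
   (a : W -> 'rV[R]_n) (b : W -> R) (y v : W) (da : 'I_n -> R) (db : R) :
  open O -> Cdiff m.+1 O f -> O (a y, b y) ->
  (forall j, is_derive y v (fun z => a z 0 j) (da j)) ->
  is_derive y v b db ->
  is_derive y v (fun z => f (a z, b z))
    (\sum_j da j * 'D_(ebase j) f (a y, b y) + db * 'D_etime f (a y, b y)).
Proof.
move=> oO Cf Oy Ha Hb.
have [dc dcE] := is_derive_pair Ha Hb.
set c : W -> V := (fun z => (a z, b z)) in dc dcE.
have [df dfE] := Cdiff_is_diff oO Cf Oy.
have c0 : c (0 *: v + y) = c y by rewrite scale0r add0r.
pose ch (h : R) : V := c (h *: v + y).
have dch : derivable ch 0 1 := (derivable1P c y v).1 dc.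
have dch' : differentiable ch 0 := (derivable1_diffP ch 0).1 dch.
have df' : differentiable f (ch 0) by rewrite /ch c0.
have dfc : differentiable (f \o ch) 0 := differentiable_comp dch' df'.
have D : derivable (f \o ch) 0 1 := (derivable1_diffP (f \o ch : R -> R^o) 0).2 dfc.
split; first exact: (derivable1P (f \o c : W -> R^o) y v).2 D.
rewrite derive_lineE -/(f \o ch) (deriveE _ dfc) (diff_comp dch' df') /=.
rewrite -(deriveE _ dch') -[X in 'd f _ X](derive_lineE c).
rewrite dcE /ch c0 dfE /pgrad /=; congr (_ + _).
by apply: eq_bigr => j _; rewrite mxE.
Qed.

End chain.

(** * Symmetry of second derivatives and Taylor's formula *)

Section second_order.
Context {R : realType} {V : normedModType R}.
Implicit Types (f : V -> R) (x u v : V) (O : set V).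

(** Two mean value theorems: one in direction [u] for the increment of [f] in direction [v], then
    one in direction [v] for the derivative along [u]. Continuity of the mixed derivative at [x]
    does the rest. *)
Lemma second_difference f O x u v (eps : R) :
  open O -> Cdiff 2 O f -> O x -> 0 < eps ->
  exists2 d : R, 0 < d & forall h : R, 0 < h < d ->
    `|f (x + h *: u + h *: v) - f (x + h *: u) - (f (x + h *: v) - f x)
      - h ^+ 2 * 'D_v ('D_u f) x| <= eps * h ^+ 2.
Proof.
move=> oO [_ /= cf] Ox eps0.
have [_ [cu /= Hu]] := cf u.
have [du [cuv _]] := Hu v.
have /(@nbhs_ballP R V) [rho /= rho0 Hrho] : \forall y \near x,
    O y /\ `|'D_v ('D_u f) x - 'D_v ('D_u f) y| <= eps.
  near=> y; split; first by near: y; exact: open_nbhs_nbhs.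
  by near: y; move: (cuv _ Ox) => /cvgrPdist_le; exact.
pose E := 1 + `|u| + `|v|.
have E0 : 0 < E by rewrite /E ltr_wpDr// ltr_wpDr.
exists (rho / E); first exact: divr_gt0.
move=> h /andP[h0 hd].
have inball (s s' : R) : `|s| <= h -> `|s'| <= h -> ball x rho (x + s *: u + s' *: v).
  move=> hs hs'; rewrite -ball_normE /= -addrA opprD addNKr normrN.
  rewrite (le_lt_trans (ler_normD _ _))// !normrZ.
  rewrite (@le_lt_trans _ _ (h * E))//; last by rewrite -ltr_pdivlMr.
  rewrite /E -addrA mulrDr mulr1 mulrDr; apply: ler_wpDl; first exact: ltW.
  by rewrite lerD// ler_wpM2r.
have fd y w : O y -> derivable f y w by move=> Oy; have [+ _] := cf w; exact.
pose g y := f (y + h *: v) - f y.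
have gd (s : R) : `|s| <= `|h| -> is_derive (x + s *: u) u g
    ('D_u f (x + s *: u + h *: v) - 'D_u f (x + s *: u)).
  rewrite (gtr0_norm h0) => hs.
  have O1 : O (x + s *: u + h *: v).
    by apply: (Hrho _ _).1; apply: inball => //; rewrite gtr0_norm.
  have O2 : O (x + s *: u).
    apply: (Hrho _ _).1; rewrite -[_ + _]addr0 -(scale0r v).
    by apply: inball => //; rewrite normr0 ltW.
  have D1 : is_derive (x + s *: u) u (fun y => f (y + h *: v))
      ('D_u f (x + s *: u + h *: v)).
    have := derivableP (fd _ u O1).
    move: (x + s *: u) => y [d1 d2].
    have E1 : (fun k : R => k^-1 *: (((fun y => f (y + h *: v)) \o shift y) (k *: u)
          - f (y + h *: v)))
        = (fun k : R => k^-1 *: ((f \o shift (y + h *: v)) (k *: u) - f (y + h *: v))).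
      by apply/funext => k /=; rewrite addrA.
    by split; [rewrite /derivable E1 | rewrite /derive E1].
  have D2 := derivableP (fd _ u O2).
  exact: is_deriveB.
have [s hs gE] : exists2 s : R, `|s| <= `|h| & g (x + h *: u) - g x = h * 'D_u g (x + s *: u).
  by apply: MVT_line => s /gd ?; exact: ex_derive.
have ds := gd _ hs; rewrite (@derive_val _ _ _ _ _ _ _ ds) in gE.
have hs1 : `|s| <= h by rewrite (gtr0_norm h0) in hs.
have [s' hs' dE] : exists2 s' : R, `|s'| <= `|h| &
   'D_u f (x + s *: u + h *: v) - 'D_u f (x + s *: u)
   = h * 'D_v ('D_u f) (x + s *: u + s' *: v).
  apply: MVT_line => s'; rewrite (gtr0_norm h0) => hs'; apply: du.
  by apply: (Hrho _ _).1; exact: inball.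
rewrite (gtr0_norm h0) in hs'.
have -> : f (x + h *: u + h *: v) - f (x + h *: u) - (f (x + h *: v) - f x)
   = h ^+ 2 * 'D_v ('D_u f) (x + s *: u + s' *: v).
  by rewrite -/(g (x + h *: u)) -/(g x) gE dE expr2 mulrA.
rewrite -mulrBr normrM (ger0_norm (exprn_ge0 2 (ltW h0))) [leLHS]mulrC.
apply: ler_wpM2r; first by apply: exprn_ge0; exact: ltW.
by rewrite distrC; apply: (Hrho _ _).2; exact: inball.
Unshelve. all: by end_near. Qed.

(** Schwarz's theorem: the second difference is symmetric in [u] and [v], and both mixed derivatives
    approximate it up to o(h^2). *)
Lemma derive_swap f O x u v : open O -> Cdiff 2 O f -> O x ->
  'D_v ('D_u f) x = 'D_u ('D_v f) x.
Proof.
move=> oO Cf Ox; apply/eqP; rewrite -subr_eq0 -normr_eq0; apply/negPn/negP => D0.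
have [D DE] : exists D, D = `|'D_v ('D_u f) x - 'D_u ('D_v f) x| by eexists.
rewrite -DE in D0.
have D0' : 0 < D by rewrite lt_neqAle eq_sym D0 DE normr_ge0.
(* With tolerance [D / 3] in both orders the gap [D] would be at most [2 / 3 * D]. *)
have [d1 d10 H1] := second_difference u v oO Cf Ox (divr_gt0 D0' (ltr0Sn R 2)).
have [d2 d20 H2] := second_difference v u oO Cf Ox (divr_gt0 D0' (ltr0Sn R 2)).
pose h := Num.min d1 d2 / 2.
have m0 : 0 < Num.min d1 d2 by rewrite lt_min d10.
have hm : h < Num.min d1 d2 by rewrite /h ltr_pdivrMr// ltr_pMr// ltr1n.
have h0 : 0 < h by exact: divr_gt0.
have := H1 h; have := H2 h; rewrite h0 /=.
move: hm; rewrite lt_min => /andP[-> ->] => /(_ isT) A /(_ isT) B.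
have h20 : 0 < h ^+ 2 by rewrite exprn_gt0.
have : D * h ^+ 2 <= 2 / 3 * D * h ^+ 2.
  rewrite {1}DE -[X in _ * X <= _](gtr0_norm h20) -normrM.
  rewrite (_ : _ * _ = (f (x + h *: v + h *: u) - f (x + h *: v) - (f (x + h *: u) - f x)
      - h ^+ 2 * 'D_u ('D_v f) x) - (f (x + h *: u + h *: v) - f (x + h *: u) -
      (f (x + h *: v) - f x) - h ^+ 2 * 'D_v ('D_u f) x)).
    rewrite (le_trans (ler_normB _ _))// (le_trans (lerD A B))//.
    suff -> : 2 / 3 * D * h ^+ 2 = D / 3 * h ^+ 2 + D / 3 * h ^+ 2 by [].
    by move: (h) => k; field.
  rewrite [x + h *: v + h *: u]addrAC; move: (h ^+ 2) (f _) (f _) (f _) (f _) ('D_u _ x) ('D_v _ x).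
  clear=> a1 a2 a3 a4 a5 a6 a7.
  by ring.
rewrite ler_pM2r//; move: D0'; clear; lra.
Qed.

Lemma taylor2 f O x v : open O -> Cdiff 2 O f ->
  (forall s : R, 0 <= s <= 1 -> O (x + s *: v)) ->
  exists2 s : R, 0 <= s <= 1 &
    f (x + v) - f x - 'D_v f x = 2^-1 * 'D_v ('D_v f) (x + s *: v).
Proof.
move=> oO [_ /= cf] Os; have [df [_ /= cD]] := cf v; have [ddf _] := cD v.
set c := _ - _ - _.
(* The quadratic correction is chosen so that [phi 1 - phi 0] equals the derivative of [f] at [x]
   along [v]; the mean value theorem for [phi], then for that derivative, identifies [c]. *)
pose phi (s : R) := f (x + s *: v) - s ^+ 2 * c.
have dphi (s : R) : 0 <= s <= 1 ->
    is_derive s 1 phi ('D_v f (x + s *: v) - 2 * s * c).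
  move=> s01.
  have D1 : is_derive s 1 (fun h : R => f (x + h *: v)) ('D_v f (x + s *: v)).
    by apply: is_derive_line; apply: derivableP; apply: df; exact: Os.
  have D2 : is_derive s 1 (fun h : R => h ^+ 2 * c) (2 * s * c).
    apply: is_derive_eq.
    by rewrite /GRing.scale /= mulr0 add0r mulr1 mulrC mulr_natl mulr2n.
  exact: is_deriveB.
have [||s] := @MVT R phi (fun s => 'D_v f (x + s *: v) - 2 * s * c) 0 1 ltr01.
- by move=> s; rewrite in_itv/= => /andP[s0 s1]; apply: dphi; rewrite !ltW.
- by apply: derivable_within_continuous => s; rewrite in_itv/= => /dphi ?; exact: ex_derive.
rewrite in_itv/= => /andP[s0 s1]; rewrite /phi scale0r addr0 scale1r subr0 mulr1.
rewrite expr1n mul1r expr0n mul0r subr0 => E.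
have H (k : R) : 0 <= k <= s -> is_derive k 1 (fun h : R => 'D_v f (x + h *: v))
    ('D_v ('D_v f) (x + k *: v)).
  move=> /andP[k0 ks]; have k01 : 0 <= k <= 1 by rewrite k0 (le_trans ks (ltW s1)).
  exact: (is_derive_line (derivableP (ddf _ (Os _ k01)))).
have [||s'] := @MVT R (fun h : R => 'D_v f (x + h *: v))
  (fun k => 'D_v ('D_v f) (x + k *: v)) 0 s s0.
- by move=> k; rewrite in_itv/= => /andP[k0 ks]; apply: H; rewrite !ltW.
- by apply: derivable_within_continuous => k; rewrite in_itv/= => /H ?; exact: ex_derive.
rewrite in_itv/= => /andP[s'0 s's]; rewrite scale0r addr0 subr0 => E2.
exists s'; first by rewrite (ltW s'0) ltW// (lt_trans s's).
have E3 : 'D_v f (x + s *: v) - 'D_v f x = 2 * s * c by rewrite /c in E *; lra.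
apply: (mulIf (lt0r_neq0 s0)); rewrite -mulrA -E2 E3.
by move: (c) (s) => a b; field.
Qed.

End second_order.

Lemma cvg_sumr {R : realType} {T : Type} (F : set_system T) {FF : Filter F}
    (I : Type) (r : seq I) (P : pred I) (f : I -> T -> R) (l : I -> R) :
  (forall i, P i -> f i x @[x --> F] --> l i) ->
  \sum_(i <- r | P i) f i x @[x --> F] --> \sum_(i <- r | P i) l i.
Proof.
move=> H; apply: cvg_big => //.
exact: add_continuous.
Qed.

(** * Functions continuously differentiable in one direction *)

Section C1dir.
Context {R : realType} {W : normedModType R}.
Variables (O : set W) (d : W).
Hypothesis oO : open O.
Implicit Types f g : W -> R.

(** One fixed direction is the right amount of regularity: the gradients of velocity and temperature
    of a strong solution are only known to be differentiable in space, and a flux component only has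
    to be differentiated in its own direction. *)
Definition C1dir f : Prop :=
  [/\ forall z, O z -> {for z, continuous f},
      forall z, O z -> derivable f z d
    & forall z, O z -> {for z, continuous ('D_d f)}].

Lemma C1dir_intro f df :
  (forall z, O z -> {for z, continuous f}) ->
  (forall z, O z -> is_derive z d f (df z)) ->
  (forall z, O z -> {for z, continuous df}) -> C1dir f.
Proof.
move=> cf dfE cdf; split=> // z Oz; first exact: (@ex_derive _ _ _ _ _ _ _ (dfE _ Oz)).
have E : \forall y \near z, df y = 'D_d f y.
  apply: open_near oO Oz _ => y Oy.
  by rewrite (@derive_val _ _ _ _ _ _ _ (dfE _ Oy)).
rewrite /prop_for /continuous_at -(nbhs_singleton E).
by apply: cvg_trans (cdf _ Oz); apply: near_eq_cvg; exact: E.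
Qed.

Lemma C1dir_is_derive f z : C1dir f -> O z -> is_derive z d f ('D_d f z).
Proof. by move=> [_ df _] Oz; apply: derivableP; exact: df. Qed.

Lemma C1dir_cst c : C1dir (fun=> c).
Proof.
by apply: (@C1dir_intro _ (fun=> 0)) => z Oz; exact: cvg_cst.
Qed.

Lemma C1dirD f g : C1dir f -> C1dir g -> C1dir (fun z => f z + g z).
Proof.
move=> Cf Cg; have [cf _ cdf] := Cf; have [cg _ cdg] := Cg.
apply: (@C1dir_intro _ (fun z => 'D_d f z + 'D_d g z)) => z Oz.
- by apply: cvgD; [exact: cf | exact: cg].
- by have ? := C1dir_is_derive Cf Oz; have ? := C1dir_is_derive Cg Oz; exact: is_deriveD.
- by apply: cvgD; [exact: cdf | exact: cdg].
Qed.

Lemma C1dirM f g : C1dir f -> C1dir g -> C1dir (fun z => f z * g z).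
Proof.
move=> Cf Cg; have [cf _ cdf] := Cf; have [cg _ cdg] := Cg.
apply: (@C1dir_intro _ (fun z => f z * 'D_d g z + g z * 'D_d f z)) => z Oz.
- by apply: cvgM; [exact: cf | exact: cg].
- by have ? := C1dir_is_derive Cf Oz; have ? := C1dir_is_derive Cg Oz; exact: is_deriveM.
- apply: cvgD; apply: cvgM; [exact: cf|exact: cdg|exact: cg|exact: cdf].
Qed.

Lemma C1dirN f : C1dir f -> C1dir (fun z => - f z).
Proof.
move=> Cf; rewrite (_ : (fun z => - f z) = (fun z => (-1) * f z)); last first.
  by apply/funext => z; rewrite mulN1r.
exact: C1dirM (C1dir_cst _) Cf.
Qed.

Lemma C1dirB f g : C1dir f -> C1dir g -> C1dir (fun z => f z - g z).
Proof. by move=> Cf Cg; apply: C1dirD Cf _; exact: C1dirN. Qed.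

Lemma C1dirX f m : C1dir f -> C1dir (fun z => f z ^+ m).
Proof.
move=> Cf; elim: m => [|m IH]; first exact: C1dir_cst.
rewrite (_ : (fun z => _) = (fun z => f z * f z ^+ m)); first exact: C1dirM.
by apply/funext => z; rewrite exprS.
Qed.

Lemma C1dir_sum (I : Type) (r : seq I) (P : pred I) (F : I -> W -> R) :
  (forall i, P i -> C1dir (F i)) -> C1dir (fun z => \sum_(i <- r | P i) F i z).
Proof.
move=> CF; elim: r => [|i r IH].
  rewrite (_ : (fun z => _) = (fun=> 0)); first exact: C1dir_cst.
  by apply/funext => z; rewrite big_nil.
case Pi: (P i).
  rewrite (_ : (fun z => _) = (fun z => F i z + \sum_(i <- r | P i) F i z)).
    by apply: C1dirD IH; exact: CF.
  by apply/funext => z; rewrite big_cons Pi.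
rewrite (_ : (fun z => _) = (fun z => \sum_(i <- r | P i) F i z))//.
by apply/funext => z; rewrite big_cons Pi.
Qed.

Lemma C1dirV f : (forall z, O z -> f z != 0) -> C1dir f -> C1dir (fun z => (f z)^-1).
Proof.
move=> f0 Cf; have [cf df cdf] := Cf.
apply: (@C1dir_intro _ (fun z => - (f z)^-2 * 'D_d f z)) => z Oz.
- by apply: cvgV; [exact: f0 | exact: cf].
- split; first by apply: derivableV; [exact: f0 | exact: df].
  by rewrite deriveV//; [exact: f0 | exact: df].
- apply: cvgM; last exact: cdf.
  apply: cvgN; apply: cvgV; first by rewrite expf_neq0// f0.
  by rewrite expr2; apply: cvgM; exact: cf.
Qed.

Lemma C1dir_eq f g : (forall z, O z -> f z = g z) -> C1dir f -> C1dir g.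
Proof.
move=> fg Cf; have [cf df cdf] := Cf.
have N z : O z -> \forall y \near z, f y = g y.
  by move=> Oz; apply: open_near oO Oz _ => y; exact: fg.
apply: (@C1dir_intro _ ('D_d f)) => z Oz.
- rewrite /prop_for /continuous_at -(nbhs_singleton (N _ Oz)).
  by apply: cvg_trans (cf _ Oz); apply: near_eq_cvg; have := N _ Oz; apply: filterS => y ->.
- apply: near_eq_is_derive (N _ Oz) _; exact: C1dir_is_derive.
- exact: cdf.
Qed.

Lemma Cdiff_C1dir m f : Cdiff m.+1 O f -> C1dir f.
Proof.
move=> [cf /= Df]; have [df Cd] := Df d; split=> //.
by case: m {Df} Cd => [|m] [].
Qed.

Context {n : nat}.
Local Notation V := ('rV[R]_n * R)%type.

Lemma continuous_pair_row (a : W -> 'rV[R]_n) (b : W -> R) (z : W) :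
  (forall j, {for z, continuous (fun y => a y 0 j)}) ->
  {for z, continuous b} -> {for z, continuous (fun y => (a y, b y) : V)}.
Proof.
move=> ca cb; suff ca' : a y @[y --> z] --> a z by exact: (cvg_pair ca' cb).
apply/cvgrPdist_le => e e0; near=> y.
rewrite [leLHS]/Num.Def.normr/= mx_normrE (bigmax_le _ (ltW e0))//= => -[i j] _.
rewrite !mxE ord1 /=; move: j; near: y; apply: filter_forall => j.
by move: (ca j) => /cvgrPdist_le; exact.
Unshelve. all: by end_near. Qed.

Lemma C1dir_chain (Q : set V) (f : V -> R) m (a : W -> 'rV[R]_n) (b : W -> R) :
  open Q -> Cdiff m.+1 Q f -> (forall z, O z -> Q (a z, b z)) ->
  (forall j, C1dir (fun z => a z 0 j)) -> C1dir b ->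
  C1dir (fun z => f (a z, b z)).
Proof.
move=> oQ Cf Qab Ca Cb.
have cab z : O z -> {for z, continuous (fun y => (a y, b y) : V)}.
  move=> Oz; apply: continuous_pair_row => [j|]; first by have [+ _ _] := Ca j; exact.
  by have [+ _ _] := Cb; exact.
have cD e z : O z -> {for z, continuous (fun y => 'D_e f (a y, b y))}.
  move=> Oz; have [_ /= Df] := Cf; have [_ Cd] := Df e.
  apply: (@continuous_comp _ _ _ (fun y => (a y, b y) : V) ('D_e f)); first exact: cab.
  by case: m {Cf Df} Cd => [|m] [+ _]; apply; exact: Qab.
apply: (@C1dir_intro _ (fun z => \sum_j 'D_d (fun z => a z 0 j) z * 'D_(ebase j) f (a z, b z)
    + 'D_d b z * 'D_etime f (a z, b z))) => z Oz.
- apply: (@continuous_comp _ _ _ (fun y => (a y, b y) : V) f); first exact: cab.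
  by have [+ _] := Cf; apply; exact: Qab.
- apply: is_derive_chain oQ Cf (Qab _ Oz) _ _; last exact: C1dir_is_derive.
  by move=> j; exact: (C1dir_is_derive (Ca j)).
- apply: cvgD; last by apply: cvgM; [have [_ _ +] := Cb; exact | exact: cD].
  apply: cvg_sumr => j _; apply: cvgM; [have [_ _ +] := Ca j; exact | exact: cD].
Qed.

End C1dir.

(** * Linear pullback and bounds on compact sets *)

Section pullback.
Context {R : realType} {V V' : normedModType R}.

Lemma derive_pullback (L : {linear V' -> V}) (f : V -> R) x v :
  (derivable f (L x) (L v) -> derivable (f \o L) x v)
  /\ 'D_v (f \o L) x = 'D_(L v) f (L x).
Proof.
have E : (fun h : R => h^-1 *: (((f \o L) \o shift x) (h *: v) - (f \o L) x))
     = (fun h : R => h^-1 *: ((f \o shift (L x)) (h *: L v) - f (L x))).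
  by apply/funext => h /=; rewrite linearP.
by split; rewrite /derivable /derive E.
Qed.

Lemma Cdiff_pullback (L : {linear V' -> V}) m (O : set V) (f : V -> R) :
  continuous L -> Cdiff m O f -> Cdiff m (L @^-1` O) (f \o L).
Proof.
move=> cL; elim: m f => [|m IH] f [cf Hf]; split=> //.
- by move=> x Ox; apply: continuous_comp; [exact: cL | exact: cf].
- by move=> x Ox; apply: continuous_comp; [exact: cL | exact: cf].
- move=> v; have [df Cd] := Hf (L v); split.
    by move=> x Ox; apply: (derive_pullback L f x v).1; exact: df.
  rewrite (_ : (fun x => _) = 'D_(L v) f \o L); first exact: IH.
  by apply/funext => x; rewrite (derive_pullback L f x v).2.
Qed.

End pullback.

Section compact_bounds.
Context {R : realType}.

Lemma compact_bound (T : topologicalType) (K : set T) (f : T -> R) :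
  compact K -> {within K, continuous f} ->
  exists2 M : R, 0 < M & forall x, K x -> `|f x| <= M.
Proof.
move=> cK cf.
have [K0|/set0P/negP/negPn/eqP ->] := pselect (K !=set0); last first.
  by exists 1 => // x [].
have cfn : {within K, continuous (fun x => `|f x|)}.
  by move=> x; apply: continuous_comp; [exact: cf | exact: norm_continuous].
have [c cK' H] := compact_EVT_max K0 cK cfn.
exists (1 + `|f c|); first by rewrite ltr_pwDl.
by move=> x Kx; rewrite (le_trans (H x _)) ?inE// lerDr.
Qed.

Lemma compact_bound_fin (T : topologicalType) (K : set T) (I : finType) (f : I -> T -> R) :
  compact K -> (forall i, {within K, continuous (f i)}) ->
  exists2 M : R, 0 < M & forall i x, K x -> `|f i x| <= M.
Proof.
move=> cK cf.
have /choice [M HM] : forall i, exists M : R, 0 < M /\ forall x, K x -> `|f i x| <= M.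
  by move=> i; have [M M0 H] := compact_bound cK (cf i); exists M.
exists (1 + \sum_i M i).
  by rewrite ltr_wpDr// sumr_ge0// => i _; rewrite ltW//; exact: (HM i).1.
move=> i x Kx; rewrite (le_trans ((HM i).2 _ Kx))// (bigD1 i)//= addrCA lerDl.
by rewrite addr_ge0// sumr_ge0// => j _; rewrite ltW//; exact: (HM j).1.
Qed.

Lemma within_continuous_at (T U : topologicalType) (K : set T) (f : T -> U) :
  (forall x, K x -> {for x, continuous f}) -> {within K, continuous f}.
Proof.
by move=> cf; apply: continuous_in_subspaceT => x; rewrite inE; exact: cf.
Qed.

End compact_bounds.

(** * Measurability and integration on the torus *)

Section caratheodory.
Context {R : realType} {d : measure_display} {T : measurableType d}.

(* A function measurable in x and continuous in y is the limit of its values at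
   the grid points floor ((n+1) y) / (n+1). *)
Lemma measurable_fun_caratheodory (f : T * R -> R) :
  (forall y, measurable_fun setT (fun x => f (x, y))) ->
  (forall x, continuous (fun y => f (x, y))) ->
  measurable_fun setT f.
Proof.
move=> mf cf.
pose r (n : nat) (y : R) : R := (Num.floor (y * n.+1%:R))%:~R / n.+1%:R.
apply: (@measurable_fun_cvg _ _ _ _ (fun n z => f (z.1, r n z.2))).
  move=> n _ B mB; rewrite setTI.
  pose S (k : int) : set R := [set` `[k%:~R / n.+1%:R, (k + 1)%:~R / n.+1%:R[].
  have -> : (fun z : T * R => f (z.1, r n z.2)) @^-1` B =
      \bigcup_(k : int) (((fun x => f (x, k%:~R / n.+1%:R)) @^-1` B) `*` S k).
    apply/seteqP; split => [[x y] /= Bxy|[x y] /= [k _ [/= Bx]]].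
      exists (Num.floor (y * n.+1%:R)) => //; split => //=.
      rewrite /S /= in_itv/= ler_pdivrMr ?ltr0Sn// ltr_pdivlMr ?ltr0Sn//.
      by rewrite floor_itv.
    rewrite /S /= in_itv/= ler_pdivrMr ?ltr0Sn// ltr_pdivlMr ?ltr0Sn// => Hk.
    by rewrite /r (floor_def Hk).
  apply: countable_bigcupT_measurable; first exact: countableP.
  move=> k; apply: measurableX; last exact: measurable_itv.
  by rewrite -[X in measurable X]setTI; exact: mf.
move=> [x y] _ /=.
have rc : r n y @[n --> \oo] --> y.
  apply/cvgrPdist_le => e e0.
  have [N _ HN] := near_infty_natSinv_lt (PosNum e0).
  exists N => // n /= Nn; rewrite /r.
  have := HN n Nn => /= en.
  have n0 : 0 < n.+1%:R :> R by rewrite ltr0Sn.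
  have h1 := floor_le (y * n.+1%:R); have h2 := floorD1_gt (y * n.+1%:R).
  set k := (Num.floor _)%:~R in h1 h2 *.
  rewrite ger0_norm; last by rewrite subr_ge0 ler_pdivrMr.
  apply: le_trans (ltW en).
  rewrite lerBlDl -[X in _ + X]mul1r -mulrDl ler_pdivlMr// ltW//.
  by move: h2; rewrite intrD.
exact: (cvg_comp _ (fun y => f (x, y)) rc (cf x y)).
Qed.

End caratheodory.

Lemma continuous_pairl (X Y : topologicalType) (y : Y) :
  continuous (fun x : X => (x, y)).
Proof.
move=> x; have h1 : id u @[u --> x] --> x by exact: cvg_id.
have h2 : (fun=> y) u @[u --> x] --> y by exact: cvg_cst.
exact: (cvg_pair h1 h2).
Qed.

Lemma continuous_pairr (X Y : topologicalType) (x : X) :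
  continuous (fun y : Y => (x, y)).
Proof.
move=> y; have h1 : id u @[u --> y] --> y by exact: cvg_id.
have h2 : (fun=> x) u @[u --> y] --> x by exact: cvg_cst.
exact: (cvg_pair h2 h1).
Qed.

Section torus.
Context {R : realType}.
Local Notation lam := (@lebesgue_measure R).
Local Notation mu3 := ((lam \x lam) \x lam)%E.

Definition cube : set (R * R * R) := (`[0, 1] `*` `[0, 1]) `*` `[0, 1].

Lemma point3_continuous : continuous (@point3 R).
Proof.
move=> z; apply/cvgrPdist_le => e e0; near=> y.
rewrite [leLHS]/Num.Def.normr/= mx_normrE (bigmax_le _ (ltW e0))//= => -[i j] _.
rewrite !mxE /=; case: j => -[|[|[|//]]] /= _; near: y.
- have : {for z, continuous (fun y : R * R * R => y.1.1)}.
    by apply: continuous_comp; exact: cvg_fst.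
  by move=> /cvgrPdist_le; exact.
- have : {for z, continuous (fun y : R * R * R => y.1.2)}.
    by apply: continuous_comp; [exact: cvg_fst | exact: cvg_snd].
  by move=> /cvgrPdist_le; exact.
- have : {for z, continuous (fun y : R * R * R => y.2)} by exact: cvg_snd.
  by move=> /cvgrPdist_le; exact.
Unshelve. all: by end_near. Qed.

(** Measurability refers to the product sigma-algebra; the criterion just proved only asks for
    measurability in one variable and continuity in the other, so coordinates can be added one at a
    time. *)
Lemma measurable_fun_continuous2 (f : R * R -> R) : continuous f -> measurable_fun setT f.
Proof.
move=> cf; apply: measurable_fun_caratheodory => [y|x].
  apply: continuous_measurable_fun => x.
  apply: (@continuous_comp _ _ _ (fun x => (x, y)) f); [exact: continuous_pairl | exact: cf].
move=> y; apply: (@continuous_comp _ _ _ (fun y => (x, y)) f); [exact: continuous_pairr | exact: cf].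
Qed.

Lemma measurable_fun_continuous3 (f : R * R * R -> R) :
  continuous f -> measurable_fun setT f.
Proof.
move=> cf; apply: measurable_fun_caratheodory => [y|x].
  apply: measurable_fun_continuous2 => x.
  apply: (@continuous_comp _ _ _ (fun x => (x, y)) f); [exact: continuous_pairl | exact: cf].
move=> y; apply: (@continuous_comp _ _ _ (fun y => (x, y)) f); [exact: continuous_pairr | exact: cf].
Qed.

Local Notation mR := (measurableTypeR R).

Lemma measurable_cube : measurable (cube : set (mR * mR * mR)).
Proof. by apply: measurableX; [apply: measurableX|]; exact: measurable_itv. Qed.

Lemma compact_cube : compact cube.
Proof. by do 2?apply: compact_setX; exact: segment_compact. Qed.

Lemma mu3_cube : mu3 cube = 1%E.
Proof.
have m01 : measurable (`[0, 1] : set mR) by exact: measurable_itv.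
have l01 : lam `[0, 1] = 1%E.
  by rewrite lebesgue_measure_itv/= lte_fin ltr01 oppr0 adde0.
have E1 : (lam \x lam)%E (`[0, 1] `*` `[0, 1]) = 1%E.
  rewrite [LHS](product_measure1E _ _ m01 m01) -[RHS]mule1.
  by congr (_ * _)%E; exact: l01.
rewrite [LHS](product_measure1E _ _ (measurableX m01 m01) m01) -[RHS]mule1.
by congr (_ * _)%E; [exact: E1 | exact: l01].
Qed.

Lemma integrable_cube (f : R * R * R -> R) :
  continuous f -> mu3.-integrable cube (EFin \o f).
Proof.
move=> cf; apply: measurable_bounded_integrable.
- exact: measurable_cube.
- suff : (mu3 cube < +oo)%E by [].
  by rewrite mu3_cube ltry.
- by apply: measurable_funTS; exact: measurable_fun_continuous3.
- have [M M0 HM] := compact_bound compact_cube (@within_continuous_at _ _ cube f (fun x _ => cf x)).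
  by exists M; split; [exact: num_real|move=> x Mx y Cy; exact: le_trans (HM y Cy) (ltW Mx)].
Qed.

Definition Tint (f : 'rV[R]_3 -> R) : R := \int[mu3]_(z in cube) f (point3 z).

Lemma integrable_torus (f : 'rV[R]_3 -> R) :
  continuous f -> mu3.-integrable cube (EFin \o (f \o @point3 R)).
Proof.
move=> cf; apply: integrable_cube => z.
by apply: continuous_comp; [exact: point3_continuous | exact: cf].
Qed.

Lemma torus_intE (f : 'rV[R]_3 -> R) : continuous f -> torus_int f = (Tint f)%:E.
Proof.
move=> cf; have H := integrable_fin_num measurable_cube (integrable_torus cf).
exact: (esym (fineK H)).
Qed.

Lemma TintD (f g : 'rV[R]_3 -> R) : continuous f -> continuous g ->
  Tint (fun x => f x + g x) = Tint f + Tint g.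
Proof.
by move=> cf cg; apply: RintegralD; [exact: measurable_cube|exact: integrable_torus..].
Qed.

Lemma TintZ (f : 'rV[R]_3 -> R) (c : R) : continuous f ->
  Tint (fun x => c * f x) = c * Tint f.
Proof.
by move=> cf; apply: RintegralZl; [exact: measurable_cube|exact: integrable_torus].
Qed.

Lemma Tint_cst (c : R) : Tint (fun=> c) = c.
Proof.
rewrite /Tint Rintegral_cst; last exact: measurable_cube.
by have -> : fine (mu3 cube) = 1 by [rewrite mu3_cube]; rewrite mulr1.
Qed.

Lemma le_Tint (f g : 'rV[R]_3 -> R) : continuous f -> continuous g ->
  (forall z, cube z -> f (point3 z) <= g (point3 z)) -> Tint f <= Tint g.
Proof.
move=> cf cg fg; apply: le_Rintegral => //;
  [exact: measurable_cube|exact: integrable_torus..].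
Qed.

Lemma Tint_ge0 (f : 'rV[R]_3 -> R) :
  (forall z, cube z -> 0 <= f (point3 z)) -> 0 <= Tint f.
Proof. by move=> f0; apply: Rintegral_ge0. Qed.

Lemma Tint_sum (I : Type) (r : seq I) (f : I -> 'rV[R]_3 -> R) :
  (forall i, continuous (f i)) ->
  Tint (fun x => \sum_(i <- r) f i x) = \sum_(i <- r) Tint (f i).
Proof.
move=> cf; elim: r => [|i r IH].
  rewrite big_nil -[RHS](Tint_cst 0); congr Tint.
  by apply/funext => x; rewrite big_nil.
rewrite big_cons -IH -TintD//; last first.
  move=> x.
  exact: (@cvg_sumr R _ (nbhs x) (nbhs_filter x) I r xpredT f (fun i => f i x) (fun i _ => cf i x)).
by congr Tint; apply/funext => x; rewrite big_cons.
Qed.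

(** Fubini in the form used for periodic derivatives: if the inner integrals vanish, so does the
    whole integral. The companion lemma integrates in the other order. *)
Lemma integral_prod_eq0_12 d1 d2 (X : measurableType d1) (Y : measurableType d2)
    (m1 : {sigma_finite_measure set X -> \bar R})
    (m2 : {sigma_finite_measure set Y -> \bar R}) (A : set X) (B : set Y)
    (f : X * Y -> R) :
  measurable A -> measurable B -> (m1 \x m2)%E.-integrable (A `*` B) (EFin \o f) ->
  (forall x, A x -> (\int[m2]_(y in B) (f (x, y))%:E = 0)%E) ->
  (\int[m1 \x m2]_(z in A `*` B) (f z)%:E = 0)%E.
Proof.
move=> mA mB fi f0; rewrite integral_mkcond.
have fi' : (m1 \x m2)%E.-integrable setT ((EFin \o f) \_ (A `*` B)).
  by rewrite -integrable_mkcond//; exact: measurableX.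
rewrite -(integral12_prod_meas1 fi') integral0_eq// => x _.
rewrite /fubini_F; have [Ax|nAx] := pselect (A x).
  rewrite -[RHS](f0 x Ax) [RHS]integral_mkcond; apply: eq_integral => y _.
  rewrite !patchE; congr (if _ then _ else _).
  by apply/idP/idP; rewrite !inE; [case | split].
apply: integral0_eq => y _; rewrite patchE ifF//.
by apply/negP; rewrite inE => -[].
Qed.

Lemma integral_prod_eq0_21 d1 d2 (X : measurableType d1) (Y : measurableType d2)
    (m1 : {sigma_finite_measure set X -> \bar R})
    (m2 : {sigma_finite_measure set Y -> \bar R}) (A : set X) (B : set Y)
    (f : X * Y -> R) :
  measurable A -> measurable B -> (m1 \x m2)%E.-integrable (A `*` B) (EFin \o f) ->
  (forall y, B y -> (\int[m1]_(x in A) (f (x, y))%:E = 0)%E) ->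
  (\int[m1 \x m2]_(z in A `*` B) (f z)%:E = 0)%E.
Proof.
move=> mA mB fi f0; rewrite integral_mkcond.
have fi' : (m1 \x m2)%E.-integrable setT ((EFin \o f) \_ (A `*` B)).
  by rewrite -integrable_mkcond//; exact: measurableX.
rewrite -(integral21_prod_meas1 fi') integral0_eq// => y _.
rewrite /fubini_G; have [By|nBy] := pselect (B y).
  rewrite -[RHS](f0 y By) [RHS]integral_mkcond; apply: eq_integral => x _.
  rewrite !patchE; congr (if _ then _ else _).
  by apply/idP/idP; rewrite !inE; [case | split].
apply: integral0_eq => x _; rewrite patchE ifF//.
by apply/negP; rewrite inE => -[].
Qed.

(** The fundamental theorem of calculus on a segment whose endpoints are identified by the period
    [v]. *)
Lemma integral_derive_periodic (f : 'rV[R]_3 -> R) (v x : 'rV[R]_3) :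
  (forall y, derivable f y v) -> continuous ('D_v f) ->
  (forall y, f (y + v) = f y) ->
  (\int[lam]_(s in `[0%R, 1%R]) ('D_v f (x + s *: v)%R)%:E = 0)%E.
Proof.
move=> df cD fp.
have D (s : R) : is_derive s 1 (fun s : R => f (x + s *: v)) ('D_v f (x + s *: v)).
  by apply: is_derive_line; exact: derivableP (df _).
have cl : continuous (fun s : R => x + s *: v).
  move=> s; apply: cvgD; first exact: cvg_cst.
  exact: scalel_continuous.
rewrite (@continuous_FTC2 _ _ (fun s : R => f (x + s *: v)) 0 1 ltr01).
- by rewrite scale1r scale0r addr0 fp subee.
- by apply: within_continuous_at => s _; exact: (cvg_comp _ ('D_v f) (cl s) (cD _)).
- have c s : {for s, continuous (fun s : R => f (x + s *: v))}.
    by apply/differentiable_continuous/derivable1_diffP; exact: ex_derive.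
  split.
  + by move=> s _; exact: ex_derive.
  + by apply: cvg_at_right_filter; exact: c.
  + by apply: cvg_at_left_filter; exact: c.
- by move=> s _; rewrite derive1E derive_val.
Qed.

End torus.

(* In the library the product of two sigma-finite measures is only found
   canonically sigma-finite when both are subprobabilities. *)
Section product_lebesgue.
Variable R : realType.
Local Notation lam := (@lebesgue_measure R).
Local Notation mR := (measurableTypeR R).

Definition lam2 : set (mR * mR) -> \bar R := (lam \x lam)%E.

HB.instance Definition _ := Measure.on lam2.

Lemma lam2_sigma_finite : sigma_finite setT lam2.
Proof.
have /sigma_finiteP [F [FT Fnd Foo]] := sigma_finiteT lam.
exists (fun n => F n `*` F n).
  rewrite -setXTT predeqE => -[x y]; split=> // _.
  have : setT x by []; have : setT y by [].
  rewrite FT => -[n _ Fy] [m _ Fx]; exists (maxn n m) => //; split => /=.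
    by apply: subsetPset (Fnd m (maxn n m) (leq_maxr _ _)) x Fx.
  by apply: subsetPset (Fnd n (maxn n m) (leq_maxl _ _)) y Fy.
move=> n; have [mF Fn] := Foo n; split; first exact: measurableX.
rewrite /lam2 [X in (X < _)%E](product_measure1E _ _ mF mF).
by apply: lte_mul_pinfty => //; rewrite ge0_fin_numE.
Qed.

HB.instance Definition _ := Measure_isSigmaFinite.Build _ _ _ lam2 lam2_sigma_finite.

End product_lebesgue.

(** * Integration by parts, parameter integrals and Gronwall's inequality *)

Section torus_calculus.
Context {R : realType}.
Local Notation lam := (@lebesgue_measure R).
Local Notation mu3 := ((lam \x lam) \x lam)%E.
Local Notation mR := (measurableTypeR R).
Local Notation lam2 := (@lam2 R).

Lemma integrable_square (f : R * R -> R) : continuous f ->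
  (lam \x lam)%E.-integrable (`[0, 1] `*` `[0, 1]) (EFin \o f).
Proof.
move=> cf.
have m01 : measurable (`[0, 1] : set mR) by exact: measurable_itv.
have l01 : lam `[0, 1] = 1%E.
  by rewrite lebesgue_measure_itv/= lte_fin ltr01 oppr0 adde0.
apply: measurable_bounded_integrable.
- exact: (measurableX m01 m01).
- suff : ((lam \x lam) (`[0%R, 1%R] `*` `[0%R, 1%R]) < +oo)%E by [].
  have -> : ((lam \x lam) (`[0%R, 1%R] `*` `[0%R, 1%R]) = 1)%E.
    rewrite [LHS](product_measure1E _ _ m01 m01) -[RHS]mule1.
    by congr (_ * _)%E; exact: l01.
  by rewrite ltry.
- by apply: measurable_funTS; exact: measurable_fun_continuous2.
- have cK : compact (`[0, 1] `*` `[0, 1] : set (R * R)).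
    by apply: compact_setX; exact: segment_compact.
  have [M M0 HM] := compact_bound cK (@within_continuous_at _ _ _ f (fun x _ => cf x)).
  by exists M; split; [exact: num_real|move=> x Mx y Cy; exact: le_trans (HM y Cy) (ltW Mx)].
Qed.

(** The torus has no boundary. The coordinate of the direction [a] is integrated innermost, where
    one period contributes zero. *)
Lemma Tint_derive_eq0 (f : 'rV[R]_3 -> R) (a : 'I_3) :
  (forall y, derivable f y (delta_mx 0 a)) -> continuous ('D_(delta_mx 0 a) f) ->
  (forall y, f (y + delta_mx 0 a) = f y) ->
  Tint ('D_(delta_mx 0 a) f) = 0.
Proof.
move=> df cD fp.
have m01 : measurable (`[0, 1] : set mR) by exact: measurable_itv.
pose G z := 'D_(delta_mx 0 a) f (point3 z).
have cG : continuous G.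
  by move=> z; apply: (@continuous_comp _ _ _ (@point3 R) ('D_(delta_mx 0 a) f)); [exact: point3_continuous | exact: cD].
have H x := integral_derive_periodic x df cD fp.
have m12 : measurable (`[0, 1] `*` `[0, 1] : set (mR * mR)) := measurableX m01 m01.
have I3 := integrable_cube cG.
have I2 (z3 : R) : (lam \x lam)%E.-integrable (`[0, 1] `*` `[0, 1]) (EFin \o (fun z => G (z, z3))).
  apply: integrable_square => z.
  exact: (cvg_comp _ G (@continuous_pairl _ _ z3 z) (cG _)).
have F21 := @integral_prod_eq0_21 R _ _ (mR * mR)%type mR lam2
  lam (`[0, 1] `*` `[0, 1]) `[0, 1] G m12 m01 I3.
have F12 := @integral_prod_eq0_12 R _ _ (mR * mR)%type mR lam2
  lam (`[0, 1] `*` `[0, 1]) `[0, 1] G m12 m01 I3.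
have S21 z3 := @integral_prod_eq0_21 R _ _ mR mR lam lam `[0, 1] `[0, 1] _ m01 m01 (I2 z3).
have S12 z3 := @integral_prod_eq0_12 R _ _ mR mR lam lam `[0, 1] `[0, 1] _ m01 m01 (I2 z3).
suff E : (\int[mu3]_(z in cube) (G z)%:E = 0)%E.
  by rewrite /Tint /Rintegral -[RHS](_ : fine 0 = 0)//; congr fine; exact: E.
(* The nesting of the product measure forces a different order of Fubini for each of the three
   directions. *)
have [a0|[a1|a2]] : a = 0 \/ a = 1 \/ a = 2.
  case: a {df cD fp G cG H I3 I2 F21 F12 S21 S12} => -[|[|[|//]]] i; [left|right;left|right;right]; exact: val_inj.
- apply: F21 => z3 _.
  apply: S21 => z2 _.
  rewrite -[RHS](H (point3 (0, z2, z3))); apply: eq_integral => s _.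
  congr (_ %:E); rewrite /G; congr ('D_ _ f _); apply/rowP => j.
  by rewrite !mxE a0; case: j => -[|[|[|//]]] i /=; rewrite ?mulr1 ?mulr0 ?add0r ?addr0.
- apply: F21 => z3 _.
  apply: S12 => z1 _.
  rewrite -[RHS](H (point3 (z1, 0, z3))); apply: eq_integral => s _.
  congr (_ %:E); rewrite /G; congr ('D_ _ f _); apply/rowP => j.
  by rewrite !mxE a1; case: j => -[|[|[|//]]] i /=; rewrite ?mulr1 ?mulr0 ?add0r ?addr0.
- apply: F12 => z12 _.
  rewrite -[RHS](H (point3 (z12, 0))); apply: eq_integral => s _.
  congr (_ %:E); rewrite /G; congr ('D_ _ f _); apply/rowP => j.
  by rewrite !mxE a2; case: j => -[|[|[|//]]] i /=; rewrite ?mulr1 ?mulr0 ?add0r ?addr0.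
Qed.

Lemma Tint_continuous_param (f : R -> 'rV[R]_3 -> R) (u v C : R) :
  (forall t, t \in `]u, v[ -> continuous (f t)) ->
  (forall x, {in `]u, v[, continuous (f ^~ x)}) ->
  (forall t z, t \in `]u, v[ -> cube z -> `|f t (point3 z)| <= C) ->
  {in `]u, v[, continuous (fun t => Tint (f t))}.
Proof.
move=> cx ct bd t It.
have A1 s : `]u, v[%classic s -> mu3.-integrable cube (EFin \o (fun z => f s (point3 z))).
  by move=> Is; apply: integrable_torus; exact: cx.
have A2 : {ae mu3, forall z, cube z ->
    {in `]u, v[%classic, continuous (fun s => f s (point3 z))}}.
  by apply: aeW => z _ s /set_mem Is; exact: ct.
have A3 : mu3.-integrable cube (EFin \o (fun=> C)).
  by apply: integrable_cube => z; exact: cvg_cst.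
have A4 s : `]u, v[%classic s -> {ae mu3, forall z, cube z -> `|f s (point3 z)| <= C}.
  by move=> Is; apply: aeW => z Cz; exact: bd.
apply: (continuity_under_integral measurable_cube A1 A2 A3 A4); exact: mem_set.
Qed.

Lemma Tint_derive_param (f : R -> 'rV[R]_3 -> R) (u v C : R) (t : R) :
  t \in `]u, v[ ->
  (forall t, t \in `]u, v[ -> continuous (f t)) ->
  (forall s x, s \in `]u, v[ -> derivable (f ^~ x) s 1) ->
  (forall s z, s \in `]u, v[ -> cube z -> `|derive1 (f ^~ (point3 z)) s| <= C) ->
  is_derive t 1 (fun t => Tint (f t)) (Tint (fun x => derive1 (f ^~ x) t)).
Proof.
move=> It cx dt bd.
have C0 : 0 <= C.
  apply: le_trans (bd t (0, 0, 0) It _) => //.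
  by split => //; [split|] => /=; rewrite in_itv/= lexx ler01.
have A1 s : s \in `]u, v[ -> mu3.-integrable cube (EFin \o (fun z => f s (point3 z))).
  by move=> Is; apply: integrable_torus; exact: cx.
have A2 : mu3.-integrable cube (EFin \o (fun=> C)) by apply: integrable_cube => z; exact: cvg_cst.
have H := @derivable_under_integral R _ _ mu3 (fun t z => f t (point3 z)) cube
  measurable_cube t u v It A1 (fun s z Is _ => dt s (point3 z) Is) (fun=> C) (fun=> C0) A2 bd.
have H' := @differentiation_under_integral R _ _ mu3 (fun t z => f t (point3 z)) cube
  measurable_cube t u v It A1 (fun s z Is _ => dt s (point3 z) Is) (fun=> C) (fun=> C0) A2 bd.
by split; [exact: H | rewrite -derive1E; exact: H'].
Qed.

Lemma continuous_primitive (g : R -> R) (T : R) : 0 < T -> continuous g ->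
  exists G : R -> R, (forall t : R, -1 < t -> is_derive t 1 G (g t)) /\
    (\int[lam]_(s in `[0%R, T]) (g s)%:E = (G T - G 0)%:E)%E.
Proof.
move=> T0 cg.
(* The lower limit is -1 rather than 0, so that [G] has a two-sided derivative at 0 as well. *)
pose G (t : R) : R := \int[lam]_(s in `[-1, t]) g s.
have dG (t : R) : -1 < t -> is_derive t 1 G (g t).
  move=> t1; have tu : t < t + 1 by rewrite ltrDl.
  have gi : lam.-integrable `[-1, t + 1] (EFin \o g).
    apply: continuous_compact_integrable; first exact: segment_compact.
    exact: continuous_subspaceT.
  have [dG Ge] := continuous_FTC1_closed tu gi t1 (cg t).
  by split; [exact: dG | rewrite -derive1E; exact: Ge].
exists G; split=> //; rewrite (@continuous_FTC2 _ g G 0 T T0) //.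
- exact: continuous_subspaceT.
- have c (t : R) : 0 <= t -> {for t, continuous G}.
    move=> t0; apply/differentiable_continuous/derivable1_diffP.
    by apply: (@ex_derive _ _ _ _ _ _ _ (dG _ _)); rewrite (lt_le_trans _ t0)// ltrN10.
  split.
  + move=> t; rewrite in_itv/= => /andP[t0 _].
    by apply: (@ex_derive _ _ _ _ _ _ _ (dG _ _)); rewrite (lt_trans _ t0)// ltrN10.
  + by apply: cvg_at_right_filter; exact: c.
  + by apply: cvg_at_left_filter; apply: c; exact: ltW.
- move=> t; rewrite in_itv/= => /andP[t0 _]; rewrite derive1E.
  by apply: (@derive_val _ _ _ _ _ _ _ (dG _ _)); rewrite (lt_trans _ t0)// ltrN10.
Qed.

(** The differential inequality is only required in the open interval, with continuity up to the
    ends, because a strong solution is merely continuous at time 0. *)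
Lemma gronwall (phi g : R -> R) (T K : R) :
  0 < T -> 0 <= K -> {within `[0, T], continuous phi} -> 0 <= phi 0 ->
  (forall t : R, 0 < t < T -> derivable phi t 1 /\ derive1 phi t <= K * phi t + g t) ->
  continuous g -> (forall t, 0 <= g t) ->
  forall t, 0 <= t <= T ->
    ((phi t)%:E <= (expR (K * T))%:E * ((phi 0)%:E + \int[lam]_(s in `[0%R, T]) (g s)%:E))%E.
Proof.
move=> T0 K0 cphi phi0 dphi cg g0 t /andP[t0 tT].
have [G [dG ->]] := continuous_primitive T0 cg.
have n1 (s : R) : 0 <= s -> -1 < s by move=> s0; rewrite (lt_le_trans _ s0)// ltrN10.
have cG (s : R) : 0 <= s -> {for s, continuous G}.
  move=> s0; apply/differentiable_continuous/derivable1_diffP.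
  exact: (@ex_derive _ _ _ _ _ _ _ (dG _ (n1 _ s0))).
have Gmono (s : R) : 0 <= s <= T -> G s <= G T.
  move=> /andP[s0 sT].
  apply: (@ger0_derive1_le_cc _ G 0 T) => //; rewrite ?in_itv/= ?s0 ?sT ?lexx ?(ltW T0)//.
  - move=> r; rewrite in_itv/= => /andP[r0 _].
    exact: (@ex_derive _ _ _ _ _ _ _ (dG _ (n1 _ (ltW r0)))).
  - move=> r; rewrite in_itv/= => /andP[r0 _]; rewrite derive1E.
    by rewrite (@derive_val _ _ _ _ _ _ _ (dG _ (n1 _ (ltW r0)))).
  - by apply: within_continuous_at => r /=; rewrite in_itv/= => /andP[r0 _]; exact: cG.
(* The integrating factor makes [h] nonincreasing: since [g] is nonnegative, [expR (- K * s) * g s]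
   is at most [g s]. *)
pose h s := expR (- K * s) * phi s - G s.
have dh (s : R) : 0 < s < T -> is_derive s 1 h
    (expR (- K * s) * (derive1 phi s - K * phi s) - g s).
  move=> sT; have [dp _] := dphi _ sT; have /andP[s0 _] := sT.
  have D0 : is_derive s 1 (fun s : R => - K * s) (- K).
    apply: is_derive_eq; rewrite /GRing.scale /=.
    by rewrite mulr1.
  have D1 := is_derive1_comp (is_derive_expR (- K * s)) D0.
  have D2 := is_deriveM D1 (derivableP dp).
  have D3 := is_deriveB D2 (dG _ (n1 _ (ltW s0))).
  apply: is_derive_eq D3 _; congr (_ - _); rewrite -derive1E /GRing.scale /=.
  move: (expR _) (derive1 phi s) (phi s) => a b c; rewrite !mulrBr; ring.
have hle : h t <= h 0.
  apply: (@ler0_derive1_le_cc _ h 0 T) => //; rewrite ?in_itv/= ?t0 ?tT ?lexx ?(ltW T0)//.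
  - by move=> s; rewrite in_itv/= => sT; exact: (@ex_derive _ _ _ _ _ _ _ (dh _ sT)).
  - move=> s; rewrite in_itv/= => sT; rewrite derive1E (@derive_val _ _ _ _ _ _ _ (dh _ sT)).
    have [_ dle] := dphi _ sT; have /andP[s0 _] := sT.
    rewrite subr_le0 (@le_trans _ _ (expR (- K * s) * g s))//.
      by rewrite ler_wpM2l ?expR_ge0// lerBlDl.
    by rewrite ler_piMl// -expR0 ler_expR mulNr oppr_le0 mulr_ge0// ltW.
  - move=> s; apply: cvgB; last first.
      move: s; apply: within_continuous_at => s /=; rewrite in_itv/= => /andP[s0 _]; exact: cG.
    apply: cvgM; last exact: cphi.
    move: s; apply: continuous_subspaceT => s.
    apply: (@continuous_comp _ _ _ (fun s => - K * s) expR); last exact: continuous_expR.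
    exact: mulrl_continuous.
rewrite -EFinD -EFinM lee_fin.
move: hle; rewrite /h mulr0 expR0 mul1r lerBlDr mulNr expRN => hle.
have e0 : 0 < expR (K * t) by exact: expR_gt0.
have : phi t <= expR (K * t) * (phi 0 - G 0 + G t).
  by rewrite -ler_pdivrMl.
move=> /le_trans; apply.
have le1 : phi 0 - G 0 + G t <= phi 0 + (G T - G 0).
  by rewrite addrAC -addrA lerD2l lerB// Gmono// t0.
(* The bracket is nonnegative by [0 <= phi 0] and the monotonicity of [G], so the exponent may be
   raised from [K * t] to [K * T]. *)
rewrite (le_trans (ler_wpM2l (ltW e0) le1))// ler_wpM2r//.
  rewrite addr_ge0// subr_ge0.
  by apply: Gmono; rewrite lexx ltW.
by rewrite ler_expR ler_wpM2l.
Qed.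

End torus_calculus.

(** * Minors of the deformation gradient and the Piola identity *)

Section minors.
Context {R : realType}.
Implicit Types (F G H : 'M[R]_3) (i a j b : 'I_3).

Definition ixF j b : 'I_19 := lshift 1 (lshift (3 * 3) (mxvec_index j b)).
Definition ixz j b : 'I_19 := lshift 1 (rshift (3 * 3) (mxvec_index j b)).
Definition ixw : 'I_19 := rshift (3 * 3 + 3 * 3) (0 : 'I_1).

(** The splitting of the 19 coordinates into three blocks lives in [Type] because [qPhi_formula]
    computes a real number by matching on it. *)
Variant ix_spec : 'I_19 -> Type :=
| IxF j b : ix_spec (ixF j b)
| Ixz j b : ix_spec (ixz j b)
| Ixw : ix_spec ixw.

Lemma ixP B : ix_spec B.
Proof.
case: (@split_ordP (3 * 3 + 3 * 3) 1 B) => [k ->|k ->]; last first.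
  by rewrite ord1; exact: Ixw.
case: (@split_ordP (3 * 3) (3 * 3) k) => [l ->|l ->].
  by case/mxvec_indexP: l => j b; exact: IxF.
by case/mxvec_indexP: l => j b; exact: Ixz.
Qed.

Lemma FpartE (x : 'rV[R]_19) j b : Fpart x j b = x 0 (ixF j b).
Proof. by rewrite /Fpart -(mxvecE (vec_mx _)) vec_mxK !mxE. Qed.

Lemma zpartE (x : 'rV[R]_19) j b : zpart x j b = x 0 (ixz j b).
Proof. by rewrite /zpart -(mxvecE (vec_mx _)) vec_mxK !mxE. Qed.

Lemma wpartE (x : 'rV[R]_19) : wpart x = x 0 ixw.
Proof. by rewrite /wpart !mxE. Qed.

Lemma PhiF F j b : Phi F 0 (ixF j b) = F j b.
Proof.
exact: (etrans (row_mxEl (row_mx (mxvec F) (mxvec (cof F))) (const_mx (\det F)) 0 _)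
  (etrans (row_mxEl _ _ _ _) (mxvecE _ _ _))).
Qed.

Lemma Phiz F j b : Phi F 0 (ixz j b) = cof F j b.
Proof.
exact: (etrans (row_mxEl (row_mx (mxvec F) (mxvec (cof F))) (const_mx (\det F)) 0 _)
  (etrans (row_mxEr _ _ _ _) (mxvecE _ _ _))).
Qed.

Lemma Phiw F : Phi F 0 ixw = \det F.
Proof.
exact: (etrans (row_mxEr (row_mx (mxvec F) (mxvec (cof F))) (const_mx (\det F)) 0 _)
  (mxE _ _ _ _)).
Qed.

Lemma det_mx2 (A : 'M[R]_2) : \det A = A 0 0 * A 1 1 - A 0 1 * A 1 0.
Proof.
rewrite (expand_det_row _ 0) !big_ord_recl big_ord0 /cofactor !det_mx11 !mxE /=.
rewrite expr0 expr1 mul1r addr0 mulN1r mulrN.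
by congr (_ * A _ _ - A _ _ * A _ _); apply: val_inj.
Qed.

(** With indices taken modulo 3 the cyclic order absorbs the sign of the cofactor, so that one
    formula covers all nine entries. *)
Lemma cofE F i a : cof F i a =
  F (i + 1) (a + 1) * F (i + 2) (a + 2) - F (i + 1) (a + 2) * F (i + 2) (a + 1).
Proof.
rewrite /cof mxE /cofactor det_mx2 !mxE.
have E (h : 'I_3) : [/\ lift h (0 : 'I_2) = if h == 0 then 1 else 0 & lift h (1 : 'I_2) = if h == 2 then 1 else 2].
  by case: h => -[|[|[|//]]] p; split; apply: val_inj.
have [-> ->] := E i; have [-> ->] := E a.
have e3 : (1 + 2 = 0 :> 'I_3) by apply: val_inj.
have e4 : (2 + 2 = 1 :> 'I_3) by apply: val_inj.
have e5 : (2 + 1 = 0 :> 'I_3) by apply: val_inj.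
have e2 : (1 + 1 = 2 :> 'I_3) by apply: val_inj.
have ci (h : 'I_3) : h = 0 \/ h = 1 \/ h = 2.
  by case: h => -[|[|[|//]]] p; [left|right;left|right;right]; exact: val_inj.
have [->|[->|->]] := ci i; have [->|[->|->]] := ci a;
  rewrite ?add0r ?e2 ?e3 ?e4 ?e5 /=; rewrite ?expr0 ?expr1 ?sqrrN ?expr1n; ring.
Qed.


Lemma is_derive_entry F H j b : is_derive F H (fun G => G j b) (H j b).
Proof.
have C : h^-1 *: (((fun G : 'M[R]_3 => G j b) \o shift F) (h *: H) - F j b) @[h --> 0^'] --> H j b.
  have E : {near 0^', (fun=> H j b) =1
      (fun h => h^-1 *: (((fun G : 'M[R]_3 => G j b) \o shift F) (h *: H) - F j b))}.
    near=> h; rewrite /= !mxE addrK [_ *: _]mulrA mulVf ?mul1r//.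
    by near: h; exact: nbhs_dnbhs_neq.
  by apply: cvg_trans (near_eq_cvg E) _; exact: cvg_cst.
by split; [apply/cvg_ex; eexists; exact: C | exact: (cvg_lim _ C)].
Unshelve. all: by end_near. Qed.

Section minors_chain.
Context {W : normedModType R}.
Implicit Types (M : W -> 'M[R]_3) (z v : W).

(** The polar form of the quadratic map [cof]: symmetric and bilinear in [F] and [H], hence its
    derivative at [F] along [H]. *)
Definition dcof (F H : 'M[R]_3) j b : R :=
  H (j + 1) (b + 1) * F (j + 2) (b + 2) + F (j + 1) (b + 1) * H (j + 2) (b + 2)
  - (H (j + 1) (b + 2) * F (j + 2) (b + 1) + F (j + 1) (b + 2) * H (j + 2) (b + 1)).

Lemma is_derive_cof M z v H j b :
  (forall k g, is_derive z v (fun y => M y k g) (H k g)) ->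
  is_derive z v (fun y => cof (M y) j b) (dcof (M z) H j b).
Proof.
move=> dM.
have E : (fun y => cof (M y) j b) = (fun y => M y (j + 1) (b + 1) * M y (j + 2) (b + 2)
    - M y (j + 1) (b + 2) * M y (j + 2) (b + 1)) by apply/funext => y; rewrite cofE.
rewrite E.
have D1 := is_deriveM (dM (j + 1) (b + 1)) (dM (j + 2) (b + 2)).
have D2 := is_deriveM (dM (j + 1) (b + 2)) (dM (j + 2) (b + 1)).
apply: is_derive_eq (is_deriveB D1 D2) _.
rewrite /GRing.scale /= /dcof; move: (M z) => N; ring.
Qed.
End minors_chain.

Lemma dPhiF F j b i a : dPhi (ixF j b) i a F = (delta_mx i a : 'M[R]_3) j b.
Proof.
rewrite /dPhi (_ : (fun G => _) = (fun G : 'M[R]_3 => G j b)).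
  exact: (@derive_val _ _ _ _ _ _ _ (is_derive_entry F (delta_mx i a) j b)).
by apply/funext => G; rewrite PhiF.
Qed.

Lemma dPhiz F j b i a : dPhi (ixz j b) i a F = dcof F (delta_mx i a) j b.
Proof.
rewrite /dPhi (_ : (fun G => _) = (fun G : 'M[R]_3 => cof G j b)).
  have D := @is_derive_cof _ id F (delta_mx i a) _ j b (is_derive_entry F (delta_mx i a)).
  exact: (@derive_val _ _ _ _ _ _ _ D).
by apply/funext => G; rewrite Phiz.
Qed.

(** Expansion along row [i]: the cofactors of that row do not see the modified entry, so the
    determinant is affine in it. *)
Lemma det_add_delta F i a (h : R) :
  \det (h *: delta_mx i a + F) = \det F + h * cof F i a.
Proof.
rewrite (expand_det_row _ i) (expand_det_row F i).
have cE c : cofactor (h *: delta_mx i a + F) i c = cofactor F i c.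
  rewrite /cofactor; congr (_ * \det _); apply/matrixP => k l; rewrite !mxE.
  by rewrite (eq_sym (lift i _)) (negbTE (neq_lift _ _)) /= mulr0 add0r.
under eq_bigr do rewrite cE !mxE eqxx /= mulrDl addrC.
rewrite big_split /=; congr (_ + _); rewrite (bigD1 a)//= eqxx mulr1 big1 ?addr0.
  by rewrite /cof mxE.
by move=> c ca; rewrite (negbTE ca) mulr0 mul0r.
Qed.

Lemma dPhiw F i a : dPhi ixw i a F = cof F i a.
Proof.
rewrite /dPhi (_ : (fun G => _) = (fun G : 'M[R]_3 => \det G)); last first.
  by apply/funext => G; rewrite Phiw.
have C : h^-1 *: (((fun G : 'M[R]_3 => \det G) \o shift F) (h *: delta_mx i a) - \det F)
    @[h --> 0^'] --> cof F i a.
  have E : {near 0^', (fun=> cof F i a) =1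
      (fun h => h^-1 *: (((fun G : 'M[R]_3 => \det G) \o shift F) (h *: delta_mx i a) - \det F))}.
    near=> h; rewrite /= det_add_delta addrC addKr [_ *: _]mulrA mulVf ?mul1r//.
    by near: h; exact: nbhs_dnbhs_neq.
  by apply: cvg_trans (near_eq_cvg E) _; exact: cvg_cst.
exact: (cvg_lim _ C).
Unshelve. all: by end_near. Qed.

Section dPhi_chain.
Context {W : normedModType R}.
Implicit Types (M : W -> 'M[R]_3) (z v : W).

(** The mixed second derivative of the minor with index [B], along the entry (i, a) and along [H].
    It vanishes on the linear block and does not depend on [F] on the quadratic block. *)
Definition qPhi_formula (B : 'I_19) i a (F H : 'M[R]_3) : R :=
  match ixP B with
  | IxF _ _ => 0
  | Ixz j b => dcof H (delta_mx i a) j b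
  | Ixw => dcof F H i a
  end.

Lemma is_derive_dPhi M z v H B i a :
  (forall k g, is_derive z v (fun y => M y k g) (H k g)) ->
  is_derive z v (fun y => dPhi B i a (M y)) (qPhi_formula B i a (M z) H).
Proof.
move=> dM; rewrite /qPhi_formula; case: ixP => [j b|j b|].
- rewrite (_ : (fun y => _) = cst ((delta_mx i a : 'M[R]_3) j b)).
    exact: (@is_derive_cst R W R^o).
  by apply/funext => y; rewrite dPhiF.
- rewrite (_ : (fun y => _) = (fun y => dcof (M y) (delta_mx i a) j b)); last first.
    by apply/funext => y; rewrite dPhiz.
  rewrite /dcof; set E := (delta_mx i a : 'M[R]_3).
  have dZ k g (c : R) : is_derive z v (fun y => M y k g * c) (H k g * c).
    have D := is_deriveM (dM k g) (@is_derive_cst R W R^o c z v).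
    by apply: is_derive_eq D _; rewrite scaler0 add0r /GRing.scale /= mulrC.
  have D := is_deriveB (is_deriveD (dZ (j + 2) (b + 2) (E (j + 1) (b + 1))) (dZ (j + 1) (b + 1) (E (j + 2) (b + 2))))
    (is_deriveD (dZ (j + 2) (b + 1) (E (j + 1) (b + 2))) (dZ (j + 1) (b + 2) (E (j + 2) (b + 1)))).
  have -> : (fun y => E (j + 1) (b + 1) * M y (j + 2) (b + 2) + M y (j + 1) (b + 1) * E (j + 2) (b + 2)
     - (E (j + 1) (b + 2) * M y (j + 2) (b + 1) + M y (j + 1) (b + 2) * E (j + 2) (b + 1)))
   = (fun y => (M y (j + 2) (b + 2) * E (j + 1) (b + 1) + M y (j + 1) (b + 1) * E (j + 2) (b + 2))
     - (M y (j + 2) (b + 1) * E (j + 1) (b + 2) + M y (j + 1) (b + 2) * E (j + 2) (b + 1))).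
    by apply/funext => y; rewrite [E (j + 1) (b + 1) * _]mulrC [E (j + 1) (b + 2) * _]mulrC.
  apply: is_derive_eq D _.
  by rewrite [E (j + 1) (b + 1) * _]mulrC [E (j + 1) (b + 2) * _]mulrC.
- rewrite (_ : (fun y => _) = (fun y => cof (M y) i a)); first exact: is_derive_cof.
  by apply/funext => y; rewrite dPhiw.
Qed.

Lemma C1dir_dPhi (O : set W) (v : W) M B i a : open O ->
  (forall k g, C1dir O v (fun y => M y k g)) ->
  C1dir O v (fun y => dPhi B i a (M y)).
Proof.
move=> oO CM; have Cc c := C1dir_cst v oO c.
case: (ixP B) => [j b|j b|].
- rewrite (_ : (fun y => _) = (fun=> (delta_mx i a : 'M[R]_3) j b)); first exact: Cc.
  by apply/funext => y; rewrite dPhiF.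
- rewrite (_ : (fun y => _) = (fun y => dcof (M y) (delta_mx i a) j b)); last first.
    by apply/funext => y; rewrite dPhiz.
  by apply: C1dirB => //; apply: C1dirD => //; apply: C1dirM.
- rewrite (_ : (fun y => _) = (fun y => M y (i + 1) (a + 1) * M y (i + 2) (a + 2) -
      M y (i + 1) (a + 2) * M y (i + 2) (a + 1))); last first.
    by apply/funext => y; rewrite dPhiw cofE.
  by apply: C1dirB => //; apply: C1dirM.
Qed.

End dPhi_chain.

(* Piola identity: the minors are null Lagrangians. *)
Lemma piola B i F (H : 'I_3 -> 'M[R]_3) :
  (forall c k g, H c k g = H g k c) ->
  \sum_(a < 3) qPhi_formula B i a F (H a) = 0.
Proof.
move=> sH.
have e3 : (1 + 2 = 0 :> 'I_3) by apply: val_inj.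
have e4 : (2 + 2 = 1 :> 'I_3) by apply: val_inj.
have e5 : (2 + 1 = 0 :> 'I_3) by apply: val_inj.
have e2 : (1 + 1 = 2 :> 'I_3) by apply: val_inj.
have l1 : lift (0 : 'I_3) (0 : 'I_2) = 1 by apply: val_inj.
have l2 : lift (0 : 'I_3) (lift (0 : 'I_2) (0 : 'I_1)) = 2 by apply: val_inj.
have ci (h : 'I_3) : h = 0 \/ h = 1 \/ h = 2.
  by case: h => -[|[|[|//]]] p; [left|right;left|right;right]; exact: val_inj.
rewrite !big_ord_recl big_ord0 l1 l2 addr0 -[ord0]/(0 : 'I_3) /qPhi_formula.
case: ixP => [j b|j b|]; first by rewrite !addr0.
(* The symmetry of [H] is the curl-free condition on F; once it is substituted, the terms of the
   cyclic formula cancel in pairs. *)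
- have s01 := sH 1 _ 0; have s02 := sH 2 _ 0; have s12 := sH 2 _ 1.
  have [->|[->|->]] := ci b;
  rewrite /dcof !mxE ?add0r ?e2 ?e3 ?e4 ?e5 /= ?s01 ?s02 ?s12;
  case: (j + 1 == i); case: (j + 2 == i) => /=; ring.
- rewrite /dcof ?add0r ?e2 ?e3 ?e4 ?e5 /=.
  have s01 k := sH 1 k 0; have s02 k := sH 2 k 0; have s12 k := sH 2 k 1.
  rewrite ?s01 ?s02 ?s12; ring.
Qed.

Section minors_bounds.
Variables (F G : 'M[R]_3) (m d : R).
Hypotheses (Fm : forall k g, `|F k g| <= m) (Gm : forall k g, `|G k g| <= m)
  (FGd : forall k g, `|F k g - G k g| <= d).

Let m0 : 0 <= m. Proof. exact: le_trans (normr_ge0 _) (Fm 0 0). Qed.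
Let d0 : 0 <= d. Proof. exact: le_trans (normr_ge0 _) (FGd 0 0). Qed.

(** The derivative of a cofactor is linear in the matrix, so its Lipschitz constant is independent
    of [m]. Later this gives linear instead of quadratic growth in |F|, matching the exponent p / (p
    - 1) of (G2). *)
Lemma dPhiz_lip j b i a :
  `|dPhi (ixz j b) i a F - dPhi (ixz j b) i a G| <= 4 * d.
Proof.
rewrite !dPhiz /dcof; set E := (delta_mx i a : 'M[R]_3).
have E1 k g : `|E k g| <= 1.
  by rewrite /E mxE; case: (_ && _); rewrite /= ?normr1 ?normr0 ?lexx ?ler01.
have T k g k' g' : `|E k g * (F k' g' - G k' g')| <= d.
  by rewrite normrM -[leRHS]mul1r ler_pM.
rewrite (_ : _ - _ = E (j + 1) (b + 1) * (F (j + 2) (b + 2) - G (j + 2) (b + 2))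
   + E (j + 2) (b + 2) * (F (j + 1) (b + 1) - G (j + 1) (b + 1))
   - E (j + 1) (b + 2) * (F (j + 2) (b + 1) - G (j + 2) (b + 1))
   - E (j + 2) (b + 1) * (F (j + 1) (b + 2) - G (j + 1) (b + 2))); last by ring.
rewrite (_ : 4 * d = d + d + d + d); last by ring.
rewrite (le_trans (ler_normB _ _))// lerD//.
by rewrite (le_trans (ler_normB _ _))// lerD// (le_trans (ler_normD _ _))// lerD.
Qed.

Lemma dPhi_lip B i a : `|dPhi B i a F - dPhi B i a G| <= 4 * (1 + m) * d.
Proof.
have le4 : 4 * d <= 4 * (1 + m) * d.
  by rewrite ler_wpM2r// -[leLHS]mulr1 ler_wpM2l// lerDl.
case: (ixP B) => [j b|j b|].
- rewrite !dPhiF subrr normr0 !mulr_ge0// addr_ge0//.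
- exact: le_trans (dPhiz_lip j b i a) le4.
rewrite !dPhiw !cofE.
have T k g k' g' : `|F k g * F k' g' - G k g * G k' g'| <= 2 * m * d.
  rewrite (_ : _ - _ = F k g * (F k' g' - G k' g') + (F k g - G k g) * G k' g'); last by ring.
  rewrite (le_trans (ler_normD _ _))// (_ : 2 * m * d = m * d + d * m); last by ring.
  by rewrite lerD// normrM ler_pM.
rewrite (_ : forall x y z t : R, x - y - (z - t) = (x - z) - (y - t)); last first.
  by move=> x y z t; ring.
rewrite (le_trans (ler_normB _ _))// (le_trans (lerD (T _ _ _ _) (T _ _ _ _)))//.
rewrite (_ : 2 * m * d + 2 * m * d = 4 * m * d); last by ring.
by rewrite ler_wpM2r// ler_wpM2l// lerDr.
Qed.

End minors_bounds.

End minors.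

(** * Uniform Lipschitz and Taylor bounds on boxes *)

Section box.
Context {R : realType} {n : nat}.
Local Notation V := ('rV[R]_n * R)%type.

Definition ebas (i : option 'I_n) : V := if i is Some j then ebase j else etime.

(** Compact convex sets of states. The lower temperature bound is separate: 0 suffices for the free
    energy, a positive value is needed for the heat conductivity. *)
Definition box (lo N : R) : set V :=
  [set z : V | (forall j, `|z.1 0 j| <= N) /\ lo <= z.2 <= N].

Lemma compact_box lo N : compact (box lo N).
Proof.
have -> : box lo N = [set x : 'rV[R]_n | forall j, `[- N, N]%classic (x 0 j)] `*` `[lo, N].
  apply/seteqP; split => -[x t] /= [H1 H2]; split => //=.
  - by move=> j; rewrite in_itv/= -ler_norml.
  - by move=> j; have := H1 j; rewrite in_itv/= -ler_norml.
apply: compact_setX; last exact: segment_compact.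
by apply: (@rV_compact _ _ (fun=> `[- N, N]%classic)) => j; exact: segment_compact.
Qed.

Lemma box_convex lo N (z w : V) (s : R) : 0 <= s <= 1 ->
  box lo N z -> box lo N (z + w) -> box lo N (z + s *: w).
Proof.
move=> /andP[s0 s1] [z1 /andP[z2 z3]] [w1 /andP[w2 w3]].
have s1' : 0 <= 1 - s by rewrite subr_ge0.
split=> [j|].
  have := w1 j; have := z1 j; rewrite !ler_norml /= !mxE.
  move: (z.1 0 j) (w.1 0 j) => a b /andP[a1 a2] /andP[b1 b2]; apply/andP; split; nra.
have /= {}w2 := w2; have /= {}w3 := w3.
rewrite /= /GRing.scale /=.
move: z2 z3 w2 w3; move: (z.2) (w.2) => a b a1 a2 b1 b2; apply/andP; split; nra.
Qed.

Variables (O : set V) (lo : R).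
Hypotheses (oO : open O) (loO : forall z : V, lo <= z.2 -> O z).

Lemma box_sub N z : box lo N z -> O z.
Proof. by move=> [_ /andP[h _]]; exact: loO. Qed.

Lemma box_line N (z zb : V) (s : R) : 0 <= s <= 1 ->
  box lo N z -> box lo N zb -> box lo N (zb + s *: (z - zb)).
Proof. by move=> s01 Kz Kzb; apply: box_convex => //; rewrite addrC subrK. Qed.

Lemma Cdiff_box_bound (m : nat) (f : V -> R) N : Cdiff m O f ->
  exists2 C : R, 0 < C & forall z, box lo N z -> `|f z| <= C.
Proof.
move=> Cf; suff H : {within box lo N, continuous f} by exact: (compact_bound (@compact_box lo N) H).
apply: within_continuous_at => z Kz; have := box_sub Kz.
by case: m Cf => [|m] [+ _]; apply.
Qed.

Lemma Cdiff_derive (m : nat) (f : V -> R) v : Cdiff m.+1 O f -> Cdiff m O ('D_v f).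
Proof. by move=> [_ /(_ v)[_]]. Qed.

Lemma Cdiff_deriv_box_bound (f : V -> R) m N : Cdiff m.+1 O f ->
  exists2 C : R, 0 < C & forall z v, box lo N z -> `|'D_v f z| <= C * `|v|.
Proof.
move=> Cf.
have H (i : option 'I_n) : {within box lo N, continuous ('D_(ebas i) f)}.
  apply: within_continuous_at => z Kz; have := box_sub Kz.
  by case: m Cf => [|m] [_ /(_ (ebas i))[_ [+ _]]]; apply.
have [C C0 HC] := compact_bound_fin (@compact_box lo N) H.
exists (C * n.+1%:R); first by rewrite mulr_gt0.
move=> z v Kz; rewrite (Cdiff_deriveE _ oO Cf (box_sub Kz)).
rewrite (le_trans (normr_pgrad_le _ _ _))// ler_wpM2r//.
rewrite -natr1 mulrDr mulr1 lerD//; last exact: (HC None).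
rewrite (@le_trans _ _ (\sum_(j < n) C))//.
  by apply: ler_sum => j _; exact: (HC (Some j)).
by rewrite sumr_const card_ord mulr_natr.
Qed.

Lemma box_lipschitz (f : V -> R) m N : Cdiff m.+1 O f ->
  exists2 C : R, 0 < C & forall z zb, box lo N z -> box lo N zb ->
    `|f z - f zb| <= C * `|z - zb|.
Proof.
move=> Cf; have [C C0 HC] := Cdiff_deriv_box_bound N Cf; exists C => // z zb Kz Kzb.
have [_ /= /(_ (z - zb)) [df _]] := Cf.
have [s|s s01 E] := @MVT01 R V f zb (z - zb).
  by move=> s01; apply: df; apply: (@box_sub N); exact: box_line.
rewrite (addrC zb) subrK in E.
by rewrite E; apply: HC; exact: box_line.
Qed.

Definition taylor_rem (f : V -> R) (z zb : V) : R := f z - f zb - 'D_(z - zb) f zb.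

(** One of the two copies of [v] is expanded in coordinates; swapping the derivatives reduces the
    claim to first-order bounds for finitely many partial derivatives. *)
Lemma second_derive_box_bound (f : V -> R) N : Cdiff 2 O f ->
  exists2 C : R, 0 < C & forall z v, box lo N z -> `|'D_v ('D_v f) z| <= C * `|v| ^+ 2.
Proof.
move=> Cf.
have /choice[C HC] : forall i : option 'I_n, exists C : R, 0 < C /\ forall z v, box lo N z ->
    `|'D_v ('D_(ebas i) f) z| <= C * `|v|.
  move=> i; have [C C0 H] := Cdiff_deriv_box_bound N (Cdiff_derive (ebas i) Cf).
  by exists C.
exists (\sum_j C (Some j) + C None).
  by rewrite ltr_wpDl// ?(HC None).1// sumr_ge0// => j _; rewrite ltW// (HC (Some j)).1.
move=> z v Kz; have Oz := box_sub Kz.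
rewrite (Cdiff_deriveE _ oO (Cdiff_derive v Cf) Oz).
rewrite (le_trans (normr_pgrad_le _ _ _))// expr2 mulrA ler_wpM2r//.
rewrite mulrDl lerD//.
  rewrite mulr_suml; apply: ler_sum => j _.
  by rewrite (derive_swap v (ebase j) oO Cf Oz) (HC (Some j)).2.
by rewrite (derive_swap v etime oO Cf Oz) (HC None).2.
Qed.

Lemma taylor_rem_box (f : V -> R) N : Cdiff 2 O f ->
  exists2 C : R, 0 < C & forall z zb, box lo N z -> box lo N zb ->
    `|taylor_rem f z zb| <= C * `|z - zb| ^+ 2.
Proof.
move=> Cf; have [C C0 HC] := second_derive_box_bound N Cf; exists C => // z zb Kz Kzb.
have [s|s s01 E] := @taylor2 R V f O zb (z - zb) oO Cf.
  by move=> s01; apply: (@box_sub N); exact: box_line.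
rewrite (addrC zb) subrK in E; rewrite /taylor_rem E normrM.
rewrite (@le_trans _ _ (1 * `|'D_(z - zb) ('D_(z - zb) f) (zb + s *: (z - zb))|))//.
  by rewrite ler_wpM2r// ger0_norm ?invr_ge0// invf_le1// ler1n.
by rewrite mul1r HC//; exact: box_line.
Qed.

End box.

(** * Derivatives and uniform convexity of the free energy *)

Section free_energy.
Context {R : realType}.
Local Notation V := ('rV[R]_19 * R)%type.
Implicit Types (f G : 'rV[R]_19 -> R -> R) (x : 'rV[R]_19) (th : R).

Lemma dxiE f (G : V -> R) B x th : (forall y, f y th = G (y, th)) ->
  dxi f B x th = 'D_(ebase B) G (x, th).
Proof.
move=> fG; rewrite /dxi /derive; set g1 := fun h => h^-1 *: _; set g2 := fun h => h^-1 *: _.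
suff -> : g1 = g2 by [].
apply/funext => h; rewrite /g1 /g2 /= !fG; congr (_ *: (G _ - _)).
by congr pair; rewrite /= scaler0 add0r.
Qed.

(** [f] agrees with [G] only at nonnegative temperatures, so its derivative is one-sided. The
    two-sided limit for [G], restricted to positive increments, is the same limit, also at
    temperature 0. *)
Lemma dthE f (G : V -> R) x th : (forall s, 0 <= s -> f x s = G (x, s)) ->
  0 <= th -> derivable G (x, th) etime -> dth f x th = 'D_etime G (x, th).
Proof.
move=> fG th0 dG; rewrite /dth; apply: cvg_lim => //.
have C : h^-1 *: ((G \o shift (x, th)) (h *: etime) - G (x, th)) @[h --> 0^'] -->
   'D_etime G (x, th) by exact: dG.
apply: cvg_trans (_ : h^-1 *: ((G \o shift (x, th)) (h *: etime) - G (x, th))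
    @[h --> 0^'+] --> _); last first.
  move=> A /C /nbhs_ballP [_ /posnumP[e] xe_A].
  by exists e%:num => //= y xe_y /gt_eqF/negbT/xe_A; exact.
apply: near_eq_cvg; near=> h; have h0 : 0 < h by near: h; exact: nbhs_right_gt.
rewrite /= (fG _ th0) (fG _ (addr_ge0 th0 (ltW h0))).
congr (_ * (G _ - _)); congr pair; rewrite /=.
  by rewrite scaler0 add0r.
by rewrite addrC [h *: _]mulr1.
Unshelve. all: by end_near. Qed.

Section psi_facts.
Variables (psi : 'rV[R]_19 -> R -> R) (O : set V) (g : V -> R).
Hypotheses (oO : open O) (O0 : forall z : V, 0 <= z.2 -> O z)
  (Cg : Cdiff 3 O g) (psiE : forall z : V, 0 <= z.2 -> psi z.1 z.2 = g z).

Lemma Cdiff_le m k (f : V -> R) : (k <= m)%N -> Cdiff m O f -> Cdiff k O f.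
Proof.
elim: k m f => [|k IH] [|m] f //=.
  by move=> _ [cf _]; split=> // x Ox; exact: cf.
move=> km [cf Df]; split => // v.
by have [df Cf] := Df v; split=> //; exact: (IH m).
Qed.

Lemma derivable_O m (f : V -> R) z v : Cdiff m.+1 O f -> 0 <= z.2 -> derivable f z v.
Proof. by move=> [_ /(_ v)[+ _]] z0; apply; exact: O0. Qed.

Lemma psi_dxi B x th : 0 <= th -> dxi psi B x th = 'D_(ebase B) g (x, th).
Proof. by move=> th0; apply: dxiE => y; exact: (psiE (z := (y, th))). Qed.

Lemma psi_dth x th : 0 <= th -> dth psi x th = 'D_etime g (x, th).
Proof.
move=> th0; apply: dthE => //; first by move=> s s0; exact: (psiE (z := (x, s))).
exact: derivable_O Cg _.
Qed.

Lemma psi_eta x th : 0 <= th -> Defs.eta psi x th = - 'D_etime g (x, th).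
Proof. by move=> th0; rewrite /Defs.eta psi_dth. Qed.

Lemma psi_energy x th : 0 <= th -> energy psi x th = g (x, th) - th * 'D_etime g (x, th).
Proof. by move=> th0; rewrite /energy psi_dth// (psiE (z := (x, th))). Qed.

Lemma psi_hess B C x th : 0 <= th ->
  dxi (dxi psi C) B x th = 'D_(ebase B) ('D_(ebase C) g) (x, th).
Proof. by move=> th0; apply: dxiE => y; rewrite psi_dxi. Qed.

Lemma psi_eta_th x th : 0 <= th ->
  dth (Defs.eta psi) x th = - 'D_etime ('D_etime g) (x, th).
Proof.
move=> th0; have d1 : derivable ('D_etime g) (x, th) etime.
  by apply: derivable_O (Cdiff_derive etime Cg) _.
rewrite -deriveN//; apply: (dthE (G := - 'D_etime g)) => //.
  by move=> s s0; rewrite psi_eta.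
exact: derivableN.
Qed.

Hypotheses (hconv : hess_xi_posdef psi) (heta : eta_th_pos psi).

Lemma DtDt_lt0 (z : V) : 0 <= z.2 -> 'D_etime ('D_etime g) z < 0.
Proof. by case: z => x th /= th0; have := heta x th0; rewrite psi_eta_th// oppr_gt0. Qed.

Lemma hess_pos (z : V) (h : 'rV[R]_19) : 0 <= z.2 -> h != 0 ->
  0 < \sum_C (\sum_B h 0 B * 'D_(ebase B) ('D_(ebase C) g) z) * h 0 C.
Proof.
case: z => x th /= th0 h0; have := hconv x th0 h0; rewrite !mxE.
congr (0 < _); apply: eq_bigr => C _; rewrite !mxE; congr (_ * _).
by apply: eq_bigr => B _; rewrite mxE psi_hess.
Qed.

Lemma DtDt_box N : exists2 m : R, 0 < m &
  forall z : V, box 0 N z -> 'D_etime ('D_etime g) z <= - m.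
Proof.
have [K0|K0] := pselect (box (n := 19) 0 N !=set0); last first.
  by exists 1 => // z Kz; exfalso; apply: K0; exists z.
have cD : {within box (n := 19) 0 N, continuous ('D_etime ('D_etime g))}.
  apply: within_continuous_at => z [_ /andP[z0 _]].
  have C1 : Cdiff 1 O ('D_etime ('D_etime g)) := Cdiff_derive etime (Cdiff_derive etime Cg).
  by have [+ _] := C1; apply; exact: O0.
have [c /set_mem [_ /andP[c0 _]] H] := compact_EVT_max K0 (@compact_box _ _ 0 N) cD.
exists (- 'D_etime ('D_etime g) c); first by rewrite oppr_gt0 DtDt_lt0.
by move=> z Kz; rewrite opprK H// inE.
Qed.

(** Positivity becomes uniform by compactness of the box times the unit sphere, and extends to all
    [h] by homogeneity of degree two. *)
Lemma hess_box N : exists2 m : R, 0 < m &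
  forall (z : V) (h : 'rV[R]_19), box 0 N z ->
    m * `|h| ^+ 2 <= \sum_C (\sum_B h 0 B * 'D_(ebase B) ('D_(ebase C) g) z) * h 0 C.
Proof.
pose S : set 'rV[R]_19 := [set h | `|h| = 1].
have cS : compact S.
  apply: bounded_closed_compact.
    exists 1; split; first exact: num_real.
    by move=> M M1 h; rewrite /S /= => ->; exact: ltW.
  rewrite (_ : S = (fun h => `|h|) @^-1` [set 1]); last by [].
  apply: closed_comp; last exact: closed_eq.
  by move=> h _; exact: norm_continuous.
pose q (w : V * 'rV[R]_19) : R :=
  \sum_C (\sum_B w.2 0 B * 'D_(ebase B) ('D_(ebase C) g) w.1) * w.2 0 C.
pose K := box (n := 19) 0 N `*` S.
have cK : compact K by apply: compact_setX cS; exact: compact_box.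
have cq : {within K, continuous q}.
  apply: within_continuous_at => -[z h] [/= [_ /andP[z0 _]] _].
  have ch C : {for (z, h), continuous (fun w : V * 'rV[R]_19 => w.2 0 C)}.
    apply: (@continuous_comp _ _ _ snd (fun u : 'rV[R]_19 => u 0 C)); first exact: cvg_snd.
    exact: coord_continuous.
  have cD B C : {for (z, h), continuous (fun w : V * 'rV[R]_19 => 'D_(ebase B) ('D_(ebase C) g) w.1)}.
    apply: (@continuous_comp _ _ _ fst ('D_(ebase B) ('D_(ebase C) g))); first exact: cvg_fst.
    have C1 : Cdiff 1 O ('D_(ebase B) ('D_(ebase C) g)) := Cdiff_derive _ (Cdiff_derive _ Cg).
    by have [+ _] := C1; apply; exact: O0.
  apply: cvg_sumr => C _; apply: cvgM; last exact: ch.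
  by apply: cvg_sumr => B _; apply: cvgM; [exact: ch | exact: cD].
have [K0|K0] := pselect (K !=set0); last first.
  exists 1 => // z h Kz; have [->|h0] := eqVneq h 0.
    by rewrite normr0 expr0n mulr0 big1// => C _; rewrite mxE mulr0.
  exfalso; apply: K0; exists (z, `|h|^-1 *: h); split => //=.
  by rewrite /S /= normrZ normfV normr_id mulVf// normr_eq0.
have [[c k] /set_mem [/= [_ /andP[c0 _]] Sk] H] := compact_EVT_min K0 cK cq.
(* The minimum of the quadratic form over states in the box and unit vectors; it is positive because
   a unit vector is nonzero. *)
exists (q (c, k)).
  apply: hess_pos => //=; rewrite -normr_gt0.
  by move: Sk; rewrite /S /= => ->.
move=> z h Kz; have [->|h0] := eqVneq h 0.
  by rewrite normr0 expr0n mulr0 big1// => C _; rewrite mxE mulr0.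
have nh : `|h| != 0 by rewrite normr_eq0.
have := H (z, `|h|^-1 *: h) _; rewrite inE => /(_ _) H1.
have {H1} : q (c, k) <= q (z, `|h|^-1 *: h).
  by apply: H1; split => //=; rewrite /S /= normrZ normfV normr_id mulVf.
have -> : q (z, `|h|^-1 *: h) = `|h| ^- 2 *
    \sum_C (\sum_B h 0 B * 'D_(ebase B) ('D_(ebase C) g) z) * h 0 C.
  rewrite mulr_sumr; apply: eq_bigr => C _; rewrite /= mxE.
  rewrite expr2 invfM mulrACA; congr (_ * _); rewrite mulr_sumr.
  by apply: eq_bigr => B _; rewrite mxE mulrA.
have h2 : 0 < `|h| ^+ 2 by rewrite exprn_gt0// normr_gt0.
by rewrite -(ler_pM2r h2) [X in _ <= X]mulrAC mulVf ?mul1r// gt_eqF.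
Qed.

End psi_facts.
End free_energy.

(** * Quadratic lower bound for the relative free energy *)

Section relative_free_energy.
Context {R : realType}.
Local Notation V := ('rV[R]_19 * R)%type.
Variables (psi : 'rV[R]_19 -> R -> R) (O : set V) (g : V -> R).
Hypotheses (oO : open O) (O0 : forall z : V, 0 <= z.2 -> O z)
  (Cg : Cdiff 3 O g) (psiE : forall z : V, 0 <= z.2 -> psi z.1 z.2 = g z).

(** The relative entropy without its kinetic part, written for the extension [g]. Since the entropy
    is minus the temperature derivative, all first-order terms at [zb] merge into one directional
    derivative. *)
Definition Jrel (z zb : V) : R :=
  g z - g zb - 'D_(z - zb) g zb - ('D_etime g z - 'D_etime g zb) * (z.2 - zb.2).

Let Cg2 : Cdiff 2 O g. Proof. exact: Cdiff_le Cg. Qed.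
Let Cg1 : Cdiff 1 O g. Proof. exact: Cdiff_le Cg. Qed.

Lemma derive_scale m (f : V -> R) (a : R) v y : Cdiff m.+1 O f -> O y ->
  'D_(a *: v) f y = a * 'D_v f y.
Proof.
move=> Cf Oy; rewrite !(Cdiff_deriveE _ oO Cf Oy).
exact: (linearZ_LR (pgradL f y)).
Qed.

Lemma derive_add m (f : V -> R) u v y : Cdiff m.+1 O f -> O y ->
  'D_(u + v) f y = 'D_u f y + 'D_v f y.
Proof.
move=> Cf Oy; rewrite !(Cdiff_deriveE _ oO Cf Oy).
exact: (linearD (pgradL f y)).
Qed.

Lemma rel_entropyE (U Ub : state R) : 0 <= temp U -> 0 <= temp Ub ->
  rel_entropy psi U Ub = Jrel (xi U, temp U) (xi Ub, temp Ub)
    + 2^-1 * frob (vel U - vel Ub) ^+ 2.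
Proof.
move=> U0 Ub0; rewrite /rel_entropy /rel_psi /Jrel.
rewrite !(psi_eta O0 Cg psiE)//.
rewrite (psiE (z := (xi U, temp U)))// (psiE (z := (xi Ub, temp Ub)))//.
rewrite (Cdiff_deriveE ((xi U, temp U) - (xi Ub, temp Ub)) oO Cg1 (O0 (z := (xi Ub, temp Ub)) Ub0)).
rewrite /pgrad /=.
rewrite (eq_bigr (fun B => (xi U - xi Ub) 0 B * 'D_(ebase B) g (xi Ub, temp Ub))).
  set S := \big[_/_]_(_ <- _ | _) _; move: S (frob _) (g (xi U, temp U)) (g (xi Ub, temp Ub))
    ('D_etime g (xi U, temp U)) ('D_etime g (xi Ub, temp Ub)) (temp U) (temp Ub).
  move=> S f a b c d s t. ring.
by move=> B _; rewrite !mxE (psi_dxi psiE)// mulrC.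
Qed.

Lemma derive2_time (a : R) y : O y ->
  'D_(a *: etime) ('D_(a *: etime) g) y = a * a * 'D_etime ('D_etime g) y.
Proof.
move=> Oy; rewrite [LHS](derive_scale a etime (Cdiff_derive (a *: etime) Cg2) Oy) -mulrA.
congr (_ * _); rewrite [LHS](derive_swap (a *: etime) etime oO Cg2 Oy).
exact: (derive_scale a etime (Cdiff_derive etime Cg2) Oy).
Qed.

Lemma derive2_space (h : 'rV[R]_19) y : O y ->
  'D_((h, 0) : V) ('D_((h, 0) : V) g) y =
  \sum_C (\sum_B h 0 B * 'D_(ebase B) ('D_(ebase C) g) y) * h 0 C.
Proof.
move=> Oy; pose k : V := (h, 0); rewrite -/k.
rewrite [LHS](Cdiff_deriveE k oO (Cdiff_derive k Cg2) Oy) /pgrad /= mul0r addr0.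
apply: eq_bigr => C _; rewrite mulrC; congr (_ * _).
rewrite [LHS](derive_swap k (ebase C) oO Cg2 Oy).
by rewrite [LHS](Cdiff_deriveE k oO (Cdiff_derive (ebase C) Cg2) Oy) /pgrad mul0r addr0.
Qed.

Lemma taylor_box N z zb : box 0 N z -> box 0 N zb ->
  exists2 y, box 0 N y & g z - g zb - 'D_(z - zb) g zb
    = 2^-1 * 'D_(z - zb) ('D_(z - zb) g) y.
Proof.
move=> Kz Kzb; have [s|s s01 E] := @taylor2 R V g O zb (z - zb) oO Cg2.
  by move=> s01; apply: (box_sub O0 (N := N)); exact: box_line.
exists (zb + s *: (z - zb)); first exact: box_line.
by rewrite (addrC zb (z - zb)) subrK in E.
Qed.

Hypotheses (hconv : hess_xi_posdef psi) (heta : eta_th_pos psi).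

(** Through the intermediate state [w], [Jrel] is the sum of minus the Taylor remainder from [z] to
    [w] in temperature, positive by concavity, and the Taylor remainder from [zb] to [w] in [xi],
    positive by convexity. *)
Lemma Jrel_near N : exists2 c : R, 0 < c & forall z zb, box 0 N z -> box 0 N zb ->
  c * `|z - zb| ^+ 2 <= Jrel z zb.
Proof.
have [m m0 Hm] := DtDt_box O0 Cg psiE heta N.
have [k k0 Hk] := hess_box O0 Cg psiE hconv N.
exists (Num.min m k / 2); first by rewrite divr_gt0// lt_min m0.
move=> z zb Kz Kzb; pose w : V := (z.1, zb.2).
have Kw : box 0 N w by case: Kz Kzb => [h1 _] [_ h2]; split.
have Oz := box_sub O0 Kz; have Ozb := box_sub O0 Kzb; have Ow := box_sub O0 Kw.
pose a := zb.2 - z.2.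
have vE : w - z = a *: etime.
  by congr pair => /=; rewrite ?subrr ?scaler0// [_ *: _]mulr1.
have EA : 2^-1 * (m * a ^+ 2) <= g z - g w + a * 'D_etime g z.
  have [y Ky] := taylor_box Kw Kz; have Oy := box_sub O0 Ky.
  rewrite vE (derive2_time a Oy) [X in _ - X](derive_scale a etime Cg1 Oz).
  have a2 : 0 <= a ^+ 2 by rewrite sqr_ge0.
  have := ler_wpM2l a2 (Hm y Ky); rewrite expr2.
  move: ('D_etime _ y) ('D_etime _ z) (g w) (g z) (a * a) (a) => d1 d2 d3 d4 b c.
  by move=> h1 h2; lra.
pose h := z.1 - zb.1.
have hE : w - zb = (h, 0) by congr pair; rewrite /= subrr.
have EB : 2^-1 * (k * `|h| ^+ 2) <= g w - g zb - 'D_(w - zb) g zb.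
  have [y Ky ->] := taylor_box Kw Kzb; have Oy := box_sub O0 Ky.
  by rewrite hE (derive2_space h Oy) ler_wpM2l ?invr_ge0// Hk.
have JE : Jrel z zb = (g z - g w + a * 'D_etime g z) + (g w - g zb - 'D_(w - zb) g zb).
  rewrite /Jrel (_ : z - zb = (w - zb) + (- a) *: etime); last first.
    have -> : (- a) *: etime = z - w by rewrite scaleNr -vE opprB.
    by rewrite [w - zb + _]addrC addrA subrK.
  rewrite (derive_add (w - zb) (- a *: etime) Cg1 Ozb) (derive_scale (- a) etime Cg1 Ozb) /a.
  move: ('D_etime _ _) ('D_etime _ _) ('D_(w - zb) _ _) (g z) (g zb) (g w) (z.2) (zb.2).
  by move=> a1 a2 a3 a4 a5 a6 a7 a8; ring.
rewrite JE; apply: le_trans (lerD EA EB).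
have nE : `|z - zb| ^+ 2 <= a ^+ 2 + `|h| ^+ 2.
  rewrite prod_normE /= -/h [`|z.2 - _|]distrC -/a.
  rewrite -(real_normK (num_real a)).
  rewrite /Num.max; case: ifP => _; first by rewrite lerDl sqr_ge0.
  by rewrite lerDr sqr_ge0.
have mm : Num.min m k <= m by rewrite ge_min lexx.
have mk : Num.min m k <= k by rewrite ge_min lexx orbT.
have mp : 0 <= Num.min m k by rewrite le_min !ltW.
have := ler_wpM2l mp nE.
have := ler_wpM2r (sqr_ge0 a) mm; have := ler_wpM2r (sqr_ge0 `|h|) mk.
move: (Num.min m k) (`|z - zb| ^+ 2) (a ^+ 2) (`|h| ^+ 2) => u1 u2 u3 u4.
by lra.
Qed.

End relative_free_energy.

(** * Consequences of the growth conditions *)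

Section growth.
Context {R : realType}.
Local Notation V := ('rV[R]_19 * R)%type.

Lemma frob_ge0 m n (A : 'M[R]_(m, n)) : 0 <= frob A.
Proof. exact: sqrtr_ge0. Qed.

Lemma frob_sqr m n (A : 'M[R]_(m, n)) : frob A ^+ 2 = \sum_i \sum_j A i j ^+ 2.
Proof. by rewrite /frob sqr_sqrtr// !sumr_ge0// => i _; rewrite sumr_ge0// => j _; exact: sqr_ge0. Qed.

Lemma frob_entry m n (A : 'M[R]_(m, n)) i j : `|A i j| <= frob A.
Proof.
rewrite -(ler_pXn2r (n := 2))// ?nnegrE ?frob_ge0// frob_sqr real_normK ?num_real//.
rewrite (bigD1 i)//= (bigD1 j)//= -addrA lerDl addr_ge0// sumr_ge0// => k _.
  exact: sqr_ge0.
by rewrite sumr_ge0// => k' _; exact: sqr_ge0.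
Qed.

Lemma powR_ge_id (x s : R) : 0 <= x -> 1 <= s -> x <= 1 + x `^ s.
Proof.
move=> x0 s1; have [x1|x1] := leP x 1; first by rewrite (le_trans x1)// lerDl powR_ge0.
rewrite (@le_trans _ _ (x `^ s))//; last by rewrite lerDr.
by rewrite -[leLHS]powRr1// ler_powR// ltW.
Qed.

Lemma powR_eps (s eps : R) : 1 < s -> 0 < eps ->
  exists2 C : R, 0 < C & forall x, 0 <= x -> x <= eps * x `^ s + C.
Proof.
move=> s1 e0; have s0 : 0 < s - 1 by rewrite subr_gt0.
(* The threshold beyond which [x ^ (s - 1)] exceeds [eps^-1]; below it the constant [K] alone bounds
   [x]. *)
pose K := (eps^-1) `^ ((s - 1)^-1).
have K0 : 0 < K by rewrite powR_gt0// invr_gt0.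
exists K => // x x0; have [xK|Kx] := leP x K.
  by rewrite (le_trans xK)// lerDr mulr_ge0 ?powR_ge0// ltW.
have xp : 0 < x by exact: lt_trans Kx.
have H : eps^-1 <= x `^ (s - 1).
  have := @ge0_ler_powR _ (s - 1) (ltW s0) K x.
  rewrite !nnegrE => /(_ (ltW K0) x0 (ltW Kx)); apply: le_trans.
  by rewrite /K -powRrM mulVf ?gt_eqF// powRr1// invr_ge0 ltW.
rewrite (@le_trans _ _ (eps * x `^ s))//; last by rewrite lerDl ltW.
have -> : x `^ s = x * x `^ (s - 1).
  have := @powRD R x 1 (s - 1); rewrite (powRr1 x0) (addrC 1) subrK; apply.
  by rewrite (gt_eqF xp) implybT.
rewrite mulrCA -[leLHS]mulr1 ler_wpM2l//.
by rewrite -[leLHS](mulfV (lt0r_neq0 e0)) ler_wpM2l// ltW.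
Qed.

Lemma powR_1D (x s : R) : 0 <= x -> 0 <= s -> (1 + x) `^ s <= 2 `^ s * (1 + x `^ s).
Proof.
move=> x0 s0; have mono := @ge0_ler_powR _ s s0.
have [x1|x1] := leP x 1.
  rewrite (@le_trans _ _ (2 `^ s))//.
    by apply: mono; rewrite ?nnegrE ?addr_ge0//; lra.
  by rewrite ler_peMr ?powR_ge0// lerDl powR_ge0.
rewrite (@le_trans _ _ ((2 * x) `^ s))//.
  by apply: mono; rewrite ?nnegrE ?addr_ge0 ?mulr_ge0//; lra.
by rewrite powRM// ler_wpM2l ?powR_ge0// lerDr.
Qed.

Variables (psi : 'rV[R]_19 -> R -> R) (O : set V) (g : V -> R).
Hypotheses (oO : open O) (O0 : forall z : V, 0 <= z.2 -> O z)
  (Cg : Cdiff 3 O g) (psiE : forall z : V, 0 <= z.2 -> psi z.1 z.2 = g z).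
Variables (p q r l : R).
Hypotheses (hp : 4 <= p) (hq : 1 < q) (hr : 1 < r) (hl : 1 < l)
  (hG1 : growth1 p q r l psi) (hG2 : growth2 p q r l psi) (hG3 : growth3 p q r l psi).

Definition sz (z : V) : R := size_pqrl p q r l z.1 z.2.

Lemma sz_ge0 z : 0 <= sz z.
Proof. by rewrite /sz /size_pqrl !addr_ge0// powR_ge0. Qed.

Lemma norm_le_parts (z : V) : 0 <= z.2 ->
  `|z| <= frob (Fpart z.1) + frob (zpart z.1) + `|wpart z.1| + z.2.
Proof.
move=> z0; have S0 : 0 <= frob (Fpart z.1) + frob (zpart z.1) + `|wpart z.1|.
  by rewrite !addr_ge0// frob_ge0.
rewrite prod_normE ge_max; apply/andP; split; last by rewrite ger0_norm// lerDr.
rewrite (@le_trans _ _ (frob (Fpart z.1) + frob (zpart z.1) + `|wpart z.1|))//; last by rewrite lerDl.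
rewrite [leLHS]/Num.Def.normr/= mx_normrE (bigmax_le _ S0)//= => -[i j] _ /=.
rewrite ord1; have := frob_ge0 (Fpart z.1); have := frob_ge0 (zpart z.1) => f1 f2.
case: (ixP j) => [k b|k b|].
- by rewrite -FpartE -addrA (le_trans (frob_entry _ _ _))// lerDl addr_ge0.
- by rewrite -zpartE (le_trans (frob_entry _ _ _))// -addrA addrCA lerDl addr_ge0.
- by rewrite -wpartE lerDr addr_ge0.
Qed.

(** All four exponents exceed 1, so terms linear in the state can be absorbed into an arbitrarily
    small multiple of the size. *)
Lemma norm_sz_eps (eps : R) : 0 < eps ->
  exists2 C : R, 0 < C & forall z : V, 0 <= z.2 -> `|z| <= eps * sz z + C.
Proof.
move=> e0; have p1 : 1 < p by rewrite (lt_le_trans _ hp)// ltr1n.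
have [C1 C10 H1] := powR_eps p1 e0; have [C2 C20 H2] := powR_eps hq e0.
have [C3 C30 H3] := powR_eps hr e0; have [C4 C40 H4] := powR_eps hl e0.
exists (C1 + C2 + C3 + C4); first by rewrite !addr_gt0.
move=> z z0; apply: le_trans (norm_le_parts z0) _.
have := H1 _ (frob_ge0 (Fpart z.1)); have := H2 _ (frob_ge0 (zpart z.1)).
have := H3 _ (normr_ge0 (wpart z.1)); have := H4 _ z0.
rewrite /sz /size_pqrl.
move: (_ `^ _) (_ `^ _) (_ `^ _) (_ `^ _) => a b c d.
move: (frob _) (frob _) `|_| (z.2) => a' b' c' d'; lra.
Qed.

Lemma norm_sz : exists2 C : R, 0 < C & forall z : V, 0 <= z.2 -> `|z| <= sz z + C.
Proof. by have [C C0 H] := norm_sz_eps ltr01; exists C => // z /H; rewrite mul1r. Qed.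

Lemma sz_box : exists2 C : R, 0 < C & forall z : V, 0 <= z.2 -> box 0 (sz z + C) z.
Proof.
have [C C0 H] := norm_sz; exists C => // z z0; have hz := H z z0; split.
  by move=> j; rewrite (le_trans (normr_coord _ _)).
by rewrite z0/= (le_trans _ hz)// (le_trans (ler_norm _))// normr_time.
Qed.

Lemma box_le lo N N' (z : V) : N <= N' -> box lo N z -> box lo N' z.
Proof.
move=> NN [h1 /andP[h2 h3]]; split => [j|]; first exact: le_trans NN.
by rewrite h2 (le_trans h3).
Qed.

(* A continuous quantity negligible at infinity is at most linear in the size. *)
Lemma negligible_linear (f : 'rV[R]_19 -> R -> R) (b : R -> R) :
  negligible_growth p q r l f ->
  (forall N z, box 0 N z -> `|f z.1 z.2| <= b N) ->
  exists2 C : R, 0 < C & forall z : V, 0 <= z.2 -> `|f z.1 z.2| <= C * (1 + sz z).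
Proof.
move=> /(_ 1 ltr01)[N HN] Hb; have [C0 C00 Hbox] := sz_box.
exists (1 + `|b (Num.max N 1 + C0)|); first by rewrite ltr_pwDl.
move=> z z0; have s0 := sz_ge0 z.
have [sN|Ns] := leP (sz z) (Num.max N 1).
  have := Hb (Num.max N 1 + C0) z (box_le _ (Hbox z z0)).
  rewrite lerD2r => /(_ sN) H; apply: le_trans H _; apply: le_trans (ler_norm _) _.
  rewrite mulrDl mul1r; apply: ler_wpDl; first by rewrite addr_ge0.
  by rewrite ler_peMr// lerDl.
move: Ns; rewrite gt_max => /andP[Ns s1].
have := HN z.1 z.2 z0 Ns; rewrite -/(sz z) normrM normfV (ger0_norm s0).
rewrite ltr_pdivrMr ?mul1r ?(lt_trans ltr01)// => /ltW H; apply: le_trans H _.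
rewrite mulrDl mul1r; apply: ler_wpDr; last by rewrite lerDr.
by rewrite mulr_ge0// addr_ge0.
Qed.

End growth.

(** * Behaviour for large states and the comparison principle *)

Section control.
Context {R : realType}.
Local Notation V := ('rV[R]_19 * R)%type.
Variables (psi : 'rV[R]_19 -> R -> R) (O : set V) (g : V -> R).
Hypotheses (oO : open O) (O0 : forall z : V, 0 <= z.2 -> O z)
  (Cg : Cdiff 3 O g) (psiE : forall z : V, 0 <= z.2 -> psi z.1 z.2 = g z).
Variables (p q r l : R).
Hypotheses (hp : 4 <= p) (hq : 1 < q) (hr : 1 < r) (hl : 1 < l)
  (hG1 : growth1 p q r l psi) (hG2 : growth2 p q r l psi) (hG3 : growth3 p q r l psi).
Hypotheses (hconv : hess_xi_posdef psi) (heta : eta_th_pos psi).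

Local Notation size_z := (sz p q r l).
Local Notation J := (Jrel g).
Local Notation en z := (g z - z.2 * 'D_etime g z).

Let Cg2 : Cdiff 2 O g. Proof. exact: Cdiff_le Cg. Qed.
Let Cg1 : Cdiff 1 O g. Proof. exact: Cdiff_le Cg. Qed.
Let p0 : 0 < p. Proof. by rewrite (lt_le_trans _ hp). Qed.

Lemma temp_derive_linear : exists2 C : R, 0 < C &
  forall z : V, 0 <= z.2 -> `|'D_etime g z| <= C * (1 + size_z z).
Proof.
have HB N : exists b : R, forall z : V, box 0 N z -> `|'D_etime g z| <= b.
  by have [b _ Hb] := Cdiff_box_bound O0 N (Cdiff_derive etime Cg1); exists b.
have [b Hb] := choice HB.
have [|C C0 H] := @negligible_linear _ _ _ _ _ hp hq hr hl _ b hG3.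
  move=> N z Kz; have [_ /andP[z0 _]] := Kz.
  rewrite normr_id (psi_dth O0 Cg psiE _ z0) -surjective_pairing; exact: Hb.
exists C => // z z0; have := H z z0.
by rewrite normr_id (psi_dth O0 Cg psiE _ z0) -surjective_pairing.
Qed.

Lemma energy_linear : exists2 C : R, 0 < C & forall z : V, 0 <= z.2 ->
  C * size_z z - C <= en z /\ `|en z| <= C * (1 + size_z z).
Proof.
have [c c0 H] := hG1; exists c => // z z0.
have /andP[h1 h2] := H z.1 z.2 z0; have s0 := sz_ge0 p q r l z.
rewrite (psi_energy O0 Cg psiE _ z0) -surjective_pairing -/(size_z z) in h1 h2.
split=> //; rewrite ler_norml; apply/andP; split; last by rewrite mulrDr mulr1 [leRHS]addrC.
rewrite (le_trans _ h1)// mulrDr mulr1 opprD [leLHS]addrC lerD2r.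
by rewrite (@le_trans _ _ 0)// ?oppr_le0 mulr_ge0// ltW.
Qed.

Lemma frob_le_sum m n (A : 'M[R]_(m, n)) (M : R) : (forall i j, `|A i j| <= M) ->
  frob A <= m%:R * n%:R * (1 + M) ^+ 2.
Proof.
move=> HM; rewrite -(ler_pXn2r (n := 2)) ?nnegrE ?frob_ge0//; last first.
  by rewrite mulr_ge0 ?sqr_ge0 ?mulr_ge0.
rewrite frob_sqr.
have M1 i j : A i j ^+ 2 <= (1 + M) ^+ 2.
  have M0 := le_trans (normr_ge0 _) (HM i j).
  by rewrite -(real_normK (num_real (A i j))) ler_pXn2r ?nnegrE ?addr_ge0// (le_trans (HM i j))// lerDr.
case: m n A HM M1 => [|m] [|n] A HM M1.
- by rewrite big_ord0 sqr_ge0.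
- by rewrite big_ord0 sqr_ge0.
- by rewrite big1 ?sqr_ge0// => i _; rewrite big_ord0.
have M1' : 1 <= (1 + M) ^+ 2.
  have M0 := le_trans (normr_ge0 _) (HM 0 0).
  by rewrite exprn_ege1// lerDl.
set S := (1 + M) ^+ 2 in M1 M1' *.
rewrite (@le_trans _ _ (m.+1%:R * n.+1%:R * S))//.
  rewrite (@le_trans _ _ (\sum_(i < m.+1) \sum_(j < n.+1) S))//.
    by apply: ler_sum => i _; apply: ler_sum => j _; exact: M1.
  by rewrite !sumr_const !card_ord -natrM mulr_natl mulnC mulrnA.
rewrite expr2 ler_peMr//; first by rewrite mulr_ge0// (le_trans _ M1').
by rewrite -[leLHS]mulr1 ler_pM// -natrM ler1n.
Qed.

(** The exponents of (G2) are kept block by block, because [stress_far] pairs each block with minors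
    of the matching growth. The last clause, valid since the exponents are at least 1, is what the
    Taylor remainders use. *)
Lemma gradient_linear : exists2 C : R, 0 < C & forall z : V, 0 <= z.2 ->
  [/\ forall j b, `|'D_(ebase (ixF j b)) g z| <= C * (1 + size_z z),
      forall j b, `|'D_(ebase (ixz j b)) g z| `^ (p / (p - 1)) <= C * (1 + size_z z),
      `|'D_(ebase ixw) g z| `^ (p / (p - 2)) <= C * (1 + size_z z)
    & forall B, `|'D_(ebase B) g z| <= C * (1 + size_z z)].
Proof.
pose s1 := p / (p - 1); pose s2 := p / (p - 2).
have pm1 : 0 < p - 1 by rewrite subr_gt0 (lt_le_trans _ hp)// ltr1n.
have pm2 : 0 < p - 2 by rewrite subr_gt0 (lt_le_trans _ hp)// ltr_nat.
have s11 : 1 <= s1 by rewrite /s1 ler_pdivlMr// mul1r lerBlDr lerDl.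
have s21 : 1 <= s2 by rewrite /s2 ler_pdivlMr// mul1r lerBlDr lerDl.
have s10 : 0 <= s1 by rewrite (le_trans _ s11).
have s20 : 0 <= s2 by rewrite (le_trans _ s21).
have gE (z : V) B : 0 <= z.2 -> grad_xi psi z.1 z.2 0 B = 'D_(ebase B) g z.
  by move=> z0; rewrite mxE (psi_dxi psiE _ _ z0) -surjective_pairing.
pose Gf x th := frob (Fpart (grad_xi psi x th)) + frob (zpart (grad_xi psi x th)) `^ s1
    + `|wpart (grad_xi psi x th)| `^ s2.
have G0 x th : 0 <= Gf x th by rewrite !addr_ge0 ?powR_ge0 ?frob_ge0.
have HB N : exists b : R, forall z : V, box 0 N z -> `|Gf z.1 z.2| <= b.
  have [b b0 Hb] := Cdiff_deriv_box_bound oO O0 N Cg1.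
  pose M := b * (1 + \sum_B `|ebase B : V|).
  have HM z B : box 0 N z -> `|'D_(ebase B) g z| <= M.
    move=> Kz; apply: le_trans (Hb _ _ Kz) _; rewrite /M ler_wpM2l ?(ltW b0)//.
    by rewrite (bigD1 B)//= addrCA lerDl addr_ge0// sumr_ge0.
  pose M' := 3%:R * 3%:R * (1 + M) ^+ 2.
  have M'0 : 0 <= M' by rewrite mulr_ge0 ?sqr_ge0 ?mulr_ge0.
  exists (M' + M' `^ s1 + M `^ s2) => z Kz; rewrite ger0_norm//.
  have [_ /andP[z0 _]] := Kz.
  have M0 : 0 <= M := le_trans (normr_ge0 _) (HM z ixw Kz).
  have b1 : frob (Fpart (grad_xi psi z.1 z.2)) <= M'.
    by apply: frob_le_sum => j c; rewrite FpartE gE// HM.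
  have b2 : frob (zpart (grad_xi psi z.1 z.2)) <= M'.
    by apply: frob_le_sum => j c; rewrite zpartE gE// HM.
  have b3 : `|wpart (grad_xi psi z.1 z.2)| <= M by rewrite wpartE gE// HM.
  rewrite lerD ?lerD//; apply: ge0_ler_powR; rewrite ?nnegrE ?frob_ge0//.
have [b Hb] := choice HB.
have [C C0 H] := @negligible_linear _ _ _ _ _ hp hq hr hl Gf b hG2 Hb.
have key z : 0 <= z.2 -> [/\ forall j b, `|'D_(ebase (ixF j b)) g z| <= C * (1 + size_z z),
      forall j b, `|'D_(ebase (ixz j b)) g z| `^ s1 <= C * (1 + size_z z) &
      `|'D_(ebase ixw) g z| `^ s2 <= C * (1 + size_z z)].
  move=> z0; have := H z z0; rewrite ger0_norm// /Gf => Hz.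
  have f1 := frob_ge0 (Fpart (grad_xi psi z.1 z.2)).
  have f2 := powR_ge0 (frob (zpart (grad_xi psi z.1 z.2))) s1.
  have f3 := powR_ge0 `|wpart (grad_xi psi z.1 z.2)| s2.
  split.
  - move=> j c; rewrite -gE// -FpartE (le_trans (frob_entry _ _ _))// (le_trans _ Hz)//.
    by rewrite -addrA lerDl addr_ge0.
  - move=> j c; rewrite -gE// -zpartE (le_trans _ Hz)//.
    rewrite (@le_trans _ _ (frob (zpart (grad_xi psi z.1 z.2)) `^ s1))//.
      by apply: ge0_ler_powR; rewrite ?nnegrE ?frob_ge0 ?frob_entry.
    by rewrite -addrA addrCA lerDl addr_ge0.
  - by rewrite -gE// -wpartE (le_trans _ Hz)// lerDr addr_ge0.
exists (1 + C); first by rewrite addr_gt0.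
move=> z z0; have [h1 h2 h3] := key z z0.
have u1 : 1 <= 1 + size_z z by rewrite lerDl sz_ge0.
have u0 : 0 <= 1 + size_z z by rewrite (le_trans _ u1).
have w1 : C * (1 + size_z z) <= (1 + C) * (1 + size_z z) by rewrite ler_wpM2r// lerDr.
have w2 : 1 + C * (1 + size_z z) <= (1 + C) * (1 + size_z z) by rewrite mulrDl mul1r lerD2r.
split.
- by move=> j c; apply: le_trans (h1 j c) w1.
- by move=> j c; apply: le_trans (h2 j c) w1.
- exact: le_trans h3 w1.
- move=> B; case: (ixP B) => [j c|j c|].
  + exact: le_trans (h1 j c) w1.
  + exact: le_trans (powR_ge_id (normr_ge0 _) s11) (le_trans (lerD (lexx 1) (h2 j c)) w2).
  + exact: le_trans (powR_ge_id (normr_ge0 _) s21) (le_trans (lerD (lexx 1) h3) w2).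
Qed.

(** The temperature derivative at [zb] cancels. What remains is the energy of [z] plus terms that
    are of lower order for bounded [zb]. *)
Lemma Jrel_energyE (z zb : V) : 0 <= zb.2 -> J z zb = en z + zb.2 * 'D_etime g z - g zb
  - \sum_B (z.1 0 B - zb.1 0 B) * 'D_(ebase B) g zb.
Proof.
move=> zb0; rewrite /Jrel (Cdiff_deriveE (z - zb) oO Cg1 (O0 zb0)) /pgrad.
rewrite (eq_bigr (fun B => (z.1 0 B - zb.1 0 B) * 'D_(ebase B) g zb)); last first.
  by move=> B _; rewrite /= !mxE.
rewrite /=; set S := \sum_B _.
move: S (g z) (g zb) ('D_etime g z) ('D_etime g zb) (z.2) (zb.2) => a1 a2 a3 a4 a5 a6 a7.
ring.
Qed.

(** The energy grows at least like [c] times the size by (G1); (G3) makes the temperature derivative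
    negligible, and the term linear in [xi] is absorbed because the size is superlinear. *)
Lemma Jrel_far M : exists c N : R, 0 < c /\ forall z zb : V, 0 <= z.2 -> box 0 M zb ->
  N < size_z z -> c * (1 + size_z z) <= J z zb.
Proof.
have [c c0 He] := energy_linear.
have [b b0 Hb] := Cdiff_box_bound O0 M Cg1.
have [b' b'0 Hb'] := Cdiff_deriv_box_bound oO O0 M Cg1.
pose b1 := b' * (1 + \sum_B `|ebase B : V|).
have b10 : 0 < b1 by rewrite mulr_gt0// ltr_pwDl// sumr_ge0.
have Hb1 zb B : box 0 M zb -> `|'D_(ebase B) g zb| <= b1.
  move=> Kzb; apply: le_trans (Hb' _ _ Kzb) _; rewrite ler_wpM2l ?(ltW b'0)//.
  by rewrite (bigD1 B)//= addrCA lerDl addr_ge0// sumr_ge0.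
pose M1 := 1 + `|M|.
have M10 : 0 < M1 by rewrite ltr_pwDl.
have eps1 : 0 < c / (4 * M1) by rewrite divr_gt0 ?mulr_gt0.
have [N1 HN1] := hG3 eps1.
have eps2 : 0 < c / (4 * (19 * b1)).
  by apply: divr_gt0 => //; apply: mulr_gt0 => //; exact: mulr_gt0.
have [C2 C20 H2] := norm_sz_eps hp hq hr hl eps2.
(* All constant losses: from (G1), from [g zb], and from the 19 coordinates of the linear term. *)
pose D := c + b + 19 * b1 * (C2 + M1) .
have D0 : 0 < D.
  by apply: addr_gt0; [exact: addr_gt0 | apply: mulr_gt0; [exact: mulr_gt0 | exact: addr_gt0]].
(* Two quarters of [c] times the size pay for the temperature derivative and the linear term. Beyond
   the second threshold a third quarter exceeds [D] by [c / 4], and the last one is left. *)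
exists (c / 4), (Num.max N1 (4 / c * D + 1)); split; first by rewrite divr_gt0.
move=> z zb z0 Kzb; have s0 := sz_ge0 p q r l z.
rewrite gt_max => /andP[sN1 sN2].
have [_ /andP[zb0 zbM]] := Kzb.
have s1 : 0 < size_z z by rewrite (lt_trans _ sN2)// addr_gt0// mulr_gt0// divr_gt0.
have [e1 _] := He z z0.
have h1 : `|zb.2 * 'D_etime g z| <= c / 4 * size_z z.
  have := HN1 z.1 z.2 z0 sN1.
  rewrite (psi_dth O0 Cg psiE _ z0) -surjective_pairing -/(size_z z) normrM normr_id normfV (ger0_norm s0).
  rewrite ltr_pdivrMr// => /ltW h.
  rewrite normrM (@le_trans _ _ (M1 * (c / (4 * M1) * size_z z)))//.
    by rewrite ler_pM// ger0_norm// (le_trans zbM)// /M1 (le_trans (ler_norm M))// lerDr.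
  have Mn : M1 != 0 by rewrite gt_eqF.
  rewrite le_eqVlt; apply/orP; left; apply/eqP.
  by move: (size_z z) (c) Mn; move: (M1) => m s a mn; field.
have h3 : `|\sum_B (z.1 0 B - zb.1 0 B) * 'D_(ebase B) g zb| <= c / 4 * size_z z + 19 * b1 * (C2 + M1).
  have nz := H2 z z0.
  have hB B : `|(z.1 0 B - zb.1 0 B) * 'D_(ebase B) g zb| <= (c / (4 * (19 * b1)) * size_z z + (C2 + M1)) * b1.
    rewrite normrM ler_pM//; last exact: Hb1.
    rewrite (le_trans (ler_normB _ _))// addrA lerD//.
      exact: le_trans (normr_coord _ _) nz.
    have [hM _] := Kzb; rewrite (le_trans (hM B))// /M1 (le_trans (ler_norm M))// lerDr//.
  rewrite (le_trans (ler_norm_sum _ _ _))//.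
  rewrite (le_trans (ler_sum _ (fun B _ => hB B)))// sumr_const card_ord -mulr_natl.
  have b1n : b1 != 0 by rewrite gt_eqF.
  move: (size_z z) (C2 + M1) (b1) (c) b1n => s w b2 c2 b02.
  by rewrite le_eqVlt; apply/orP; left; apply/eqP; field.
rewrite (Jrel_energyE _ zb0).
have h4 := Hb zb Kzb.
have D4 : D <= c / 4 * size_z z - c / 4.
  rewrite -[X in _ - X]mulr1 -mulrBr mulrC -ler_pdivrMr ?divr_gt0//.
  by rewrite invf_div mulrC lerBrDr ltW.
move: h1 h3 h4; rewrite !ler_norml => /andP[h1 _] /andP[_ h3] /andP[_ h4].
rewrite /D in D4.
move: e1 h1 h3 h4 D4; move: (19 * b1 * (C2 + M1)) (en z) (zb.2 * _) (g zb) (\sum_B _) => w e u v S.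
move: (size_z z) => s e1 h1 h3 h4 D4; lra.
Qed.

Lemma Jrel_ge0 M (z zb : V) : 0 <= z.2 -> box 0 M zb -> 0 <= J z zb.
Proof.
move=> z0 Kzb; have [C _ Hbox] := sz_box hp hq hr hl.
pose N := Num.max (size_z z + C) M.
have Kz1 : box 0 N z by apply: box_le (Hbox z z0); rewrite le_max lexx.
have Kzb1 : box 0 N zb by apply: box_le Kzb; rewrite le_max lexx orbT.
have [c c0 H] := Jrel_near oO O0 Cg psiE hconv heta N.
by apply: le_trans (H z zb Kz1 Kzb1); rewrite mulr_ge0 ?exprn_ge0// ltW.
Qed.

(* Comparison principle: what is quadratic near the reference states and at most
   linear in the size far from them is controlled by the relative free energy. *)
Lemma Jrel_control dl M (P : V -> Prop) (Q : V -> V -> R) : 0 <= dl ->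
  (exists C : R, forall z zb : V, 0 <= z.2 -> P z -> box dl M zb -> `|Q z zb| <= C * (1 + size_z z)) ->
  (forall N, exists C : R, forall z zb : V, box 0 N z -> P z -> box dl M zb ->
      M <= N -> `|Q z zb| <= C * `|z - zb| ^+ 2) ->
  exists2 C : R, 0 < C & forall z zb : V, 0 <= z.2 -> P z -> box dl M zb ->
    `|Q z zb| <= C * J z zb.
Proof.
move=> dl0 [C1 far] near; have [c [N [c0 Hfar]]] := Jrel_far M.
have [C0 C00 Hbox] := sz_box hp hq hr hl.
(* Large enough that a box of this radius contains every state of size at most [N] as well as the
   reference states. *)
pose N' := Num.max (N + C0) M.
have [C2 HC2] := near N'.
have [k k0 Hk] := Jrel_near oO O0 Cg psiE hconv heta N'.
exists (1 + `|C1| / c + `|C2| / k).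
  by rewrite -addrA ltr_pwDl// addr_ge0// divr_ge0// ltW.
move=> z zb z0 Pz Kzb.
have Kzb0 : box 0 M zb.
  by case: Kzb => h1 /andP[h2 h3]; split=> //; rewrite h3 (le_trans dl0 h2).
have J0 := Jrel_ge0 z0 Kzb0.
have [sN|Ns] := leP (size_z z) N.
  have Kz : box 0 N' z.
    by apply: box_le (Hbox z z0); rewrite le_max lerD2r sN.
  have Kzb' : box 0 N' zb by apply: box_le Kzb0; rewrite le_max lexx orbT.
  have MN : M <= N' by rewrite le_max lexx orbT.
  have h1 := HC2 z zb Kz Pz Kzb MN; have h2 := Hk z zb Kz Kzb'.
  apply: le_trans h1 _.
  rewrite (@le_trans _ _ (`|C2| * `|z - zb| ^+ 2))// ?ler_wpM2r ?exprn_ge0 ?ler_norm//.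
  rewrite (@le_trans _ _ (`|C2| / k * J z zb))//.
    by rewrite -mulrA ler_wpM2l// ler_pdivlMl.
  apply: ler_wpM2r => //; rewrite lerDr; apply: addr_ge0 => //; apply: divr_ge0 => //.
  exact: ltW.
have h1 := far z zb z0 Pz Kzb; have h2 := Hfar z zb z0 Kzb0 Ns.
apply: le_trans h1 _; have s0 : 0 <= 1 + size_z z by apply: addr_ge0 => //; exact: sz_ge0.
rewrite (@le_trans _ _ (`|C1| * (1 + size_z z)))// ?ler_wpM2r ?ler_norm//.
rewrite (@le_trans _ _ (`|C1| / c * J z zb))//.
  by rewrite -mulrA ler_wpM2l// ler_pdivlMl.
apply: ler_wpM2r; first exact: J0.
rewrite -addrA addrCA lerDl; apply: addr_ge0 => //; apply: divr_ge0 => //; exact: ltW.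
Qed.

(** The one is needed on the right because [Jrel] vanishes when the two states coincide. It is the
    source of the inhomogeneous term of order mu0 in the vanishing-viscosity estimate. *)
Lemma sz_Jrel M : exists2 C : R, 0 < C & forall z zb : V, 0 <= z.2 -> box 0 M zb ->
  1 + size_z z <= C * (1 + J z zb).
Proof.
have [c [N [c0 Hfar]]] := Jrel_far M.
exists (1 + `|N| + c^-1); first by rewrite addr_gt0 ?invr_gt0// ltr_pwDl.
move=> z zb z0 Kzb; have J0 := Jrel_ge0 z0 Kzb.
have J1 : 1 <= 1 + J z zb by rewrite lerDl.
have [sN|Ns] := leP (size_z z) N.
  apply: (@le_trans _ _ (1 + `|N|)); first by rewrite lerD2l (le_trans sN)// ler_norm.
  by rewrite -[leLHS]mulr1 ler_pM// lerDl invr_ge0 ltW.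
have h2 := Hfar z zb z0 Kzb Ns.
apply: (@le_trans _ _ (c^-1 * J z zb)); first by rewrite ler_pdivlMl.
rewrite ler_pM ?invr_ge0 ?(ltW c0)//; last by rewrite lerDr.
by rewrite lerDr addr_ge0.
Qed.

End control.

(** * Quantities controlled by the relative free energy *)

Section quadratic_bounds.
Context {R : realType}.
Local Notation V := ('rV[R]_19 * R)%type.
Variables (psi : 'rV[R]_19 -> R -> R) (O : set V) (g : V -> R).
Hypotheses (oO : open O) (O0 : forall z : V, 0 <= z.2 -> O z)
  (Cg : Cdiff 3 O g) (psiE : forall z : V, 0 <= z.2 -> psi z.1 z.2 = g z).
Variables (p q r l : R).
Hypotheses (hp : 4 <= p) (hq : 1 < q) (hr : 1 < r) (hl : 1 < l)
  (hG1 : growth1 p q r l psi) (hG2 : growth2 p q r l psi) (hG3 : growth3 p q r l psi).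
Hypotheses (hconv : hess_xi_posdef psi) (heta : eta_th_pos psi).

Local Notation size_z := (sz p q r l).
Local Notation J := (Jrel g).
Local Notation en z := (g z - z.2 * 'D_etime g z).

Let Cg2 : Cdiff 2 O g. Proof. exact: Cdiff_le Cg. Qed.
Let Cg1 : Cdiff 1 O g. Proof. exact: Cdiff_le Cg. Qed.
Let control dl M P Q := @Jrel_control R psi O g oO O0 Cg psiE p q r l hp hq hr hl hG1 hG3 hconv heta dl M P Q.

Lemma box_norm lo M (z : V) : 0 <= lo -> box lo M z -> `|z| <= `|M|.
Proof.
move=> lo0 [h1 /andP[h2 h3]]; rewrite prod_normE ge_max; apply/andP; split.
  rewrite [leLHS]/Num.Def.normr/= mx_normrE (bigmax_le _ (normr_ge0 M))//= => -[i j] _ /=.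
  by rewrite ord1 (le_trans (h1 j))// ler_norm.
by rewrite ger0_norm ?(le_trans lo0 h2)// (le_trans h3)// ler_norm.
Qed.

(** Three derivatives of [g] make the remainder of a first derivative quadratic near the reference
    states; far away the derivative and its linearisation grow at most linearly in the size. *)
Lemma taylor_rem_control M (i : option 'I_19) : exists2 C : R, 0 < C & forall z zb : V,
  0 <= z.2 -> box 0 M zb -> `|taylor_rem ('D_(ebas i) g) z zb| <= C * J z zb.
Proof.
have CD : Cdiff 2 O ('D_(ebas i) g) := Cdiff_derive _ Cg.
have CD1 : Cdiff 1 O ('D_(ebas i) g) := Cdiff_derive _ Cg2.
have [||C C0 H] := @control 0 M (fun=> True) (taylor_rem ('D_(ebas i) g)) (lexx 0).
- have [C1 C10 H1] : exists2 C : R, 0 < C & forall z : V, 0 <= z.2 ->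
      `|'D_(ebas i) g z| <= C * (1 + size_z z).
    case: i {CD CD1} => [B|].
      have [C C0 H] := gradient_linear oO O0 Cg psiE hp hq hr hl hG2.
      by exists C => // z z0; have [_ _ _ h] := H z z0; exact: h.
    have [C C0 H] := temp_derive_linear O0 Cg psiE hp hq hr hl hG3.
    by exists C => // z z0; exact: H.
  have [b b0 Hb] := Cdiff_box_bound O0 M CD.
  have [b' b'0 Hb'] := Cdiff_deriv_box_bound oO O0 M CD1.
  have [C2 C20 H2] := norm_sz hp hq hr hl.
  exists (C1 + b + b' * (1 + C2 + `|M|)) => z zb z0 _ Kzb.
  have s0 := sz_ge0 p q r l z.
  rewrite /taylor_rem (le_trans (ler_normB _ _))// mulrDl lerD//.
    rewrite (le_trans (ler_normB _ _))// mulrDl lerD ?H1//.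
    by rewrite (le_trans (Hb _ Kzb))// ler_peMr ?(ltW b0)// lerDl.
  rewrite (le_trans (Hb' _ _ Kzb))// -mulrA ler_wpM2l ?(ltW b'0)//.
  rewrite (le_trans (ler_normB _ _))// (le_trans (lerD (H2 z z0) (box_norm (lexx 0) Kzb)))//.
  rewrite mulrDr mulr1 -[leLHS]addrA [leLHS]addrC lerD//; first by rewrite -addrA lerDr.
  by rewrite ler_peMl// -addrA lerDl addr_ge0// ltW.
- move=> N; have [C C0 H] := taylor_rem_box oO O0 N CD.
  by exists C => z zb Kz _ Kzb MN; apply: H => //; exact: box_le MN Kzb.
by exists C => // z zb z0 Kzb; exact: H.
Qed.

Local Notation DA B i a z zb := (dPhi B i a (Fpart z.1) - dPhi B i a (Fpart zb.1)).
Local Notation fr z := (frob (Fpart z.1)).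

Lemma minors_near N (z zb : V) B i a : box 0 N z -> box 0 N zb ->
  `|DA B i a z zb| <= 4 * (1 + N) * `|z - zb|.
Proof.
move=> [h1 _] [h2 _]; apply: dPhi_lip => k c; rewrite !FpartE//.
by apply: le_trans (normr_coord (z - zb) (ixF k c)); rewrite /= !mxE.
Qed.

Lemma minors_far M (z zb : V) B i a : box 0 M zb ->
  `|DA B i a z zb| <= 4 * (1 + `|M|) ^+ 2 * (1 + fr z) ^+ 2.
Proof.
move=> [h _]; have f0 := frob_ge0 (Fpart z.1).
have b1 k c : `|Fpart zb.1 k c| <= `|M| by rewrite FpartE (le_trans (h _))// ler_norm.
have m0 : 0 <= `|M| by [].
have := @dPhi_lip R (Fpart z.1) (Fpart zb.1) (fr z + `|M|) (fr z + `|M|) _ _ _ B i a.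
have c1 k c : `|Fpart z.1 k c| <= fr z + `|M|.
  by rewrite (le_trans (frob_entry _ _ _))// lerDl.
have c2 k c : `|Fpart zb.1 k c| <= fr z + `|M| by rewrite (le_trans (b1 _ _))// lerDr.
have c3 k c : `|Fpart z.1 k c - Fpart zb.1 k c| <= fr z + `|M|.
  by rewrite (le_trans (ler_normB _ _))// lerD// frob_entry.
move=> /(_ c1 c2 c3) H; apply: le_trans H _.
move: (fr z) `|M| f0 m0 => f m f0 m0.
rewrite -[leLHS]mulrA -[leRHS]mulrA ler_wpM2l// -exprMn.
have e : 1 + (f + m) <= (1 + m) * (1 + f) by nra.
have e0 : 0 <= f + m by rewrite addr_ge0.
by rewrite expr2 ler_pM ?addr_ge0// (le_trans _ e)// lerDr.
Qed.

Lemma minorsz_far M (z zb : V) j b i a : box 0 M zb ->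
  `|DA (ixz j b) i a z zb| <= 4 * (1 + `|M|) * (1 + fr z).
Proof.
move=> [h _]; have f0 := frob_ge0 (Fpart z.1).
have b1 k c : `|Fpart zb.1 k c| <= `|M| by rewrite FpartE (le_trans (h _))// ler_norm.
have m0 : 0 <= `|M| by [].
have c1 k c : `|Fpart z.1 k c| <= fr z + `|M|.
  by rewrite (le_trans (frob_entry _ _ _))// lerDl.
have c3 k c : `|Fpart z.1 k c - Fpart zb.1 k c| <= fr z + `|M|.
  by rewrite (le_trans (ler_normB _ _))// lerD// frob_entry.
have H := dPhiz_lip c3 j b i a; apply: le_trans H _.
move: (fr z) `|M| f0 m0 => f m f0 m0; nra.
Qed.

Lemma frob_pow_le (z : V) : (1 + fr z) `^ p <= 2 `^ p * (1 + size_z z).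
Proof.
have p0 : 0 <= p by rewrite (le_trans _ hp).
rewrite (le_trans (powR_1D (frob_ge0 _) p0))// ler_wpM2l ?powR_ge0// lerD2l.
by rewrite /sz /size_pqrl -!addrA lerDl !addr_ge0 ?powR_ge0.
Qed.

Lemma frob_pown_le (z : V) (n : nat) : n%:R <= p -> (1 + fr z) ^+ n <= (1 + fr z) `^ p.
Proof.
move=> np; have f1 : 1 <= 1 + fr z by rewrite lerDl frob_ge0.
by rewrite -powR_mulrn ?(le_trans _ f1)// ler_powR.
Qed.

(** The derivative of the determinant is quadratic in F, so its square grows like |F|^4, which is at
    most linear in the size because [4 <= p]. *)
Lemma minors_control M B i a : exists2 C : R, 0 < C & forall z zb : V,
  0 <= z.2 -> box 0 M zb -> `|DA B i a z zb ^+ 2| <= C * J z zb.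
Proof.
have [||C C0 H] := @control 0 M (fun=> True) (fun z zb => DA B i a z zb ^+ 2) (lexx 0).
- exists ((4 * (1 + `|M|) ^+ 2) ^+ 2 * 2 `^ p) => z zb z0 _ Kzb.
  rewrite normrX (le_trans (y := (4 * (1 + `|M|) ^+ 2 * (1 + fr z) ^+ 2) ^+ 2))//.
    have h := minors_far z B i a Kzb.
    by apply: lerXn2r => //; rewrite nnegrE (le_trans _ h).
  rewrite exprMn -[leRHS]mulrA ler_wpM2l ?sqr_ge0// -exprM (le_trans _ (frob_pow_le z))//.
  exact: (@frob_pown_le z 4).
- move=> N; exists ((4 * (1 + N)) ^+ 2) => z zb Kz _ Kzb MN.
  have Kzb' := box_le MN Kzb; have h := minors_near B i a Kz Kzb'.
  by rewrite normrX -exprMn ler_pXn2r ?nnegrE// (le_trans _ h).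
by exists C => // z zb z0 Kzb; exact: H.
Qed.

Lemma young (a b s t : R) : 0 <= a -> 0 <= b -> 1 <= s -> 1 <= t ->
  s^-1 + t^-1 = 1 -> a * b <= a `^ s + b `^ t.
Proof.
move=> a0 b0 s1 t1 st; have s0 : 0 < s by rewrite (lt_le_trans _ s1).
have t0 : 0 < t by rewrite (lt_le_trans _ t1).
apply: le_trans (conjugate_powR a0 b0 s0 t0 st) _.
by rewrite lerD// ler_pdivrMr// ler_peMr ?powR_ge0.
Qed.

(** Young's inequality with the conjugate pairs (p / (p - 1), p) on the cofactor block, where the
    minors contribute one power of |F|, and (p / (p - 2), p / 2) on the determinant block, where
    they contribute two. *)
Lemma stress_far M B i a : exists C : R, forall z zb : V, 0 <= z.2 -> box 0 M zb ->
  `|('D_(ebase B) g z - 'D_(ebase B) g zb) * DA B i a z zb| <= C * (1 + size_z z).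
Proof.
have [C C0 H] := gradient_linear oO O0 Cg psiE hp hq hr hl hG2.
have [b b0 Hb] := Cdiff_box_bound O0 M (Cdiff_derive (ebase B) Cg1).
have p0 : 0 < p by rewrite (lt_le_trans _ hp).
have pm1 : 0 < p - 1 by rewrite subr_gt0 (lt_le_trans _ hp)// ltr1n.
have pm2 : 0 < p - 2 by rewrite subr_gt0 (lt_le_trans _ hp)// ltr_nat.
have s11 : 1 <= p / (p - 1) by rewrite ler_pdivlMr// mul1r lerBlDr lerDl.
have s21 : 1 <= p / (p - 2) by rewrite ler_pdivlMr// mul1r lerBlDr lerDl.
have p1 : 1 <= p by rewrite (le_trans _ hp)// ler1n.
have p2 : 1 <= p / 2 by rewrite ler_pdivlMr// mul1r (le_trans _ hp)// ler_nat.
have PB (z zb : V) : box 0 M zb -> `|'D_(ebase B) g z - 'D_(ebase B) g zb|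
     <= (1 + b) * (1 + `|'D_(ebase B) g z|).
  move=> Kzb; rewrite (le_trans (ler_normB _ _))// (le_trans (lerD (lexx _) (Hb _ Kzb)))//.
  by move: `|_| (normr_ge0 ('D_(ebase B) g z)) => x x0; nra.
(* Common to both blocks: [s] is the exponent of (G2), [t] its conjugate, and [X] the bound on the
   minors, normalised so that its power [t] is [(1 + |F|) ^ p]. *)
have key (s t : R) (X : R) : 1 <= s -> 1 <= t -> s^-1 + t^-1 = 1 ->
    forall z, 0 <= z.2 -> 0 <= X -> X `^ t = (1 + fr z) `^ p ->
    `|'D_(ebase B) g z| `^ s <= C * (1 + size_z z) ->
    (1 + `|'D_(ebase B) g z|) * X <= (2 `^ s * (1 + C) + 2 `^ p) * (1 + size_z z).
  move=> s1 t1 st z z0 X0 XE h.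
  have u1 : 1 <= 1 + size_z z by rewrite lerDl sz_ge0.
  apply: le_trans (young _ X0 s1 t1 st) _; first by rewrite addr_ge0.
  rewrite XE mulrDl lerD//; last exact: frob_pow_le.
  rewrite (le_trans (powR_1D _ _))// ?(le_trans ler01 s1)// -mulrA ler_wpM2l ?powR_ge0//.
  by rewrite mulrDl mul1r lerD.
case: (ixP B) PB key => [j c|j c|] PB key.
(* On the linear block the derivatives of the minors are constant and their difference vanishes. *)
- exists 0 => z zb _ _; rewrite !dPhiF subrr mulr0 normr0 mul0r //.
- exists ((1 + b) * (4 * (1 + `|M|)) * (2 `^ (p / (p - 1)) * (1 + C) + 2 `^ p)) => z zb z0 Kzb.
  rewrite normrM (le_trans (ler_pM _ _ (PB z zb Kzb) (minorsz_far z _ _ _ _ Kzb)))//.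
  rewrite mulrACA -[leRHS]mulrA; apply: ler_wpM2l.
    by rewrite mulr_ge0 ?addr_ge0 ?(ltW b0)// mulr_ge0 ?addr_ge0.
  have st : (p / (p - 1))^-1 + p^-1 = 1.
    by rewrite invf_div -[X in _ + X]mul1r -mulrDl subrK mulfV// gt_eqF.
  have X0 : 0 <= 1 + fr z by rewrite addr_ge0// frob_ge0.
  have [_ h _ _] := H z z0.
  exact: (key _ p _ s11 p1 st z z0 X0 erefl (h j c)).
- exists ((1 + b) * (4 * (1 + `|M|) ^+ 2) * (2 `^ (p / (p - 2)) * (1 + C) + 2 `^ p)) => z zb z0 Kzb.
  rewrite normrM (le_trans (ler_pM _ _ (PB z zb Kzb) (minors_far z _ _ _ Kzb)))//.
  rewrite mulrACA -[leRHS]mulrA; apply: ler_wpM2l.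
    by rewrite mulr_ge0 ?addr_ge0 ?(ltW b0)// mulr_ge0 ?sqr_ge0.
  have st : (p / (p - 2))^-1 + (p / 2)^-1 = 1.
    by rewrite !invf_div -mulrDl subrK mulfV// gt_eqF.
  have XE : ((1 + fr z) ^+ 2) `^ (p / 2) = (1 + fr z) `^ p.
    rewrite -powR_mulrn ?addr_ge0 ?frob_ge0// -powRrM; congr (_ `^ _).
    by rewrite mulrC divfK.
  have [_ _ h _] := H z z0.
  exact: (key _ (p / 2) _ s21 p2 st z z0 (sqr_ge0 _) XE h).
Qed.

Lemma stress_control M B i a : exists2 C : R, 0 < C & forall z zb : V,
  0 <= z.2 -> box 0 M zb ->
  `|('D_(ebase B) g z - 'D_(ebase B) g zb) * DA B i a z zb| <= C * J z zb.
Proof.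
have [||C C0 H] := @control 0 M (fun=> True)
    (fun z zb => ('D_(ebase B) g z - 'D_(ebase B) g zb) * DA B i a z zb) (lexx 0).
- by have [C H] := stress_far M B i a; exists C => z zb z0 _; exact: H.
- move=> N; have [C C0 H] := box_lipschitz oO O0 N (Cdiff_derive (ebase B) Cg2).
  exists (C * (4 * (1 + N))) => z zb Kz _ Kzb MN.
  have Kzb' := box_le MN Kzb; have h := minors_near B i a Kz Kzb'.
  rewrite normrM expr2 mulrACA ler_pM//; exact: H.
by exists C => // z zb z0 Kzb; exact: H.
Qed.

(** The square vanishes to second order where the two states meet. Far away it is at most a multiple
    of k + theta^2 / k, precisely the combination that is assumed to be bounded by the energy. *)
Lemma heat_control (kk : V -> R) (dl dlow M C' : R) :
  0 < dl -> 0 < dlow -> Cdiff 1 [set z : V | 0 < z.2] kk ->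
  (forall z : V, 0 < z.2 -> 0 < kk z) ->
  exists2 C : R, 0 < C & forall z zb : V, 0 <= z.2 ->
    dlow <= z.2 /\ kk z + z.2 ^+ 2 / kk z <= C' * en z -> box dl M zb ->
    `|(zb.2 * kk z - z.2 * kk zb) ^+ 2 / kk z| <= C * J z zb.
Proof.
move=> dl0 dlow0 Ck kpos.
(* The conductivity is smooth and positive only at positive temperatures, so both states are kept at
   temperature at least [lo]. *)
pose lo := Num.min dl dlow.
have lo0 : 0 < lo by rewrite lt_min dl0.
have oQ : open [set z : V | 0 < z.2].
  apply: (@open_comp _ _ (snd : V -> R) [set x : R | 0 < x]); last exact: open_gt.
  by move=> z _; exact: cvg_snd.
have loQ (z : V) : lo <= z.2 -> [set z : V | 0 < z.2] z by exact: lt_le_trans.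
have boxlo N (z : V) : dl <= z.2 \/ dlow <= z.2 -> box 0 N z -> box lo N z.
  move=> h [h1 /andP[_ h3]]; split=> //; rewrite h3 andbT ge_min.
  by case: h => ->; rewrite ?orbT.
have Kb N (zb : V) : box dl N zb -> box lo N zb.
  move=> [h1 /andP[h2 h3]]; apply: boxlo; first by left.
  by split=> //; rewrite h3 andbT (le_trans (ltW dl0)).
apply: (@control dl M (fun z => dlow <= z.2 /\ kk z + z.2 ^+ 2 / kk z <= C' * en z)
  (fun z zb => (zb.2 * kk z - z.2 * kk zb) ^+ 2 / kk z) (ltW dl0)).
- have [C1 C10 H1] := energy_linear O0 Cg psiE hG1.
  have [b b0 Hb] := Cdiff_box_bound loQ M Ck.
  exists ((2 * (`|M| ^+ 2 + b ^+ 2)) * (`|C'| * C1)) => z zb z0 [zl zk] Kzb.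
  have kz0 : 0 < kk z by apply: kpos; exact: lt_le_trans zl.
  have [_ /andP[zb1 zb2]] := Kzb.
  have zbM : `|zb.2| <= `|M|.
    by rewrite ger0_norm ?(le_trans (ltW dl0))// (le_trans zb2)// ler_norm.
  have kb : `|kk zb| <= b by exact: Hb (Kb _ _ Kzb).
  have [_ e1] := H1 z z0.
  have S0 : 0 <= z.2 ^+ 2 / kk z by rewrite divr_ge0 ?sqr_ge0// ltW.
  rewrite ger0_norm; last by rewrite divr_ge0 ?sqr_ge0// ltW.
  have step1 : (zb.2 * kk z - z.2 * kk zb) ^+ 2 / kk z <=
      2 * (zb.2 ^+ 2 * kk z + kk zb ^+ 2 * (z.2 ^+ 2 / kk z)).
    have -> : 2 * (zb.2 ^+ 2 * kk z + kk zb ^+ 2 * (z.2 ^+ 2 / kk z)) =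
       (2 * ((zb.2 * kk z) ^+ 2 + (z.2 * kk zb) ^+ 2)) / kk z.
      have kn : kk z != 0 by rewrite gt_eqF.
      by move: (kk z) (kk zb) (z.2) (zb.2) kn => k1 k2 t1 t2 kn; field.
    rewrite ler_pM2r ?invr_gt0//.
    move: (zb.2 * kk z) (z.2 * kk zb) => x y.
    rewrite -subr_ge0 (_ : _ - _ = (x + y) ^+ 2); first exact: sqr_ge0.
    by ring.
  have step2 : zb.2 ^+ 2 * kk z + kk zb ^+ 2 * (z.2 ^+ 2 / kk z) <=
      (`|M| ^+ 2 + b ^+ 2) * (kk z + z.2 ^+ 2 / kk z).
    have m1 : zb.2 ^+ 2 <= `|M| ^+ 2 by rewrite -(real_normK (num_real zb.2)) ler_pXn2r ?nnegrE.
    have m2 : kk zb ^+ 2 <= b ^+ 2.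
      by rewrite -(real_normK (num_real (kk zb))) ler_pXn2r ?nnegrE// ltW.
    have m3 : 0 <= `|M| ^+ 2 by rewrite sqr_ge0.
    have m4 : 0 <= b ^+ 2 by rewrite sqr_ge0.
    move: (zb.2 ^+ 2) (kk zb ^+ 2) (z.2 ^+ 2 / kk z) S0 (`|M| ^+ 2) (b ^+ 2) m1 m2 m3 m4 => x y s s0 m n m1 m2 m3 m4.
    move: (kk z) kz0 => k k0; nra.
  have step3 : kk z + z.2 ^+ 2 / kk z <= `|C'| * C1 * (1 + size_z z).
    apply: le_trans zk _; apply: le_trans (ler_norm _) _.
    by rewrite normrM -mulrA ler_wpM2l.
  have Mb0 : 0 <= `|M| ^+ 2 + b ^+ 2 by rewrite addr_ge0 ?sqr_ge0.
  apply: le_trans step1 (le_trans (ler_wpM2l _ (le_trans step2 (ler_wpM2l Mb0 step3))) _) => //.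
  by rewrite !mulrA.
- move=> N.
  have [C0 C00 HL] := box_lipschitz oQ loQ N Ck.
  have [b b0 Hb] := Cdiff_box_bound loQ N Ck.
  have [m m0 Hm] : exists2 m : R, 0 < m & forall z, box lo N z -> m <= kk z.
    have [K0|K0] := pselect (box (n := 19) lo N !=set0); last first.
      by exists 1 => // z Kz; exfalso; apply: K0; exists z.
    have ck : {within box (n := 19) lo N, continuous kk}.
      apply: within_continuous_at => z Kz; have [+ _] := Ck; apply.
      exact: (box_sub loQ Kz).
    have [c /set_mem Kc H] := compact_EVT_min K0 (@compact_box _ _ lo N) ck.
    exists (kk c); first by apply: kpos; exact: (box_sub loQ Kc).
    by move=> z Kz; apply: H; rewrite inE.
  exists ((`|N| * C0 + b) ^+ 2 / m) => z zb Kz [zl zk] Kzb MN.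
  have Kz' : box lo N z by apply: boxlo Kz; right.
  have Kzb' : box lo N zb by apply: box_le MN _; exact: Kb.
  have kz0 : 0 < kk z := lt_le_trans m0 (Hm _ Kz').
  have L1 := HL z zb Kz' Kzb'.
  have e1 : `|zb.2 * kk z - z.2 * kk zb| <= (`|N| * C0 + b) * `|z - zb|.
    have -> : zb.2 * kk z - z.2 * kk zb = zb.2 * (kk z - kk zb) - (z.2 - zb.2) * kk zb.
      by move: (kk z) (kk zb) (z.2) (zb.2) => k1 k2 t1 t2; ring.
    rewrite (le_trans (ler_normB _ _))// [leRHS]mulrDl lerD//.
      rewrite normrM -mulrA ler_pM//.
      by rewrite (le_trans (normr_time _))// (box_norm (ltW lo0) Kzb').
    rewrite normrM mulrC ler_pM//; first exact: Hb Kzb'.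
    exact: (normr_time (z - zb)).
  have q1 : (zb.2 * kk z - z.2 * kk zb) ^+ 2 <= (`|N| * C0 + b) ^+ 2 * `|z - zb| ^+ 2.
    rewrite -exprMn -(real_normK (num_real (_ - _))) ler_pXn2r ?nnegrE//.
    exact: le_trans e1.
  rewrite ger0_norm; last by rewrite divr_ge0 ?sqr_ge0// ltW.
  rewrite [leRHS]mulrAC; apply: ler_pM => //; first exact: sqr_ge0.
    by rewrite invr_ge0 ltW.
  by rewrite lef_pV2 ?posrE// Hm.
Qed.

End quadratic_bounds.

(** * Derivation rules in space-time *)

Section derive_rules.
Context {R : realType} {W : normedModType R}.
Implicit Types (f h : W -> R) (z d : W).

Lemma C1dir_derivable (S : set W) d f z : C1dir S d f -> S z -> derivable f z d.
Proof. by move=> [_ + _]; exact. Qed.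

Lemma C1dir_sub (S S' : set W) d f : S' `<=` S -> C1dir S d f -> C1dir S' d f.
Proof. by move=> SS [h1 h2 h3]; split=> z /SS; [exact: h1 | exact: h2 | exact: h3]. Qed.

Lemma DD f h z d : derivable f z d -> derivable h z d ->
  'D_d (fun y => f y + h y) z = 'D_d f z + 'D_d h z.
Proof. by move=> df dh; exact: (deriveD df dh). Qed.

Lemma DB f h z d : derivable f z d -> derivable h z d ->
  'D_d (fun y => f y - h y) z = 'D_d f z - 'D_d h z.
Proof. by move=> df dh; exact: (deriveB df dh). Qed.

Lemma DM f h z d : derivable f z d -> derivable h z d ->
  'D_d (fun y => f y * h y) z = 'D_d f z * h z + f z * 'D_d h z.
Proof.
move=> df dh; rewrite [LHS](deriveM df dh) /GRing.scale /= addrC; congr (_ + _).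
exact: mulrC.
Qed.

Lemma DS (n : nat) (F : 'I_n -> W -> R) z d : (forall i, derivable (F i) z d) ->
  'D_d (fun y => \sum_(i < n) F i y) z = \sum_(i < n) 'D_d (F i) z.
Proof.
move=> dF; rewrite -derive_sum//; congr ('D_d _ z).
by apply/funext => y; rewrite fct_sumE.
Qed.

Lemma derivable_sumf (n : nat) (F : 'I_n -> W -> R) z d : (forall i, derivable (F i) z d) ->
  derivable (fun y => \sum_(i < n) F i y) z d.
Proof.
move=> dF; rewrite (_ : (fun y => _) = \sum_(i < n) F i); first exact: derivable_sum.
by apply/funext => y; rewrite fct_sumE.
Qed.

Lemma derive_half_sq (n : nat) (F : 'I_n -> W -> R) z d : (forall i, derivable (F i) z d) ->
  'D_d (fun y => 2^-1 * (\sum_(i < n) F i y ^+ 2)) z = \sum_(i < n) F i z * 'D_d (F i) z.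
Proof.
move=> dF.
have sqE i : (fun y => F i y ^+ 2) = (fun y => F i y * F i y).
  by apply/funext => y; rewrite expr2.
have dq i : derivable (fun y => F i y ^+ 2) z d by rewrite sqE; exact: (derivableM (dF i) (dF i)).
rewrite [LHS](DM (derivable_cst _ _ _) (derivable_sumf dq)) derive_cst mul0r add0r (DS dq) mulr_sumr.
apply: eq_bigr => i _; rewrite sqE (DM (dF i) (dF i)).
by rewrite [X in _ + X]mulrC -mulr2n -[X in _ * X]mulr_natl mulKf ?pnatr_eq0// mulrC.
Qed.

Lemma D_eq_on (S : set W) f h z d : open S -> S z -> (forall y, S y -> f y = h y) ->
  'D_d f z = 'D_d h z.
Proof. by move=> oS Sz fh; apply: near_eq_derive; exact: open_near oS Sz fh. Qed.

End derive_rules.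

Section space_time.
Context {R : realType}.
Local Notation W := ('rV[R]_3 * R)%type.
Implicit Types (f : 'rV[R]_3 -> R -> R).

Lemma dxE a f x t : dx a f x t = 'D_(ebase a) (fun z : W => f z.1 z.2) (x, t).
Proof.
rewrite /dx /derive; set g1 := fun h => h^-1 *: _; set g2 := fun h => h^-1 *: _.
suff -> : g1 = g2 by [].
by apply/funext => h; rewrite /g1 /g2 /=; congr (_ *: (f _ _ - _)); rewrite scaler0 add0r.
Qed.

Lemma dtE f x t : dt f x t = 'D_etime (fun z : W => f z.1 z.2) (x, t).
Proof.
rewrite /dt derive1E /derive; set g1 := fun h => h^-1 *: _; set g2 := fun h => h^-1 *: _.
suff -> : g1 = g2 by [].
by apply/funext => h; rewrite /g1 /g2 /=; congr (_ *: (f _ _ - _)); rewrite scaler0 add0r.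
Qed.

End space_time.

(** * Balance laws in nonconservative form *)

Section balance.
Context {R : realType}.
Local Notation V := ('rV[R]_19 * R)%type.
Local Notation W := ('rV[R]_3 * R)%type.
Variables (O : set V) (g : V -> R).
Hypotheses (oO : open O) (O0 : forall z : V, 0 <= z.2 -> O z) (Cg : Cdiff 3 O g).
Variables (S : set W) (oS : open S).

(** A solution as functions on space-time, with the coefficients already evaluated along it. Both
    systems are instances of the same record, the inviscid one having [fmu] equal to 0. *)
Record fields := Fields {
  fX : W -> 'rV[R]_19; fv : 'I_3 -> W -> R; fth : W -> R; fmu : W -> R; fk : W -> R }.

Record regular (u : fields) : Prop := Regular {
  rX : forall B d, C1dir S d (fun z => fX u z 0 B);
  rv : forall i d, C1dir S d (fv u i);
  rth : forall d, C1dir S d (fth u);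
  rdv : forall i a b, C1dir S (ebase b) ('D_(ebase a) (fv u i));
  rdth : forall a b, C1dir S (ebase b) ('D_(ebase a) (fth u));
  rmu : forall d, C1dir S d (fmu u);
  rk : forall d, C1dir S d (fk u);
  rpos : forall z, S z -> 0 < fth u z }.

(** In these abbreviations [fE] is minus the entropy and [fQ] is the entropy flux; contracting [fP]
    with [fA] gives the stress. *)
Definition fP u B z := 'D_(ebase B) g (fX u z, fth u z).
Definition fE u z := 'D_etime g (fX u z, fth u z).
Definition fA u (B : 'I_19) (i a : 'I_3) z := dPhi B i a (Fpart (fX u z)).
Definition fQ u a z := fk u z * 'D_(ebase a) (fth u) z * (fth u z)^-1.

Record balanced (u : fields) (z : W) : Prop := Balanced {
  bX : forall B, 'D_etime (fun y => fX u y 0 B) z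
       - \sum_(a < 3) 'D_(ebase a) (fun y => \sum_(i < 3) fA u B i a y * fv u i y) z = 0;
  bv : forall i, 'D_etime (fv u i) z
       - \sum_(a < 3) 'D_(ebase a) (fun y => \sum_B fP u B y * fA u B i a y) z
       = \sum_(a < 3) 'D_(ebase a) (fun y => fmu u y * 'D_(ebase a) (fv u i) y) z;
  be : 'D_etime (fun y => 2^-1 * (\sum_(i < 3) fv u i y ^+ 2)
          + (g (fX u y, fth u y) - fth u y * fE u y)) z
       - \sum_(a < 3) 'D_(ebase a) (fun y => \sum_(i < 3)
            (\sum_B fP u B y * fA u B i a y) * fv u i y) z
       = \sum_(a < 3) 'D_(ebase a) (fun y => \sum_(i < 3)
            fmu u y * fv u i y * 'D_(ebase a) (fv u i) y) z
         + \sum_(a < 3) 'D_(ebase a) (fun y => fk u y * 'D_(ebase a) (fth u) y) z;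
  bc : forall i a b, 'D_(ebase a) (fun y => Fpart (fX u y) i b) z
       - 'D_(ebase b) (fun y => Fpart (fX u y) i a) z = 0 }.

Variable u : fields.
Hypothesis ru : regular u.

Lemma C1dir_comp m (f : V -> R) d : Cdiff m.+1 O f -> C1dir S d (fun z => f (fX u z, fth u z)).
Proof.
move=> Cf; apply: (C1dir_chain oS oO Cf).
- by move=> z Sz; apply: O0; rewrite ltW// (rpos ru Sz).
- by move=> j; exact: rX ru j d.
- exact: rth ru d.
Qed.

Lemma C1dir_P B d : C1dir S d (fP u B).
Proof. exact: (@C1dir_comp 1 _ d (Cdiff_derive (ebase B) Cg)). Qed.

Lemma C1dir_E d : C1dir S d (fE u).
Proof. exact: (@C1dir_comp 1 _ d (Cdiff_derive etime Cg)). Qed.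

Lemma C1dir_A B i a d : C1dir S d (fA u B i a).
Proof.
apply: C1dir_dPhi => // k c; rewrite (_ : (fun y => _) = (fun y => fX u y 0 (ixF k c))).
  exact: rX ru _ d.
by apply/funext => y; rewrite FpartE.
Qed.

Lemma C1dir_Q a b : C1dir S (ebase b) (fQ u a).
Proof.
apply: C1dirM => //; first by apply: C1dirM => //; [exact: rk ru _ | exact: rdth ru _ _].
by apply: C1dirV => //; [move=> z Sz; rewrite gt_eqF// (rpos ru Sz) | exact: rth ru _].
Qed.

Lemma derive_comp m (f : V -> R) d z : Cdiff m.+1 O f -> S z ->
  'D_d (fun z => f (fX u z, fth u z)) z
  = \sum_B 'D_d (fun y => fX u y 0 B) z * 'D_(ebase B) f (fX u z, fth u z)
    + 'D_d (fth u) z * 'D_etime f (fX u z, fth u z).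
Proof.
move=> Cf Sz; apply: derive_val; apply: is_derive_chain oO Cf _ _ _.
- by apply: O0; rewrite ltW// (rpos ru Sz).
- by move=> j; exact: C1dir_is_derive (rX ru j d) Sz.
- exact: C1dir_is_derive (rth ru d) Sz.
Qed.

Section at_point.
Variable z : W.
Hypotheses (Sz : S z) (bz : balanced u z).

Local Notation dA B i a := ('D_(ebase a) (fA u B i a) z).

(** The curl-free constraint makes the derivatives of F symmetric in the sense required by
    [piola]. *)
Lemma piola_field B i : \sum_(a < 3) dA B i a = 0.
Proof.
pose H (c : 'I_3) : 'M[R]_3 := \matrix_(k, e) 'D_(ebase c) (fun y => Fpart (fX u y) k e) z.
rewrite -[RHS](@piola R B i (Fpart (fX u z)) H).
  apply: eq_bigr => a _; apply: derive_val; apply: is_derive_dPhi => k e.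
  rewrite mxE; apply: derivableP.
  rewrite (_ : (fun y => _) = (fun y => fX u y 0 (ixF k e))).
    exact: C1dir_derivable (rX ru _ _) Sz.
  by apply/funext => y; rewrite FpartE.
by move=> c k e; rewrite !mxE; apply/eqP; rewrite -subr_eq0 (bc bz).
Qed.

Lemma balance_X B : 'D_etime (fun y => fX u y 0 B) z =
  \sum_(a < 3) \sum_(i < 3) fA u B i a z * 'D_(ebase a) (fv u i) z.
Proof.
have /eqP := bX bz B; rewrite subr_eq0 => /eqP ->.
transitivity (\sum_(a < 3) (\sum_(i < 3) dA B i a * fv u i z
    + \sum_(i < 3) fA u B i a z * 'D_(ebase a) (fv u i) z)).
  apply: eq_bigr => a _; rewrite DS; last first.
    move=> i; apply: C1dir_derivable Sz; apply: C1dirM => //; [exact: C1dir_A | exact: rv ru _ _].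
  rewrite -big_split; apply: eq_bigr => i _ /=; rewrite DM//.
    by apply: C1dir_derivable Sz; exact: C1dir_A.
  by apply: C1dir_derivable Sz; exact: rv ru _ _.
rewrite big_split /= exchange_big /= big1 ?add0r// => i _.
by rewrite -mulr_suml piola_field mul0r.
Qed.

Lemma stress_div i : \sum_(a < 3) 'D_(ebase a) (fun y => \sum_B fP u B y * fA u B i a y) z
  = \sum_(a < 3) \sum_B 'D_(ebase a) (fP u B) z * fA u B i a z.
Proof.
transitivity (\sum_(a < 3) (\sum_B 'D_(ebase a) (fP u B) z * fA u B i a z
    + \sum_B fP u B z * dA B i a)).
  apply: eq_bigr => a _; rewrite DS; last first.
    move=> B; apply: C1dir_derivable Sz; apply: C1dirM => //; [exact: C1dir_P | exact: C1dir_A].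
  rewrite -big_split; apply: eq_bigr => B _ /=; rewrite DM//.
    by apply: C1dir_derivable Sz; exact: C1dir_P.
  by apply: C1dir_derivable Sz; exact: C1dir_A.
rewrite big_split /= addrC exchange_big /= big1 ?add0r// => B _.
by rewrite -mulr_sumr piola_field mulr0.
Qed.

Lemma balance_v i : 'D_etime (fv u i) z =
  \sum_(a < 3) (\sum_B 'D_(ebase a) (fP u B) z * fA u B i a z
    + 'D_(ebase a) (fun y => fmu u y * 'D_(ebase a) (fv u i) y) z).
Proof. by rewrite big_split /= -(bv bz i) stress_div addrC subrK. Qed.

End at_point.
End balance.

(** * Gibbs relation and entropy production *)

Section entropy_balance.
Context {R : realType}.
Local Notation V := ('rV[R]_19 * R)%type.
Local Notation W := ('rV[R]_3 * R)%type.
Variables (O : set V) (g : V -> R).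
Hypotheses (oO : open O) (O0 : forall z : V, 0 <= z.2 -> O z) (Cg : Cdiff 3 O g).
Variables (S : set W) (oS : open S) (u : @fields R).
Hypothesis ru : regular S u.
Variable z : W.
Hypotheses (Sz : S z) (bz : balanced g u z).

Local Notation dv a i := ('D_(ebase a) (fv u i) z).
Local Notation dth a := ('D_(ebase a) (fth u) z).


Let dEC d := C1dir_derivable (C1dir_E oO O0 Cg oS ru d) Sz.

Let dvC i d := C1dir_derivable (rv ru i d) Sz.
Let dthC d := C1dir_derivable (rth ru d) Sz.

Let C1sigma i a d : C1dir S d (fun y => \sum_B fP g u B y * fA u B i a y).
Proof.
apply: C1dir_sum => // B _; apply: C1dirM => //; [exact: (C1dir_P oO O0 Cg oS ru) | exact: (C1dir_A oS ru)].
Qed.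

Let C1tau i a : C1dir S (ebase a) (fun y => fmu u y * 'D_(ebase a) (fv u i) y).
Proof. by apply: C1dirM => //; [exact: rmu ru _ | exact: rdv ru _ _ _]. Qed.

(** Gibbs relation: in the derivative of the energy the two terms containing the derivative of the
    temperature cancel. *)
Lemma derive_internal_energy d :
  'D_d (fun y => g (fX u y, fth u y) - fth u y * fE g u y) z
  = \sum_B 'D_d (fun y => fX u y 0 B) z * fP g u B z - fth u z * 'D_d (fE g u) z.
Proof.
have dg : derivable (fun y => g (fX u y, fth u y)) z d.
  exact: C1dir_derivable (C1dir_comp oO O0 oS ru d Cg) Sz.
rewrite (DB dg (derivableM (@dthC d) (@dEC d))) (DM (@dthC d) (@dEC d)).
rewrite (derive_comp oO O0 ru d Cg Sz) -/(fE g u z).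
rewrite -[\sum_B _]/(\sum_B 'D_d (fun y => fX u y 0 B) z * fP g u B z).
move: (\sum_B _) ('D_d _ z) (fE _ _ _) => x y e; ring.
Qed.

(** The momentum equation tested with the velocity is subtracted from the energy equation. The
    stress power cancels against the transport of [xi], and division by the temperature leaves the
    entropy equation. *)
Lemma entropy_balance : - 'D_etime (fE g u) z =
  \sum_(a < 3) 'D_(ebase a) (fQ u a) z
  + \sum_(a < 3) fk u z * dth a ^+ 2 * (fth u z)^-1 ^+ 2
  + \sum_(a < 3) \sum_(i < 3) fmu u z * dv a i ^+ 2 * (fth u z)^-1.
Proof.
have thp := rpos ru Sz.
pose ds a i := 'D_(ebase a) (fun y => \sum_B fP g u B y * fA u B i a y) z.
pose s a i := \sum_B fP g u B z * fA u B i a z.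
pose ta a i := 'D_(ebase a) (fun y => fmu u y * 'D_(ebase a) (fv u i) y) z.
pose hq a := 'D_(ebase a) (fun y => fk u y * 'D_(ebase a) (fth u) y) z.
have e1 : \sum_(a < 3) 'D_(ebase a) (fun y => \sum_(i < 3)
            (\sum_B fP g u B y * fA u B i a y) * fv u i y) z
    = \sum_(a < 3) \sum_(i < 3) ds a i * fv u i z + \sum_(a < 3) \sum_(i < 3) s a i * dv a i.
  rewrite -big_split; apply: eq_bigr => a _ /=; rewrite DS; last first.
    move=> i; apply: C1dir_derivable Sz; apply: C1dirM => //; exact: rv ru _ _.
  rewrite -big_split; apply: eq_bigr => i _ /=; rewrite DM//.
  exact: C1dir_derivable (C1sigma i a _) Sz.
have e2 : \sum_(a < 3) 'D_(ebase a) (fun y => \sum_(i < 3)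
            fmu u y * fv u i y * 'D_(ebase a) (fv u i) y) z
    = \sum_(a < 3) \sum_(i < 3) ta a i * fv u i z
    + \sum_(a < 3) \sum_(i < 3) fmu u z * dv a i ^+ 2.
  rewrite -big_split; apply: eq_bigr => a _ /=.
  have -> : (fun y => \sum_(i < 3) fmu u y * fv u i y * 'D_(ebase a) (fv u i) y)
    = (fun y => \sum_(i < 3) (fmu u y * 'D_(ebase a) (fv u i) y) * fv u i y).
    by apply/funext => y; apply: eq_bigr => i _; rewrite mulrAC.
  rewrite DS; last first.
    by move=> i; apply: C1dir_derivable Sz; apply: C1dirM => //; exact: rv ru _ _.
  rewrite -big_split; apply: eq_bigr => i _ /=; rewrite DM//; last first.
    exact: C1dir_derivable (C1tau i a) Sz.
  by rewrite -mulrA -expr2.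
have e3 : \sum_(i < 3) fv u i z * 'D_etime (fv u i) z
    = \sum_(a < 3) \sum_(i < 3) ds a i * fv u i z
    + \sum_(a < 3) \sum_(i < 3) ta a i * fv u i z.
  rewrite [X in X + _]exchange_big [X in _ + X]exchange_big -big_split /=.
  apply: eq_bigr => i _; rewrite -!mulr_suml -mulrDl mulrC; congr (_ * _).
  by have /eqP := bv bz i; rewrite subr_eq addrC => /eqP ->.
have e4 : \sum_B 'D_etime (fun y => fX u y 0 B) z * fP g u B z
    = \sum_(a < 3) \sum_(i < 3) s a i * dv a i.
  under eq_bigr do rewrite (balance_X oS ru Sz bz) mulr_suml.
  rewrite exchange_big; apply: eq_bigr => a _ /=.
  under eq_bigr do rewrite mulr_suml.
  rewrite exchange_big; apply: eq_bigr => i _ /=.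
  by rewrite /s mulr_suml; apply: eq_bigr => B _; rewrite -mulrA mulrC.
(* Dividing the heat flux by the temperature inside the divergence produces the term quadratic in
   the temperature gradient, that is, the entropy production by conduction. *)
have e5 a : 'D_(ebase a) (fQ u a) z =
    hq a * (fth u z)^-1 - fk u z * dth a ^+ 2 * (fth u z)^-1 ^+ 2.
  have th0 : fth u z != 0 by rewrite gt_eqF.
  have Ck : C1dir S (ebase a) (fun y => fk u y * 'D_(ebase a) (fth u) y).
    by apply: C1dirM => //; [exact: rk ru _ | exact: rdth ru _ _].
  rewrite /fQ DM; last first.
  - exact: derivableV.
  - exact: C1dir_derivable Ck Sz.
  have -> : 'D_(ebase a) (fun y => (fth u y)^-1) z = - (fth u z)^-1 ^+ 2 * dth a.
    rewrite [LHS](deriveV th0 (@dthC _)) /GRing.scale /= exprVn//.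
  rewrite -/(hq a); move: (hq a) (dth a) (fk u z) (_^-1) => x y k t; ring.
have := be bz; rewrite DD; last first.
- apply: derivableB; first exact: C1dir_derivable (C1dir_comp oO O0 oS ru _ Cg) Sz.
  by apply: derivableM; [exact: dthC | exact: dEC].
- apply: C1dir_derivable Sz; apply: C1dirM => //; first exact: C1dir_cst.
  by apply: C1dir_sum => // i _; apply: C1dirX => //; exact: rv ru _ _.
rewrite (derive_half_sq (@dvC ^~ etime)) derive_internal_energy e1 e2 e3 e4 => bal.
have -> : \sum_(a < 3) \sum_(i < 3) fmu u z * dv a i ^+ 2 * (fth u z)^-1
  = (\sum_(a < 3) \sum_(i < 3) fmu u z * dv a i ^+ 2) * (fth u z)^-1.
  by rewrite mulr_suml; apply: eq_bigr => a _; rewrite mulr_suml.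
rewrite (eq_bigr _ (fun a _ => e5 a)) sumrB -mulr_suml subrK -mulrDl.
have tV : fth u z * (fth u z)^-1 = 1 by rewrite mulfV// gt_eqF.
move: bal tV; move: ('D_etime (fE g u) z) (fth u z)^-1 (fth u z).
move: (\sum_(a < 3) hq a) (\sum_(a < 3) \sum_(i < 3) fmu u z * dv a i ^+ 2).
move: (\sum_(a < 3) \sum_(i < 3) ds a i * fv u i z) (\sum_(a < 3) \sum_(i < 3) s a i * dv a i).
move: (\sum_(a < 3) \sum_(i < 3) ta a i * fv u i z) => S3 S1 S2 H S4 E t h bal ht.
have {}bal : H + S4 = - (h * E).
  have -> : H + S4 = S3 + S4 + H - S3 by ring.
  by rewrite -bal; ring.
by rewrite bal mulNr mulrAC ht mul1r.
Qed.

End entropy_balance.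

(** * Time derivative of the relative free energy *)

Section relative_entropy_balance.
Context {R : realType}.
Local Notation V := ('rV[R]_19 * R)%type.
Local Notation W := ('rV[R]_3 * R)%type.
Variables (O : set V) (g : V -> R).
Hypotheses (oO : open O) (O0 : forall z : V, 0 <= z.2 -> O z) (Cg : Cdiff 3 O g).
Variables (S : set W) (oS : open S) (u ub : @fields R).
Hypotheses (ru : regular S u) (rub : regular S ub).

(** Symmetry of the bilinear form with space block [H], mixed part [G] and time entry [K], applied
    to the vectors [(h, s)] and [(x, t)]. *)
Lemma adjoint_sums n (h x G : 'I_n -> R) (H : 'I_n -> 'I_n -> R) (s t K : R) :
  \sum_B h B * (\sum_C x C * H C B + t * G B) + s * (\sum_C x C * G C + t * K)
  = \sum_B x B * (\sum_C h C * H B C + s * G B) + t * (\sum_C h C * G C + s * K).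
Proof.
under eq_bigr do rewrite mulrDr mulr_sumr.
under [in RHS]eq_bigr do rewrite mulrDr mulr_sumr.
rewrite !big_split /= exchange_big /= -!addrA !mulrDr; congr (_ + _).
  by apply: eq_bigr => C _; apply: eq_bigr => B _; exact: mulrCA.
rewrite addrCA !mulr_sumr; congr (_ + (_ + _)); last exact: mulrCA.
  by apply: eq_bigr => C _; exact: mulrCA.
by apply: eq_bigr => C _; exact: mulrCA.
Qed.

Definition fY (u : @fields R) z : V := (fX u z, fth u z).

Definition relent z := Jrel g (fY u z) (fY ub z)
  + 2^-1 * (\sum_(i < 3) (fv u i z - fv ub i z) ^+ 2).

Lemma derive_coord (f : V -> R) m (y h : V) : Cdiff m.+1 O f -> 0 <= y.2 ->
  'D_h f y = \sum_B h.1 0 B * 'D_(ebase B) f y + h.2 * 'D_etime f y.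
Proof. by move=> Cf y0; rewrite [LHS](Cdiff_deriveE h oO Cf (O0 y0)). Qed.

Lemma Jrel_fieldE z : S z -> Jrel g (fY u z) (fY ub z) =
  g (fX u z, fth u z) - g (fX ub z, fth ub z)
  - \sum_B (fX u z 0 B - fX ub z 0 B) * fP g ub B z - fE g u z * (fth u z - fth ub z).
Proof.
move=> Sz; rewrite /Jrel (derive_coord _ Cg) ?(ltW (rpos rub Sz))//=.
rewrite -/(fE g u z) -/(fE g ub z).
under eq_bigr do rewrite !mxE -/(fP g ub _ z).
rewrite /fY; move: (fth u z) (fth ub z) (\sum_B _) (g _) (g _) (fE _ _ _) (fE _ _ _) => *; ring.
Qed.

Let C1P B d := C1dir_P oO O0 Cg oS ru B d.
Let C1Pb B d := C1dir_P oO O0 Cg oS rub B d.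
Let C1E d := C1dir_E oO O0 Cg oS ru d.
Let C1A B i a d := C1dir_A oS ru B i a d.

Lemma C1dir_Jrel d : C1dir S d (fun y => Jrel g (fY u y) (fY ub y)).
Proof.
apply: (@C1dir_eq _ _ _ _ oS (fun y => g (fX u y, fth u y) - g (fX ub y, fth ub y)
  - \sum_B (fX u y 0 B - fX ub y 0 B) * fP g ub B y - fE g u y * (fth u y - fth ub y))).
  by move=> y Sy; rewrite Jrel_fieldE.
apply: (C1dirB oS); last exact: (C1dirM oS (@C1E d) (C1dirB oS (rth ru d) (rth rub d))).
apply: (C1dirB oS); first exact: (C1dirB oS (C1dir_comp oO O0 oS ru d Cg) (C1dir_comp oO O0 oS rub d Cg)).
apply: (C1dir_sum oS) => B _.
exact: (C1dirM oS (C1dirB oS (rX ru B d) (rX rub B d)) (@C1Pb B d)).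
Qed.

Lemma C1dir_relent d : C1dir S d relent.
Proof.
apply: (C1dirD oS); first exact: C1dir_Jrel.
apply: (C1dirM oS); first exact: C1dir_cst.
apply: (C1dir_sum oS) => i _; apply: (C1dirX oS).
exact: (C1dirB oS (rv ru i d) (rv rub i d)).
Qed.

(** The quadratic error left when the gradient of the free energy is linearised at the reference
    state, weighted by the time derivative of that state. *)
Definition frem z := \sum_B 'D_etime (fun y => fX ub y 0 B) z
    * taylor_rem ('D_(ebase B) g) (fY u z) (fY ub z)
  + 'D_etime (fth ub) z * taylor_rem ('D_etime g) (fY u z) (fY ub z).

Variable z : W.
Hypothesis Sz : S z.

(** Both sides are the Hessian of [g] at the reference state, applied to the difference of the
    states and to the time derivative of the reference state; its symmetry exchanges the two
    arguments. *)
Lemma derive_adjoint :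
  \sum_B (fX u z 0 B - fX ub z 0 B) * 'D_etime (fP g ub B) z
  + (fth u z - fth ub z) * 'D_etime (fE g ub) z
  = \sum_B 'D_etime (fun y => fX ub y 0 B) z * 'D_(fY u z - fY ub z) ('D_(ebase B) g) (fY ub z)
    + 'D_etime (fth ub) z * 'D_(fY u z - fY ub z) ('D_etime g) (fY ub z).
Proof.
have Yb0 : 0 <= (fY ub z).2 by rewrite ltW// (rpos rub Sz).
have Cd v : Cdiff 2 O ('D_v g) := Cdiff_derive v Cg.
have Cg2 : Cdiff 2 O g := Cdiff_le (isT : (2 <= 3)%N) Cg.
have sw v w : 'D_v ('D_w g) (fY ub z) = 'D_w ('D_v g) (fY ub z).
  exact: derive_swap oO Cg2 (O0 Yb0).
pose T B := 'D_etime ('D_(ebase B) g) (fY ub z).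
have e1 B : 'D_etime (fP g ub B) z
    = \sum_C 'D_etime (fun y => fX ub y 0 C) z * 'D_(ebase C) ('D_(ebase B) g) (fY ub z)
      + 'D_etime (fth ub) z * T B.
  exact: (derive_comp oO O0 rub etime (Cd (ebase B)) Sz).
have e2 : 'D_etime (fE g ub) z
    = \sum_C 'D_etime (fun y => fX ub y 0 C) z * T C
      + 'D_etime (fth ub) z * 'D_etime ('D_etime g) (fY ub z).
  have -> : \sum_C 'D_etime (fun y => fX ub y 0 C) z * T C
      = \sum_C 'D_etime (fun y => fX ub y 0 C) z * 'D_(ebase C) ('D_etime g) (fY ub z).
    by apply: eq_bigr => C _; rewrite /T (sw etime (ebase C)).
  exact: (derive_comp oO O0 rub etime (Cd etime) Sz).
have e3 B : 'D_(fY u z - fY ub z) ('D_(ebase B) g) (fY ub z)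
    = \sum_C (fX u z 0 C - fX ub z 0 C) * 'D_(ebase B) ('D_(ebase C) g) (fY ub z)
      + (fth u z - fth ub z) * T B.
  have -> : \sum_C (fX u z 0 C - fX ub z 0 C) * 'D_(ebase B) ('D_(ebase C) g) (fY ub z)
      = \sum_C (fY u z - fY ub z).1 0 C * 'D_(ebase C) ('D_(ebase B) g) (fY ub z).
    by apply: eq_bigr => C _; rewrite !mxE (sw (ebase B) (ebase C)).
  exact: (derive_coord _ (Cd (ebase B)) Yb0).
have e4 : 'D_(fY u z - fY ub z) ('D_etime g) (fY ub z)
    = \sum_C (fX u z 0 C - fX ub z 0 C) * T C
      + (fth u z - fth ub z) * 'D_etime ('D_etime g) (fY ub z).
  have -> : \sum_C (fX u z 0 C - fX ub z 0 C) * T C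
      = \sum_C (fY u z - fY ub z).1 0 C * 'D_(ebase C) ('D_etime g) (fY ub z).
    by apply: eq_bigr => C _; rewrite !mxE /T (sw etime (ebase C)).
  exact: (derive_coord _ (Cd etime) Yb0).
rewrite (eq_bigr _ (fun B _ => congr1 _ (e1 B))) e2.
rewrite [in RHS](eq_bigr _ (fun B _ => congr1 _ (e3 B))) e4.
exact: adjoint_sums.
Qed.

(** By [derive_adjoint], the terms in which the reference state is differentiated complete the
    difference of gradients to the Taylor remainders of [frem]; the other terms pair differences
    with differences. *)
Lemma derive_Jrel : 'D_etime (fun y => Jrel g (fY u y) (fY ub y)) z =
  \sum_B ('D_etime (fun y => fX u y 0 B) z - 'D_etime (fun y => fX ub y 0 B) z)
    * (fP g u B z - fP g ub B z)
  + frem z + (fth u z - fth ub z) * ('D_etime (fE g ub) z - 'D_etime (fE g u) z).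
Proof.
have dX B : derivable (fun y => fX u y 0 B) z etime := C1dir_derivable (rX ru B _) Sz.
have dXb B : derivable (fun y => fX ub y 0 B) z etime := C1dir_derivable (rX rub B _) Sz.
have dP B : derivable (fP g ub B) z etime := C1dir_derivable (C1Pb B _) Sz.
have dE : derivable (fE g u) z etime := C1dir_derivable (C1E _) Sz.
have dT : derivable (fth u) z etime := C1dir_derivable (rth ru _) Sz.
have dTb : derivable (fth ub) z etime := C1dir_derivable (rth rub _) Sz.
have dg : derivable (fun y => g (fX u y, fth u y)) z etime.
  exact: C1dir_derivable (C1dir_comp oO O0 oS ru _ Cg) Sz.
have dgb : derivable (fun y => g (fX ub y, fth ub y)) z etime.
  exact: C1dir_derivable (C1dir_comp oO O0 oS rub _ Cg) Sz.
have dXX B : derivable (fun y => fX u y 0 B - fX ub y 0 B) z etime.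
  exact: (derivableB (dX B) (dXb B)).
have dTT : derivable (fun y => fth u y - fth ub y) z etime by exact: (derivableB dT dTb).
have dm B : derivable (fun y => (fX u y 0 B - fX ub y 0 B) * fP g ub B y) z etime.
  exact: (derivableM (dXX B) (dP B)).
have dgg : derivable (fun y => g (fX u y, fth u y) - g (fX ub y, fth ub y)) z etime.
  exact: (derivableB dg dgb).
have ds : derivable (fun y => \sum_B (fX u y 0 B - fX ub y 0 B) * fP g ub B y) z etime by exact: derivable_sumf dm.
rewrite (D_eq_on etime oS Sz Jrel_fieldE).
rewrite [LHS](DB (derivableB dgg ds) (derivableM dE dTT)) (DB dgg ds) (DB dg dgb) (DM dE dTT)
  (DB dT dTb) (DS dm).
under [X in _ - X - _ = _]eq_bigr do rewrite (DM (dXX _) (dP _)) (DB (dX _) (dXb _)).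
rewrite big_split /=.
rewrite (derive_comp oO O0 ru etime Cg Sz) (derive_comp oO O0 rub etime Cg Sz).
rewrite -/(fE g u z) -/(fE g ub z).
have adj := derive_adjoint.
have -> : frem z = \sum_B 'D_etime (fun y => fX ub y 0 B) z * (fP g u B z - fP g ub B z)
    + 'D_etime (fth ub) z * (fE g u z - fE g ub z)
    - (\sum_B (fX u z 0 B - fX ub z 0 B) * 'D_etime (fP g ub B) z
  + (fth u z - fth ub z) * 'D_etime (fE g ub) z).
  rewrite adj /frem /taylor_rem -/(fE g u z) -/(fE g ub z).
  under eq_bigr do rewrite mulrBr.
  by rewrite sumrB mulrBr opprD addrACA.
have -> : \sum_B ('D_etime (fun y => fX u y 0 B) z - 'D_etime (fun y => fX ub y 0 B) z)
      * (fP g u B z - fP g ub B z)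
    = \sum_B 'D_etime (fun y => fX u y 0 B) z * 'D_(ebase B) g (fX u z, fth u z)
      - \sum_B 'D_etime (fun y => fX ub y 0 B) z * 'D_(ebase B) g (fX ub z, fth ub z)
      - \sum_B ('D_etime (fun y => fX u y 0 B) z - 'D_etime (fun y => fX ub y 0 B) z) * fP g ub B z
      - \sum_B 'D_etime (fun y => fX ub y 0 B) z * (fP g u B z - fP g ub B z).
  rewrite -!sumrB; apply: eq_bigr => B _; rewrite -/(fP g u B z) -/(fP g ub B z).
  by move: (fP _ u _ _) (fP _ ub _ _) ('D__ _ z) ('D__ _ z) => *; ring.
move: (fth u z) (fth ub z) (fE _ _ _) (fE _ _ _) ('D_etime _ z) ('D_etime _ z) ('D_etime _ z) ('D_etime _ z)
  (\sum_B _) (\sum_B _) (\sum_B _) (\sum_B _) (\sum_B _) => *; ring.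
Qed.

End relative_entropy_balance.

(** * The relative entropy identity *)

Section pointwise.
Context {R : realType}.

(* [A dv - Ab dvb] is split as [A (dv - dvb) + (A - Ab) dvb], and the stress divergence likewise. *)
Lemma stress_terms n (P Pb A Ab dA dP dPb : 'I_n -> R) (dv dvb w tau m th thb t : R) :
  th * t = 1 ->
  \sum_B (P B - Pb B) * (A B * dv - Ab B * dvb)
  + w * ((\sum_B dP B * A B + tau) - \sum_B dPb B * Ab B) + (th - thb) * (m * dv ^+ 2 * t)
  = ((\sum_B ((dP B - dPb B) * A B + (P B - Pb B) * dA B) + tau) * w
     + (\sum_B (P B - Pb B) * A B + m * dv) * (dv - dvb))
    + (\sum_B ((P B - Pb B) * (A B - Ab B) * dvb + w * dPb B * (A B - Ab B))
       + (m * dv * dvb - thb * (m * dv ^+ 2 * t)))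
    - \sum_B (P B - Pb B) * dA B * w.
Proof.
move=> ht; rewrite big_split /= [X in _ = X + _ - _]addrC.
have -> : (th - thb) * (m * dv ^+ 2 * t) = m * dv ^+ 2 * (th * t) - thb * (m * dv ^+ 2 * t) by ring.
rewrite ht -[in RHS]mulr_suml big_split /=.
have -> : \sum_B (P B - Pb B) * (A B * dv - Ab B * dvb)
    = (\sum_B (P B - Pb B) * A B) * (dv - dvb) + \sum_B (P B - Pb B) * (A B - Ab B) * dvb.
  by rewrite mulr_suml -big_split; apply: eq_bigr => B _ /=; ring.
have -> : \sum_B w * dPb B * (A B - Ab B)
    = w * (\sum_B dPb B * A B) - w * (\sum_B dPb B * Ab B).
  by rewrite !mulr_sumr -sumrB; apply: eq_bigr => B _ /=; ring.
have -> : \sum_B (dP B - dPb B) * A B = \sum_B dP B * A B - \sum_B dPb B * A B.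
  by rewrite -sumrB; apply: eq_bigr => B _ /=; ring.
ring.
Qed.

(** The first term on the right completes the temperature difference times the divergence of the
    entropy-flux difference to a full divergence; the rest is a quadratic form in the logarithmic
    gradients [x * t] and [xb * tb]. *)
Lemma heat_terms (k kb th thb t tb x xb : R) : th * t = 1 -> thb * tb = 1 ->
  (th - thb) * (k * x ^+ 2 * t ^+ 2 - kb * xb ^+ 2 * tb ^+ 2)
  = (x - xb) * (k * x * t - kb * xb * tb)
    + ((th * kb + thb * k) * (x * t) * (xb * tb)
       - thb * k * (x * t) ^+ 2 - th * kb * (xb * tb) ^+ 2).
Proof.
move=> ht htb.
have -> : (x - xb) * (k * x * t - kb * xb * tb)
  = (th * t * x - thb * tb * xb) * (k * x * t - kb * xb * tb) by rewrite ht htb !mul1r.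
ring.
Qed.

End pointwise.

Section relative_identity.
Context {R : realType}.
Local Notation V := ('rV[R]_19 * R)%type.
Local Notation W := ('rV[R]_3 * R)%type.
Variables (O : set V) (g : V -> R).
Hypotheses (oO : open O) (O0 : forall z : V, 0 <= z.2 -> O z) (Cg : Cdiff 3 O g).
Variables (S : set W) (oS : open S) (u ub : @fields R).
Hypotheses (ru : regular S u) (rub : regular S ub) (mub : fmu ub = fun=> 0).

(** The minors are taken along [u] throughout, so that the Piola identity for [u] removes the term
    in which they are differentiated. *)
Definition fflux a y :=
  \sum_(i < 3) (\sum_B (fP g u B y - fP g ub B y) * fA u B i a y
                + fmu u y * 'D_(ebase a) (fv u i) y) * (fv u i y - fv ub i y)
  + (fth u y - fth ub y) * (fQ u a y - fQ ub a y).

(** The three groups are: linearisation of the free energy, mechanical and viscous mismatch, and the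
    heat form in logarithmic temperature gradients. *)
Definition fres z := frem g u ub z
  + \sum_(a < 3) \sum_(i < 3)
      (\sum_B ((fP g u B z - fP g ub B z) * (fA u B i a z - fA ub B i a z)
                 * 'D_(ebase a) (fv ub i) z
               + (fv u i z - fv ub i z) * 'D_(ebase a) (fP g ub B) z
                 * (fA u B i a z - fA ub B i a z))
       + (fmu u z * 'D_(ebase a) (fv u i) z * 'D_(ebase a) (fv ub i) z
          - fth ub z * (fmu u z * 'D_(ebase a) (fv u i) z ^+ 2 * (fth u z)^-1)))
  + \sum_(a < 3)
      ((fth u z * fk ub z + fth ub z * fk u z) * ('D_(ebase a) (fth u) z * (fth u z)^-1)
          * ('D_(ebase a) (fth ub) z * (fth ub z)^-1)
       - fth ub z * fk u z * ('D_(ebase a) (fth u) z * (fth u z)^-1) ^+ 2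
       - fth u z * fk ub z * ('D_(ebase a) (fth ub) z * (fth ub z)^-1) ^+ 2).

Let C1P B d := C1dir_P oO O0 Cg oS ru B d.
Let C1Pb B d := C1dir_P oO O0 Cg oS rub B d.
Let C1A B i a d := C1dir_A oS ru B i a d.

Let C1mech a i : C1dir S (ebase a) (fun y => \sum_B (fP g u B y - fP g ub B y) * fA u B i a y
                + fmu u y * 'D_(ebase a) (fv u i) y).
Proof.
apply: (C1dirD oS); last exact: (C1dirM oS (rmu ru _) (rdv ru i a a)).
apply: (C1dir_sum oS) => B _; exact: (C1dirM oS (C1dirB oS (C1P _ _) (C1Pb _ _)) (C1A _ _ _ _)).
Qed.

Lemma C1dir_flux a : C1dir S (ebase a) (fflux a).
Proof.
apply: (C1dirD oS); last first.
  exact: (C1dirM oS (C1dirB oS (rth ru _) (rth rub _))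
                    (C1dirB oS (C1dir_Q oS ru a a) (C1dir_Q oS rub a a))).
apply: (C1dir_sum oS) => i _.
exact: (C1dirM oS (C1mech a i) (C1dirB oS (rv ru i _) (rv rub i _))).
Qed.

Variable z : W.
Hypotheses (Sz : S z) (bz : balanced g u z) (bbz : balanced g ub z).

Lemma derive_flux a : 'D_(ebase a) (fflux a) z =
  \sum_(i < 3)
    ((\sum_B (('D_(ebase a) (fP g u B) z - 'D_(ebase a) (fP g ub B) z) * fA u B i a z
              + (fP g u B z - fP g ub B z) * 'D_(ebase a) (fA u B i a) z)
      + 'D_(ebase a) (fun y => fmu u y * 'D_(ebase a) (fv u i) y) z) * (fv u i z - fv ub i z)
     + (\sum_B (fP g u B z - fP g ub B z) * fA u B i a z
        + fmu u z * 'D_(ebase a) (fv u i) z)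
       * ('D_(ebase a) (fv u i) z - 'D_(ebase a) (fv ub i) z))
  + (('D_(ebase a) (fth u) z - 'D_(ebase a) (fth ub) z) * (fQ u a z - fQ ub a z)
     + (fth u z - fth ub z) * ('D_(ebase a) (fQ u a) z - 'D_(ebase a) (fQ ub a) z)).
Proof.
have dP B : derivable (fP g u B) z (ebase a) := C1dir_derivable (C1P _ _) Sz.
have dPb B : derivable (fP g ub B) z (ebase a) := C1dir_derivable (C1Pb _ _) Sz.
have dA B i : derivable (fA u B i a) z (ebase a) := C1dir_derivable (C1A _ _ _ _) Sz.
have dv i : derivable (fv u i) z (ebase a) := C1dir_derivable (rv ru i _) Sz.
have dvb i : derivable (fv ub i) z (ebase a) := C1dir_derivable (rv rub i _) Sz.
have dT : derivable (fth u) z (ebase a) := C1dir_derivable (rth ru _) Sz.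
have dTb : derivable (fth ub) z (ebase a) := C1dir_derivable (rth rub _) Sz.
have dQ : derivable (fQ u a) z (ebase a) := C1dir_derivable (C1dir_Q oS ru a a) Sz.
have dQb : derivable (fQ ub a) z (ebase a) := C1dir_derivable (C1dir_Q oS rub a a) Sz.
have dt i : derivable (fun y => fmu u y * 'D_(ebase a) (fv u i) y) z (ebase a).
  exact: C1dir_derivable (C1dirM oS (rmu ru _) (rdv ru i a a)) Sz.
have dPP B : derivable (fun y => fP g u B y - fP g ub B y) z (ebase a).
  exact: (derivableB (dP B) (dPb B)).
have dPA i B : derivable (fun y => (fP g u B y - fP g ub B y) * fA u B i a y) z (ebase a).
  exact: (derivableM (dPP B) (dA B i)).
have dw i : derivable (fun y => fv u i y - fv ub i y) z (ebase a).
  exact: (derivableB (dv i) (dvb i)).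
have dm i : derivable (fun y => \sum_B (fP g u B y - fP g ub B y) * fA u B i a y
                + fmu u y * 'D_(ebase a) (fv u i) y) z (ebase a).
  exact: C1dir_derivable (C1mech a i) Sz.
have dmw i : derivable (fun y => (\sum_B (fP g u B y - fP g ub B y) * fA u B i a y
                + fmu u y * 'D_(ebase a) (fv u i) y) * (fv u i y - fv ub i y)) z (ebase a).
  exact: (derivableM (dm i) (dw i)).
have dTT : derivable (fun y => fth u y - fth ub y) z (ebase a) by exact: (derivableB dT dTb).
have dQQ : derivable (fun y => fQ u a y - fQ ub a y) z (ebase a) by exact: (derivableB dQ dQb).
rewrite [LHS](DD (derivable_sumf dmw) (derivableM dTT dQQ)) (DS dmw) (DM dTT dQQ)
  (DB dT dTb) (DB dQ dQb); congr (_ + _).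
apply: eq_bigr => i _; rewrite (DM (dm i) (dw i)) (DB (dv i) (dvb i)) (DD (derivable_sumf (dPA i)) (dt i))
  (DS (dPA i)); congr ((_ + _) * _ + _).
by apply: eq_bigr => B _; rewrite (DM (dPP B) (dA B i)) (DB (dP B) (dPb B)).
Qed.

(** The balance laws of both solutions are inserted into the time derivative, and each direction [a]
    is rearranged separately by [stress_terms] and [heat_terms]. No estimate is used. *)
Lemma relative_entropy_identity :
  'D_etime (relent g u ub) z = \sum_(a < 3) 'D_(ebase a) (fflux a) z + fres z.
Proof.
have dw i : derivable (fun y => fv u i y - fv ub i y) z etime.
  exact: (derivableB (C1dir_derivable (rv ru i _) Sz) (C1dir_derivable (rv rub i _) Sz)).
have dJ : derivable (fun y => Jrel g (fY u y) (fY ub y)) z etime.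
  exact: C1dir_derivable (C1dir_Jrel oO O0 Cg oS ru rub etime) Sz.
have dk : derivable (fun y => 2^-1 * (\sum_(i < 3) (fv u i y - fv ub i y) ^+ 2)) z etime.
  apply: C1dir_derivable Sz; apply: (C1dirM oS); first exact: C1dir_cst.
  apply: (C1dir_sum oS) => i _; apply: (C1dirX oS).
  exact: (C1dirB oS (rv ru i _) (rv rub i _)).
rewrite [LHS](DD dJ dk) (derive_half_sq dw) (derive_Jrel oO O0 Cg oS ru rub Sz).
have eX B : 'D_etime (fun y => fX u y 0 B) z - 'D_etime (fun y => fX ub y 0 B) z
    = \sum_(a < 3) \sum_(i < 3) (fA u B i a z * 'D_(ebase a) (fv u i) z
                                - fA ub B i a z * 'D_(ebase a) (fv ub i) z).
  rewrite (balance_X oS ru Sz bz) (balance_X oS rub Sz bbz) -sumrB.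
  by apply: eq_bigr => a _; rewrite -sumrB.
have ev i : 'D_etime (fun y => fv u i y - fv ub i y) z
    = \sum_(a < 3) (\sum_B 'D_(ebase a) (fP g u B) z * fA u B i a z
        + 'D_(ebase a) (fun y => fmu u y * 'D_(ebase a) (fv u i) y) z
        - \sum_B 'D_(ebase a) (fP g ub B) z * fA ub B i a z).
  rewrite (DB (C1dir_derivable (rv ru i _) Sz) (C1dir_derivable (rv rub i _) Sz)).
  rewrite (balance_v oO O0 Cg oS ru Sz bz) (balance_v oO O0 Cg oS rub Sz bbz) -sumrB.
  apply: eq_bigr => a _; congr (_ - _); rewrite mub.
  rewrite (_ : (fun y => _) = cst 0) ?derive_cst ?addr0//.
  by apply/funext => y; rewrite mul0r.
have e1 : \sum_B ('D_etime (fun y => fX u y 0 B) z - 'D_etime (fun y => fX ub y 0 B) z)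
      * (fP g u B z - fP g ub B z)
    = \sum_(a < 3) \sum_(i < 3) \sum_B (fP g u B z - fP g ub B z)
       * (fA u B i a z * 'D_(ebase a) (fv u i) z - fA ub B i a z * 'D_(ebase a) (fv ub i) z).
  under eq_bigr do rewrite eX mulr_suml.
  rewrite exchange_big; apply: eq_bigr => a _ /=.
  under eq_bigr do rewrite mulr_suml.
  rewrite exchange_big; apply: eq_bigr => i _ /=.
  by apply: eq_bigr => B _; exact: mulrC.
have e2 : \sum_(i < 3) (fv u i z - fv ub i z) * 'D_etime (fun y => fv u i y - fv ub i y) z
    = \sum_(a < 3) \sum_(i < 3) (fv u i z - fv ub i z)
       * (\sum_B 'D_(ebase a) (fP g u B) z * fA u B i a z
        + 'D_(ebase a) (fun y => fmu u y * 'D_(ebase a) (fv u i) y) z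
        - \sum_B 'D_(ebase a) (fP g ub B) z * fA ub B i a z).
  under eq_bigr do rewrite ev mulr_sumr.
  exact: exchange_big.
have Eu := entropy_balance oO O0 Cg oS ru Sz bz.
have Eb := entropy_balance oO O0 Cg oS rub Sz bbz.
have {}Eb : - 'D_etime (fE g ub) z = \sum_(a < 3) 'D_(ebase a) (fQ ub a) z
    + \sum_(a < 3) fk ub z * 'D_(ebase a) (fth ub) z ^+ 2 * (fth ub z)^-1 ^+ 2.
  rewrite Eb mub [X in _ + X]big1 ?addr0// => a _.
  by rewrite big1// => i _; rewrite !mul0r.
have e3 : (fth u z - fth ub z) * ('D_etime (fE g ub) z - 'D_etime (fE g u) z)
   = \sum_(a < 3) \sum_(i < 3)
       (fth u z - fth ub z) * (fmu u z * 'D_(ebase a) (fv u i) z ^+ 2 * (fth u z)^-1)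
   + \sum_(a < 3) ((fth u z - fth ub z) * ('D_(ebase a) (fQ u a) z - 'D_(ebase a) (fQ ub a) z)
      + (fth u z - fth ub z) * (fk u z * 'D_(ebase a) (fth u) z ^+ 2 * (fth u z)^-1 ^+ 2
        - fk ub z * 'D_(ebase a) (fth ub) z ^+ 2 * (fth ub z)^-1 ^+ 2)).
  rewrite -['D_etime (fE g ub) z]opprK Eb Eu.
  have -> : \sum_(a < 3) \sum_(i < 3)
       (fth u z - fth ub z) * (fmu u z * 'D_(ebase a) (fv u i) z ^+ 2 * (fth u z)^-1)
    = (fth u z - fth ub z) * \sum_(a < 3) \sum_(i < 3)
        fmu u z * 'D_(ebase a) (fv u i) z ^+ 2 * (fth u z)^-1.
    by rewrite mulr_sumr; apply: eq_bigr => a _; rewrite mulr_sumr.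
  rewrite big_split /= -!mulr_sumr !sumrB.
  move: (fth u z - _) (\sum_(a < 3) 'D_(ebase a) (fQ u a) z) (\sum_(a < 3) 'D_(ebase a) (fQ ub a) z)
    (\sum_(a < 3) \sum_(i < 3) _) (\sum_(a < 3) _) (\sum_(a < 3) _) => *; ring.
rewrite e1 e2 e3.
have tV : fth u z * (fth u z)^-1 = 1 by rewrite mulfV// gt_eqF// (rpos ru Sz).
have tbV : fth ub z * (fth ub z)^-1 = 1 by rewrite mulfV// gt_eqF// (rpos rub Sz).
(* Differentiating the minors inside the flux produces this sum; it vanishes only after summation
   over [a], so it is subtracted before the identity is compared term by term. *)
have e4 : \sum_(a < 3) \sum_(i < 3) \sum_B
    (fP g u B z - fP g ub B z) * 'D_(ebase a) (fA u B i a) z * (fv u i z - fv ub i z) = 0.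
  rewrite exchange_big big1// => i _ /=; rewrite exchange_big big1// => B _ /=.
  by rewrite -mulr_suml -mulr_sumr (piola_field ru Sz bz) mulr0 mul0r.
transitivity (frem g u ub z
  + \sum_(a < 3) (\sum_(i < 3)
     (\sum_B (fP g u B z - fP g ub B z)
       * (fA u B i a z * 'D_(ebase a) (fv u i) z - fA ub B i a z * 'D_(ebase a) (fv ub i) z)
      + (fv u i z - fv ub i z)
       * (\sum_B 'D_(ebase a) (fP g u B) z * fA u B i a z
        + 'D_(ebase a) (fun y => fmu u y * 'D_(ebase a) (fv u i) y) z
        - \sum_B 'D_(ebase a) (fP g ub B) z * fA ub B i a z)
      + (fth u z - fth ub z) * (fmu u z * 'D_(ebase a) (fv u i) z ^+ 2 * (fth u z)^-1))
    + ((fth u z - fth ub z) * ('D_(ebase a) (fQ u a) z - 'D_(ebase a) (fQ ub a) z)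
      + (fth u z - fth ub z) * (fk u z * 'D_(ebase a) (fth u) z ^+ 2 * (fth u z)^-1 ^+ 2
        - fk ub z * 'D_(ebase a) (fth ub) z ^+ 2 * (fth ub z)^-1 ^+ 2)))).
  rewrite [in RHS]big_split /=.
  under [X in _ = _ + (X + _)]eq_bigr do rewrite big_split /= big_split /=.
  rewrite [X in _ = _ + (X + _)]big_split /= [X in _ = _ + (X + _ + _)]big_split /=.
  move: (\sum_(a < 3) _) (\sum_(a < 3) _) (\sum_(a < 3) _) (\sum_(a < 3) _) (frem _ _ _ _) => *.
  ring.
have o1 (b c d e f : R) : b + (c + d + e) - f = c + (b + d + e - f) by ring.
have o2 (b x y r h f : R) : b + (x + y) + r + h - f = b + r - f + (y + (x + h)) by ring.
rewrite /fres -[RHS]subr0 -[X in _ = _ - X]e4 [RHS]o1; congr (_ + _).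
rewrite -!big_split -sumrB; apply: eq_bigr => a _ /=.
rewrite derive_flux [RHS]o2 (heat_terms _ _ _ _ tV tbV); congr (_ + _).
rewrite -big_split -sumrB; apply: eq_bigr => i _ /=.
exact: (stress_terms (fP g u ^~ z) (fP g ub ^~ z) (fA u ^~ i ^~ a ^~ z)
  (fA ub ^~ i ^~ a ^~ z) (fun B => 'D_(ebase a) (fA u B i a) z)
  (fun B => 'D_(ebase a) (fP g u B) z) (fun B => 'D_(ebase a) (fP g ub B) z) _ _ _ _ _ _ tV).
Qed.

End relative_identity.

(** * Estimate of the residual *)

Section residual.
Context {R : realType}.
Local Notation V := ('rV[R]_19 * R)%type.
Local Notation W := ('rV[R]_3 * R)%type.

Lemma sum_le_const n (F : 'I_n -> R) c : (forall i, F i <= c) -> \sum_(i < n) F i <= n%:R * c.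
Proof.
move=> Fc; apply: (@le_trans _ _ (\sum_(i < n) c)); first exact: ler_sum.
by rewrite sumr_const card_ord mulr_natl.
Qed.

Lemma uniform_control (I : finType) (T : Type) (H : T -> Prop) (Q : I -> T -> R) (J : T -> R) :
  (forall z, H z -> 0 <= J z) ->
  (forall i, exists2 C : R, 0 < C & forall z, H z -> `|Q i z| <= C * J z) ->
  exists2 C : R, 0 < C & forall i z, H z -> `|Q i z| <= C * J z.
Proof.
move=> J0 /(_ _)/cid2-/all_sig2[c c0 Hc]; exists (1 + \sum_i c i).
  by rewrite ltr_wpDr// sumr_ge0// => i _; exact: ltW.
move=> i z Hz; rewrite (le_trans (Hc i z Hz))// ler_wpM2r ?J0//.
rewrite (bigD1 i)//= addrCA lerDl addr_ge0// sumr_ge0// => j _; exact: ltW.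
Qed.

(** Completing the square in [x]: the viscous dissipation absorbs the cross term. The best constant
    on the right would be 1/4; the summand with the factor 3 is the slack. *)
Lemma viscous_young (m th thb x y : R) : 0 <= m -> 0 < th -> 0 < thb ->
  m * x * y - thb * (m * x ^+ 2 * th^-1) <= m * th * (y ^+ 2 * thb^-1).
Proof.
move=> m0 th0 tb0.
have -> : m * x * y - thb * (m * x ^+ 2 * th^-1)
  = m * th * (y ^+ 2 * thb^-1) - m * (thb * th^-1) *
     ((x - 2^-1 * y * th * thb^-1) ^+ 2 + 3%:R * (2^-1 * y * th * thb^-1) ^+ 2).
  by field; rewrite !gt_eqF.
rewrite gerBl; apply: mulr_ge0; last first.
  by apply: addr_ge0; [exact: sqr_ge0 | apply: mulr_ge0 => //; exact: sqr_ge0].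
by apply: mulr_ge0 => //; apply: mulr_ge0; rewrite ?invr_ge0 ltW.
Qed.

(* With [x = y + c] the left side is [(th * kb - thb * k) * c * y - thb * k * c ^+ 2]. *)
Lemma heat_young (k kb th thb x y : R) : 0 < k -> 0 < thb ->
  (th * kb + thb * k) * x * y - thb * k * x ^+ 2 - th * kb * y ^+ 2
  <= y ^+ 2 * thb^-1 * ((thb * k - th * kb) ^+ 2 / k).
Proof.
move=> k0 tb0.
have -> : (th * kb + thb * k) * x * y - thb * k * x ^+ 2 - th * kb * y ^+ 2
  = y ^+ 2 * thb^-1 * ((thb * k - th * kb) ^+ 2 / k)
    - thb * k * ((x - y - 2^-1 * y * (th * kb - thb * k) * (thb^-1 * k^-1)) ^+ 2
       + 3%:R * (2^-1 * y * (th * kb - thb * k) * (thb^-1 * k^-1)) ^+ 2).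
  by field; rewrite !gt_eqF.
rewrite gerBl; apply: mulr_ge0; last first.
  by apply: addr_ge0; [exact: sqr_ge0 | apply: mulr_ge0 => //; exact: sqr_ge0].
by apply: mulr_ge0; rewrite ltW.
Qed.

Variables (psi : 'rV[R]_19 -> R -> R) (O : set V) (g : V -> R).
Hypotheses (oO : open O) (O0 : forall z : V, 0 <= z.2 -> O z)
  (Cg : Cdiff 3 O g) (psiE : forall z : V, 0 <= z.2 -> psi z.1 z.2 = g z).
Variables (p q r l : R).
Hypotheses (hp : 4 <= p) (hq : 1 < q) (hr : 1 < r) (hl : 1 < l)
  (hG1 : growth1 p q r l psi) (hG2 : growth2 p q r l psi) (hG3 : growth3 p q r l psi).
Hypotheses (hconv : hess_xi_posdef psi) (heta : eta_th_pos psi).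

Local Notation J := (Jrel g).
Local Notation en := (fun z : V => g z - z.2 * 'D_etime g z).

(** The constant is chosen before the fields and depends on the reference solution only through its
    bounds [dl], [M] and [D]. The viscosity enters only in the last term, which is the integrand of
    [viscous_error]. *)
Lemma residual_le (kk : V -> R) (dl dlow M C' D : R) :
  0 < dl -> 0 < dlow -> 0 < D -> Cdiff 1 [set z : V | 0 < z.2] kk ->
  (forall z : V, 0 < z.2 -> 0 < kk z) ->
  exists2 K : R, 0 < K & forall (u ub : @fields R) (z : W),
    0 < fth u z -> dlow <= fth u z -> 0 <= fmu u z ->
    fk u z = kk (fY u z) -> fk ub z = kk (fY ub z) ->
    kk (fY u z) + fth u z ^+ 2 / kk (fY u z) <= C' * en (fY u z) ->
    box dl M (fY ub z) ->
    (forall B, `|'D_etime (fun y => fX ub y 0 B) z| <= D) ->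
    `|'D_etime (fth ub) z| <= D ->
    (forall i a, `|'D_(ebase a) (fv ub i) z| <= D) ->
    (forall B a, `|'D_(ebase a) (fP g ub B) z| <= D) ->
    (forall a, `|'D_(ebase a) (fth ub) z * (fth ub z)^-1| <= D) ->
    fres g u ub z <= K * relent g u ub z
      + fmu u z * fth u z * (\sum_(i < 3) \sum_(a < 3) 'D_(ebase a) (fv ub i) z ^+ 2 / fth ub z).
Proof.
move=> dl0 dlow0 D0 Ck kpos.
have bx zb : box dl M zb -> box (n := 19) 0 M zb.
  by move=> [h1 /andP[h2 h3]]; split=> //; rewrite h3 andbT (le_trans (ltW dl0)).
pose H (w : V * V) := [/\ 0 <= w.1.2, dlow <= w.1.2 /\ kk w.1 + w.1.2 ^+ 2 / kk w.1 <= C' * en w.1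
  & box dl M w.2].
have J0 w : H w -> 0 <= J w.1 w.2.
  move=> [w0 _ /bx wb]; exact: (Jrel_ge0 oO O0 Cg psiE hp hq hr hl hconv heta w0 wb).
have [C1 C10 H1] : exists2 C : R, 0 < C & forall (i : option 'I_19) w, H w ->
    `|taylor_rem ('D_(ebas i) g) w.1 w.2| <= C * J w.1 w.2.
  apply: uniform_control => // i.
  have [C C0 HC] := taylor_rem_control oO O0 Cg psiE hp hq hr hl hG1 hG2 hG3 hconv heta M i.
  by exists C => // w [w0 _ /bx wb]; exact: HC.
have [C2 C20 H2] : exists2 C : R, 0 < C & forall (j : 'I_19 * 'I_3 * 'I_3) w, H w ->
    `|('D_(ebase j.1.1) g w.1 - 'D_(ebase j.1.1) g w.2)
      * (dPhi j.1.1 j.1.2 j.2 (Fpart w.1.1) - dPhi j.1.1 j.1.2 j.2 (Fpart w.2.1))| <= C * J w.1 w.2.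
  apply: uniform_control => // j.
  have [C C0 HC] := stress_control oO O0 Cg psiE hp hq hr hl hG1 hG2 hG3 hconv heta M j.1.1 j.1.2 j.2.
  by exists C => // w [w0 _ /bx wb]; exact: HC.
have [C3 C30 H3] : exists2 C : R, 0 < C & forall (j : 'I_19 * 'I_3 * 'I_3) w, H w ->
    `|(dPhi j.1.1 j.1.2 j.2 (Fpart w.1.1) - dPhi j.1.1 j.1.2 j.2 (Fpart w.2.1)) ^+ 2| <= C * J w.1 w.2.
  apply: uniform_control => // j.
  have [C C0 HC] := minors_control oO O0 Cg psiE hp hq hr hl hG1 hG3 hconv heta M j.1.1 j.1.2 j.2.
  by exists C => // w [w0 _ /bx wb]; exact: HC.
have [C4 C40 H4] := heat_control oO O0 Cg psiE hp hq hr hl hG1 hG3 hconv heta M C' dl0 dlow0 Ck kpos.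
(* In order: remainders for the 19 coordinates and the temperature; the sum over [a], [i] and [B] of
   stress times minors and of velocity times minors, the latter by |x y| <= x^2 + y^2 with squares
   at most 2 and [C3] times the relative entropy; the heat terms. *)
pose K := 19%:R * (D * C1) + D * C1 + 3%:R * (3%:R * (19%:R * (D * C2 + D * (2 + C3))))
  + 3%:R * (D ^+ 2 * dl^-1 * C4).
exists K.
  have h1 : 0 < D * C1 by exact: mulr_gt0.
  have h2 : 0 < D * C2 by exact: mulr_gt0.
  have h3 : 0 < D * (2 + C3) by apply: mulr_gt0 => //; exact: addr_gt0.
  have h4 : 0 < D ^+ 2 * dl^-1 * C4.
    by apply: mulr_gt0 => //; apply: mulr_gt0; rewrite ?exprn_gt0 ?invr_gt0.
  rewrite /K; move: (D * C1) (D * C2) (D * (2 + C3)) (_ * C4) h1 h2 h3 h4 => x y s t *; lra.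
move=> u ub z th0 thl m0 kE kbE hk Yb HX Hth Hv HP Hq.
pose w := (fY u z, fY ub z).
have Hw : H w by split=> //=; rewrite ltW.
have Jw := J0 _ Hw.
have tb0 : 0 < fth ub z by case: Yb => _ /andP[h _]; exact: lt_le_trans h.
set I := relent g u ub z.
have W0 i : (fv u i z - fv ub i z) ^+ 2 <= \sum_(j < 3) (fv u j z - fv ub j z) ^+ 2.
  by rewrite (bigD1 i)//= lerDl sumr_ge0// => j _; exact: sqr_ge0.
have Wp : 0 <= \sum_(j < 3) (fv u j z - fv ub j z) ^+ 2.
  by rewrite sumr_ge0// => j _; exact: sqr_ge0.
have JI : J w.1 w.2 <= I by rewrite /I /relent lerDl mulr_ge0// invr_ge0.
have WI i : (fv u i z - fv ub i z) ^+ 2 <= 2 * I.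
  rewrite (le_trans (W0 i))// /I /relent mulrDr mulVKf// lerDr mulr_ge0//.
have I0 : 0 <= I := le_trans Jw JI.
have CI C : 0 < C -> C * J w.1 w.2 <= C * I by move=> C0; rewrite ler_wpM2l// ltW.
have prod_le (x y c : R) : `|x| <= D -> `|y| <= c -> x * y <= D * c.
  move=> hx hy; apply: le_trans (ler_norm _) _; rewrite normrM; exact: ler_pM.
have b1 : frem g u ub z <= (19%:R * (D * C1) + D * C1) * I.
  rewrite /frem mulrDl; apply: lerD; last first.
    by rewrite -mulrA; apply: prod_le => //; apply: le_trans (H1 None w Hw) (CI _ C10).
  rewrite -mulrA; apply: sum_le_const => B; rewrite -mulrA; apply: prod_le => //.
  exact: le_trans (H1 (Some B) w Hw) (CI _ C10).
have b2 a i : \sum_B ((fP g u B z - fP g ub B z) * (fA u B i a z - fA ub B i a z)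
                 * 'D_(ebase a) (fv ub i) z
               + (fv u i z - fv ub i z) * 'D_(ebase a) (fP g ub B) z
                 * (fA u B i a z - fA ub B i a z))
    <= 19%:R * ((D * C2 + D * (2 + C3)) * I).
  apply: sum_le_const => B; rewrite [leRHS]mulrDl; apply: lerD.
    rewrite [leLHS]mulrC -[leRHS]mulrA; apply: prod_le => //; exact: le_trans (H2 (B, i, a) w Hw) (CI _ C20).
  rewrite [X in X * _]mulrC -[leLHS]mulrA -[leRHS]mulrA; apply: prod_le => //.
  have := le_trans (H3 (B, i, a) w Hw) (CI _ C30); rewrite /= (ger0_norm (sqr_ge0 _)).
  have := WI i; rewrite /fA; move: (fv u i z - _) (dPhi _ _ _ _ - _) => x y hx hy.
  rewrite ler_norml; apply/andP; split; nra.
have b3 : \sum_(a < 3) \sum_(i < 3)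
     (fmu u z * 'D_(ebase a) (fv u i) z * 'D_(ebase a) (fv ub i) z
      - fth ub z * (fmu u z * 'D_(ebase a) (fv u i) z ^+ 2 * (fth u z)^-1))
    <= fmu u z * fth u z * (\sum_(i < 3) \sum_(a < 3) 'D_(ebase a) (fv ub i) z ^+ 2 / fth ub z).
  rewrite exchange_big mulr_sumr; apply: ler_sum => i _; rewrite mulr_sumr; apply: ler_sum => a _.
  exact: viscous_young.
have b4 a : (fth u z * fk ub z + fth ub z * fk u z) * ('D_(ebase a) (fth u) z * (fth u z)^-1)
          * ('D_(ebase a) (fth ub) z * (fth ub z)^-1)
       - fth ub z * fk u z * ('D_(ebase a) (fth u) z * (fth u z)^-1) ^+ 2
       - fth u z * fk ub z * ('D_(ebase a) (fth ub) z * (fth ub z)^-1) ^+ 2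
    <= D ^+ 2 * dl^-1 * C4 * I.
  have k0 : 0 < fk u z by rewrite kE; exact: kpos.
  apply: le_trans (heat_young _ _ _ _ k0 tb0) _.
  have q0 : 0 <= (fth ub z * fk u z - fth u z * fk ub z) ^+ 2 / fk u z.
    by apply: mulr_ge0; [exact: sqr_ge0 | rewrite invr_ge0 ltW].
  rewrite -[leRHS]mulrA; apply: ler_pM => //.
  - by apply: mulr_ge0; [exact: sqr_ge0 | rewrite invr_ge0 ltW].
  - apply: ler_pM => //; [exact: sqr_ge0 | by rewrite invr_ge0 ltW | |].
      by rewrite -(ler_sqrt _ (exprn_ge0 _ (ltW D0))) !sqrtr_sqr (ger0_norm (ltW D0)).
    by rewrite lef_pV2 ?posrE//; case: Yb => _ /andP[].
  - have [_ [_ hk'] Yb'] := Hw.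
    have := le_trans (H4 w.1 w.2 (ltW th0) (conj thl hk') Yb') (CI _ C40).
    by rewrite kE kbE; exact: le_trans (ler_norm _).
rewrite /fres.
under [X in _ + X + _]eq_bigr do rewrite big_split /=.
have o3 (a b c d : R) : a + (b + c) + d = a + b + (c + d) by ring.
rewrite big_split /= [leLHS]o3.
have b5 : \sum_(a < 3) \sum_(i < 3) \sum_B
    ((fP g u B z - fP g ub B z) * (fA u B i a z - fA ub B i a z) * 'D_(ebase a) (fv ub i) z
     + (fv u i z - fv ub i z) * 'D_(ebase a) (fP g ub B) z * (fA u B i a z - fA ub B i a z))
    <= 3%:R * (3%:R * (19%:R * ((D * C2 + D * (2 + C3)) * I))).
  by apply: sum_le_const => a; apply: sum_le_const => i; exact: b2.
have b6 := sum_le_const b4.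
apply: (le_trans (lerD (lerD b1 b5) (lerD b3 b6))).
rewrite /K; move: (fmu u z * _ * _) => v.
move: (D * C1) (D * C2) (D * (2 + C3)) (_ * C4) => c1 c2 c3 c4.
by rewrite -subr_ge0 le_eqVlt eq_sym; apply/orP; left; apply/eqP; ring.
Qed.

End residual.

(** * Continuity up to the ends of the time interval *)

Section clamped_time.
Context {R : realType}.
Local Notation W := ('rV[R]_3 * R)%type.

Lemma within_comp_continuous (X Y Z : topologicalType) (K : set Y) (c : X -> Y) (h : Y -> Z) :
  continuous c -> (forall x, K (c x)) -> {within K, continuous h} -> continuous (h \o c).
Proof.
move=> cc Kc /subspace_continuousP ch x A hA.
have H := cc x _ (ch _ (Kc x) A hA); rewrite /nbhs /=.
exact: (filterS (fun y Hy => Hy (Kc y)) H).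
Qed.

Lemma within_eq_continuous (X Y : topologicalType) (K : set X) (f h : X -> Y) :
  (forall x, K x -> f x = h x) -> {within K, continuous f} -> {within K, continuous h}.
Proof.
move=> fh; have e : {in K, f =1 h} by move=> x /set_mem; exact: fh.
exact: (subspace_eq_continuous e).
Qed.

Variable T : R.
Hypothesis T0 : 0 < T.

(** The projection of the line onto [0, T]. Composing with it turns a function continuous within the
    closed slab into a globally continuous one, to which the integration lemmas apply. *)
Definition clamp (t : R) := 2^-1 * (`|t| - `|t - T| + T).

Lemma clamp_id t : 0 <= t <= T -> clamp t = t.
Proof.
by move=> /andP[t0 tT]; rewrite /clamp ger0_norm// ler0_norm ?subr_le0//; lra.
Qed.

Lemma clamp_in t : 0 <= clamp t <= T.
Proof.
suff /andP[h1 h2] : 0 <= `|t| - `|t - T| + T <= 2 * T.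
  by rewrite /clamp mulr_ge0//= mulrC ler_pdivrMr// mulrC.
have [t0|t0] := lerP 0 t; have [tT|tT] := lerP T t.
- rewrite !ger0_norm ?subr_ge0// (_ : t - (t - T) + T = 2 * T) ?lexx ?andbT; last by ring.
  by rewrite mulr_ge0// ltW.
- by rewrite ger0_norm//; apply/andP; split; nra.
- by have := lt_le_trans t0 (le_trans (ltW T0) tT); rewrite ltxx.
- rewrite ltr0_norm// (_ : - t - (T - t) + T = 0) ?lexx/=; last by ring.
  by rewrite mulr_ge0// ltW.
Qed.

Lemma clamp_continuous : continuous clamp.
Proof.
move=> t; have ci : (s : R) @[s --> t] --> t by exact: cvg_id.
have c1 : `|s - T| @[s --> t] --> `|t - T| by exact: cvg_norm (cvgB ci (cvg_cst T)).
have c2 : `|s| @[s --> t] --> `|t| by exact: cvg_norm ci.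
exact: cvgM (cvg_cst _) (cvgD (cvgB c2 c1) (cvg_cst T)).
Qed.

Lemma clamped_continuous (h : W -> R) : {within slab `[0, T], continuous h} ->
  continuous (fun z : W => h (z.1, clamp z.2)).
Proof.
apply: (@within_comp_continuous _ _ _ _ (fun z : W => (z.1, clamp z.2))).
- move=> z; have h1 : w.1 @[w --> z] --> z.1 by exact: cvg_fst.
  have h0 : w.2 @[w --> z] --> z.2 by exact: cvg_snd.
  have h2 : clamp w.2 @[w --> z] --> clamp z.2 by exact: (cvg_comp _ _ h0 (@clamp_continuous z.2)).
  exact: (cvg_pair h1 h2).
- by move=> z; rewrite /slab/= in_itv/=; exact: clamp_in.
Qed.

Lemma Tint_continuous (h : W -> R) : continuous h -> continuous (fun t => Tint (fun x => h (x, t))).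
Proof.
move=> ch t.
have [M M0 HM] : exists2 M : R, 0 < M & forall z, (cube `*` `[t - 1, t + 1]) z ->
    `|h (point3 z.1, z.2)| <= M.
  apply: compact_bound; first by apply: compact_setX; [exact: compact_cube | exact: segment_compact].
  apply: within_continuous_at => z _.
  have h0 : w.1 @[w --> z] --> z.1 by exact: cvg_fst.
  have h1 : point3 w.1 @[w --> z] --> point3 z.1 by exact: (cvg_comp _ _ h0 (@point3_continuous _ z.1)).
  have h2 : w.2 @[w --> z] --> z.2 by exact: cvg_snd.
  have h3 : (point3 w.1, w.2) @[w --> z] --> (point3 z.1, z.2) by exact: (cvg_pair h1 h2).
  exact: (cvg_comp (fun w => (point3 w.1, w.2)) h h3 (ch (point3 z.1, z.2))).
apply: (@Tint_continuous_param _ (fun t x => h (x, t)) (t - 1) (t + 1) M).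
- by move=> s _ x; exact: (cvg_comp (fun y => (y, s)) h (@continuous_pairl _ _ s x) (ch (x, s))).
- by move=> x s _; exact: (cvg_comp (fun r => (x, r)) h (@continuous_pairr _ _ x s) (ch (x, s))).
- move=> s z; rewrite in_itv/= => /andP[s1 s2] Cz; apply: (HM (z, s)); split=> //=.
  by rewrite in_itv/= !ltW.
- by rewrite in_itv/= ltrBlDr ltrDl ltr01.
Qed.

Lemma slice_continuous (h : W -> R) t : 0 <= t <= T ->
  continuous (fun z : W => h (z.1, clamp z.2)) -> continuous (fun x => h (x, t)).
Proof.
move=> tT ch; rewrite -(clamp_id tT) => x.
exact: (cvg_comp (fun y => (y, t)) (fun z : W => h (z.1, clamp z.2))
  (@continuous_pairl _ _ t x) (ch (x, t))).
Qed.

End clamped_time.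

(** * Integration over the torus and Gronwall's argument *)

Section integrated.
Context {R : realType}.
Local Notation V := ('rV[R]_19 * R)%type.
Local Notation W := ('rV[R]_3 * R)%type.

Lemma open_slab (a b : R) : open (slab `]a, b[ : set W).
Proof.
apply: (@open_comp _ _ (snd : W -> R) `]a, b[%classic); last exact: itv_open.
by move=> z _; exact: cvg_snd.
Qed.

Lemma continuous_slice (h : W -> R) t : (forall x, {for (x, t), continuous h}) ->
  continuous (fun x => h (x, t)).
Proof.
move=> ch x; exact: (cvg_comp (fun y => (y, t)) h (@continuous_pairl _ _ t x) (ch x)).
Qed.

Lemma Tint_derive_time (h : W -> R) (T t : R) : 0 < t < T -> C1dir (slab `]0, T[) etime h ->
  is_derive t 1 (fun s : R => Tint (fun x => h (x, s))) (Tint (fun x => 'D_etime h (x, t))).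
Proof.
move=> /andP[t0 tT] [ch dh cdh].
(* The derivative is continuous only in the open slab, so a compact subinterval around [t] supplies
   the dominating constant. *)
pose a := t / 2; pose b := (t + T) / 2.
have a0 : 0 < a by rewrite divr_gt0.
have at' : a < t by rewrite /a ltr_pdivrMr// mulr_natr mulr2n ltrDl.
have tb : t < b by rewrite /b ltr_pdivlMr// mulr_natr mulr2n ltrD2l.
have bT : b < T by rewrite /b ltr_pdivrMr// mulr_natr mulr2n ltrD2r.
have inS (x : 'rV[R]_3) s : a <= s <= b -> slab `]0, T[ (x, s).
  by move=> /andP[s1 s2]; rewrite /slab /= in_itv /= (lt_le_trans a0 s1) (le_lt_trans s2 bT).
have inS' (x : 'rV[R]_3) s : s \in `]a, b[ -> slab `]0, T[ (x, s).
  by rewrite in_itv /= => /andP[s1 s2]; apply: inS; rewrite !ltW.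
have dE s x : (fun r => h (x, r))^`()%classic s = 'D_etime h (x, s).
  by rewrite -[LHS]/(dt (fun y r => h (y, r)) x s) dtE; congr ('D_etime _ _); apply/funext => -[].
have [M M0 HM] : exists2 M : R, 0 < M & forall z, (cube `*` `[a, b]) z ->
    `|'D_etime h (point3 z.1, z.2)| <= M.
  apply: compact_bound; first by apply: compact_setX; [exact: compact_cube | exact: segment_compact].
  apply: within_continuous_at => z [_ zab].
  have h0 : w.1 @[w --> z] --> z.1 by exact: cvg_fst.
  have h1 : point3 w.1 @[w --> z] --> point3 z.1 by exact: (cvg_comp _ _ h0 (@point3_continuous _ z.1)).
  have h2 : w.2 @[w --> z] --> z.2 by exact: cvg_snd.
  have h3 : (point3 w.1, w.2) @[w --> z] --> (point3 z.1, z.2) by exact: (cvg_pair h1 h2).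
  exact: (cvg_comp (fun w => (point3 w.1, w.2)) ('D_etime h) h3 (cdh _ (inS _ _ zab))).
have tab : t \in `]a, b[ by rewrite in_itv/= at'.
have := @Tint_derive_param _ (fun s x => h (x, s)) a b M t tab.
rewrite (_ : (fun x => _^`()%classic t) = (fun x => 'D_etime h (x, t))); last first.
  by apply/funext => x; exact: dE.
apply.
- by move=> s sab; exact: (@continuous_slice h s (fun x => ch _ (inS' x _ sab))).
- move=> s x sab; have := dh _ (inS' x _ sab).
  rewrite /derivable; set F := fun _ => _; set G := fun _ => _.
  suff -> : F = G by [].
  have e r : shift (x, s) (r *: etime) = (x, shift s (r *: 1)) :> W.
    by rewrite /shift /etime; congr (_, _); rewrite /= scaler0 add0r.
  by apply/funext => r; rewrite /F /G /comp e.
- move=> s z sab Cz; rewrite dE; apply: (HM (z, s)); split=> //=.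
  by move: sab; rewrite !in_itv/= => /andP[s1 s2]; rewrite !ltW.
Qed.

Definition periodic_at t (h : W -> R) := forall x (a : 'I_3), h (x + delta_mx 0 a, t) = h (x, t).

Lemma periodic_derive t h b : periodic_at t h -> periodic_at t ('D_(ebase b) h).
Proof.
move=> ph x a; rewrite /derive; set F := fun _ => _; set G := fun _ => _.
suff -> : F = G by [].
have e r y : shift (y, t) (r *: ebase b) = (r *: delta_mx 0 b + y, t) :> W.
  by rewrite /shift /ebase; congr (_, _); rewrite /= scaler0 add0r.
by apply/funext => r; rewrite /F /G /comp !e addrA !ph.
Qed.

Record periodic_fields (u : @fields R) t : Prop := PeriodicFields {
  pX : forall x (a : 'I_3), fX u (x + delta_mx 0 a, t) = fX u (x, t);
  pv : forall i, periodic_at t (fv u i);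
  pth : periodic_at t (fth u);
  pmu : periodic_at t (fmu u);
  pk : periodic_at t (fk u) }.

Lemma periodic_flux g u ub t b : periodic_fields u t -> periodic_fields ub t ->
  periodic_at t (fflux g u ub b).
Proof.
move=> pu pub x a; rewrite /fflux /fP /fA /fQ !(pX pu, pX pub, pth pu, pth pub, pk pu, pk pub, pmu pu).
rewrite !(periodic_derive b (pth pu) x a, periodic_derive b (pth pub) x a); congr (_ + _).
by apply: eq_bigr => i _; rewrite (pv pu) (pv pub) (periodic_derive b (pv pu i) x a).
Qed.

Variables (O : set V) (g : V -> R).
Hypotheses (oO : open O) (O0 : forall z : V, 0 <= z.2 -> O z) (Cg : Cdiff 3 O g).
Variables (T : R) (u ub : @fields R).
Local Notation S := (slab `]0, T[ : set W).
Hypotheses (T0 : 0 < T) (ru : regular S u) (rub : regular S ub) (mub : fmu ub = fun=> 0).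
Hypotheses (pu : forall t, 0 < t < T -> periodic_fields u t)
           (pub : forall t, 0 < t < T -> periodic_fields ub t).
Hypotheses (bu : forall z, S z -> balanced g u z) (bub : forall z, S z -> balanced g ub z).
Hypothesis crel : continuous (fun z : W => relent g u ub (z.1, clamp T z.2)).

Local Notation phi := (fun t : R => Tint (fun x => relent g u ub (x, t))).

Lemma derive_total t : 0 < t < T ->
  (forall x, {for (x, t), continuous (fres g u ub)}) /\
  Tint (fun x => 'D_etime (relent g u ub) (x, t)) = Tint (fun x => fres g u ub (x, t)).
Proof.
move=> tT; have oS := @open_slab 0 T.
have Sx (x : 'rV[R]_3) : S (x, t) by rewrite /slab /= in_itv.
have cD z : S z -> {for z, continuous ('D_etime (relent g u ub))}.
  by move=> Sz; have [_ _] := C1dir_relent oO O0 Cg oS ru rub etime; apply.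
have cF a z : S z -> {for z, continuous ('D_(ebase a) (fflux g u ub a))}.
  by move=> Sz; have [_ _] := C1dir_flux oO O0 Cg oS ru rub a; apply.
have id z : S z -> 'D_etime (relent g u ub) z
    = \sum_(a < 3) 'D_(ebase a) (fflux g u ub a) z + fres g u ub z.
  by move=> Sz; exact: (relative_entropy_identity oO O0 Cg oS ru rub mub Sz (bu Sz) (bub Sz)).
have cS z : S z -> {for z, continuous (fun z => \sum_(a < 3) 'D_(ebase a) (fflux g u ub a) z)}.
  by move=> Sz; apply: cvg_sumr => a _; exact: cF.
(* Continuity of the residual is read off from the identity, as the difference of two continuous
   functions, rather than from its long expression. *)
have cres z : S z -> {for z, continuous (fres g u ub)}.
  move=> Sz; have h : {for z, continuous (fun z => 'D_etime (relent g u ub) z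
      - \sum_(a < 3) 'D_(ebase a) (fflux g u ub a) z)}.
    exact: cvgB (cD z Sz) (cS z Sz).
  have e : forall y, S y -> 'D_etime (relent g u ub) y
      - \sum_(a < 3) 'D_(ebase a) (fflux g u ub a) y = fres g u ub y.
    by move=> y Sy; rewrite id// addrAC subrr add0r.
  have h' : 'D_etime (relent g u ub) y - \sum_(a < 3) 'D_(ebase a) (fflux g u ub a) y
      @[y --> z] --> fres g u ub z by rewrite -(e z Sz); exact: h.
  apply: cvg_trans h'; apply: near_eq_cvg; apply: (open_near oS Sz) => y Sy; exact: e.
split; first by move=> x; exact: cres.
rewrite (_ : (fun x => _) = (fun x => \sum_(a < 3) 'D_(ebase a) (fflux g u ub a) (x, t)
    + fres g u ub (x, t))); last by apply/funext => x; exact: id.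
have csl a : continuous (fun x => 'D_(ebase a) (fflux g u ub a) (x, t)).
  exact: (@continuous_slice ('D_(ebase a) (fflux g u ub a)) t (fun x => cF a _ (Sx x))).
rewrite TintD; last 2 first.
- exact: (@continuous_slice (fun z => \sum_(a < 3) 'D_(ebase a) (fflux g u ub a) z) t (fun x => cS _ (Sx x))).
- exact: (@continuous_slice (fres g u ub) t (fun x => cres _ (Sx x))).
rewrite Tint_sum// big1 ?add0r// => a _.
have sE x : 'D_(ebase a) (fflux g u ub a) (x, t)
    = 'D_(delta_mx 0 a) (fun y => fflux g u ub a (y, t)) x.
  rewrite -[RHS]/(dx a (fun y s => fflux g u ub a (y, s)) x t) dxE.
  by congr ('D__ _ _); apply/funext => -[].
have -> : (fun x => 'D_(ebase a) (fflux g u ub a) (x, t))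
  = 'D_(delta_mx 0 a) (fun y => fflux g u ub a (y, t)) by apply/funext => x; exact: sE.
apply: Tint_derive_eq0.
- move=> x; have [_ dF _] := C1dir_flux oO O0 Cg oS ru rub a; have := dF _ (Sx x).
  rewrite /derivable; set F := fun _ => _; set G := fun _ => _.
  suff -> : F = G by [].
  have e r : shift (x, t) (r *: ebase a) = (shift x (r *: delta_mx 0 a), t) :> W.
    by rewrite /shift /ebase; congr (_, _); rewrite /= scaler0 add0r.
  by apply/funext => r; rewrite /F /G /comp e.
- rewrite (_ : 'D__ _ = (fun x => 'D_(ebase a) (fflux g u ub a) (x, t)))//.
  by apply/funext => x; rewrite sE.
- by move=> x; exact: (periodic_flux _ _ (pu tT) (pub tT)).
Qed.

Lemma integrated_gronwall (K : R) (e : W -> R) : 0 <= K ->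
  continuous (fun z : W => e (z.1, clamp T z.2)) -> (forall z, slab `[0, T] z -> 0 <= e z) ->
  0 <= phi 0 ->
  (forall y t, cube y -> 0 < t < T ->
     fres g u ub (point3 y, t) <= K * relent g u ub (point3 y, t) + e (point3 y, t)) ->
  forall t, 0 <= t <= T -> ((phi t)%:E <= (expR (K * T))%:E *
    ((phi 0)%:E + \int[lebesgue_measure]_(s in `[0%R, T]) (Tint (fun x => e (x, s)))%:E))%E.
Proof.
move=> K0 ce e0 phi0 He t tT.
(* The source term is replaced by its clamped version, which is continuous on the whole line as
   [gronwall] requires and has the same integral over [0, T]. *)
have -> : (\int[lebesgue_measure]_(s in `[0%R, T]) (Tint (fun x => e (x, s)))%:E
  = \int[lebesgue_measure]_(s in `[0%R, T]) (Tint (fun x => e (x, clamp T s)))%:E)%E.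
  by apply: eq_integral => s; rewrite inE /= in_itv /= => sT; rewrite clamp_id.
apply: (@gronwall _ phi (fun s => Tint (fun x => e (x, clamp T s))) T K T0 K0 _ phi0 _ _ _ t tT).
- have c0 := Tint_continuous crel.
  apply: (@within_eq_continuous _ _ _ (fun s : R => Tint (fun x => relent g u ub (x, clamp T s)))).
    by move=> s /=; rewrite in_itv /= => sT; rewrite clamp_id.
  exact: continuous_subspaceT.
- move=> s sT; have sT' : 0 <= s <= T by case/andP: sT => /ltW-> /ltW->.
  have D := Tint_derive_time sT (C1dir_relent oO O0 Cg (@open_slab 0 T) ru rub etime).
  split; first exact: (@ex_derive _ _ _ _ _ _ _ D).
  rewrite derive1E (@derive_val _ _ _ _ _ _ _ D).
  have [cres ->] := derive_total sT.
  rewrite clamp_id//.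
  have cr := slice_continuous sT' crel; have ces := slice_continuous sT' ce.
  have cK : continuous (fun x => K * relent g u ub (x, s)).
    by move=> x; exact: (cvgM (cvg_cst K) (cr x)).
  rewrite -TintZ// -TintD//; apply: le_Tint.
  + exact: (@continuous_slice (fres g u ub) s cres).
  + by move=> x; exact: (cvgD (cK x) (ces x)).
  + by move=> y Cy; exact: He.
- exact: Tint_continuous ce.
- move=> s; apply: Tint_ge0 => z _; apply: e0; rewrite /slab /= in_itv /=; exact: clamp_in.
Qed.

End integrated.

(** * From the stated systems to fields on space-time *)

Section translation.
Context {R : realType}.
Local Notation V := ('rV[R]_19 * R)%type.
Local Notation W := ('rV[R]_3 * R)%type.

Lemma Cdiff_sub (X : normedModType R) m (O O' : set X) (f : X -> R) :
  O' `<=` O -> Cdiff m O f -> Cdiff m O' f.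
Proof.
move=> sO; elim: m f => [|m IH] f /= [cf h].
  by split=> // x /sO; exact: cf.
split; first by move=> x /sO; exact: cf.
by move=> v; have [dv Cv] := h v; split; [move=> x /sO; exact: dv | exact: IH].
Qed.

(** Composing with this linear projection makes a coefficient of (F, theta) a smooth function of the
    full state, comparable with the free energy. *)
Definition deformation_temp (z : V) : 'M[R]_3 * R := (Fpart z.1, z.2).

Lemma deformation_temp_linear : linear deformation_temp.
Proof.
move=> a x y; rewrite /deformation_temp /=; congr (_, _).
by apply/matrixP => i j; rewrite !(FpartE, mxE).
Qed.

Definition deformation_tempL : {linear V -> ('M[R]_3 * R)%type} :=
  HB.pack deformation_temp (GRing.isLinear.Build _ _ _ _ deformation_temp deformation_temp_linear).

Lemma deformation_temp_continuous : continuous deformation_temp.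
Proof.
apply: (@bounded_linear_continuous _ _ _ deformation_tempL).
apply/linear_boundedP; near=> r => v /=.
apply: (@le_trans _ _ `|v|); last by rewrite ler_peMl//; near: r; exact: nbhs_pinfty_ge.
rewrite /deformation_temp [leLHS]prod_normE ge_max normr_time andbT.
rewrite [leLHS]/Num.Def.normr /= mx_normrE; apply/bigmax_leP; split=> // -[i j] _ /=.
by rewrite FpartE; exact: normr_coord.
Unshelve. all: by end_near. Qed.

Lemma coefficient_pullback (m : 'M[R]_3 -> R -> R) : coefficient m ->
  exists2 mm : V -> R, (forall n, Cdiff n [set z : V | 0 < z.2] mm)
    & forall z : V, 0 < z.2 -> mm z = m (Fpart z.1) z.2.
Proof.
case=> -[Q [f [oQ sQ Cf fE]]] _; exists (f \o deformation_temp).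
  move=> n; apply: (@Cdiff_sub _ _ (deformation_temp @^-1` Q)).
    by move=> z z0; apply: sQ.
  exact: (@Cdiff_pullback _ _ _ deformation_tempL n Q f deformation_temp_continuous (Cf n)).
by move=> z z0; rewrite /= -fE.
Qed.

Lemma C1_C2space_C1dir (J : set R) (f : 'rV[R]_3 -> R -> R) a b : C1_C2space J f ->
  C1dir (slab J) (ebase b) ('D_(ebase a) (fun z : W => f z.1 z.2)).
Proof.
case=> -[cf Df] D2; have [dd Cdd] := D2 a b.
have dE : 'D_(ebase a) (fun z : W => f z.1 z.2) = (fun z : W => dx a f z.1 z.2).
  by apply/funext => -[x t]; rewrite dxE.
have d2E : 'D_(ebase b) ('D_(ebase a) (fun z : W => f z.1 z.2))
    = (fun z : W => dx b (dx a f) z.1 z.2).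
  by rewrite dE; apply/funext => -[x t]; rewrite dxE.
split.
- by have [_ [cD _]] := Df (ebase a); exact: cD.
- move=> [x t] Sz; rewrite dE; have := dd _ Sz.
  rewrite /derivable; set F := fun _ => _; set G := fun _ => _.
  suff -> : F = G by [].
  have e r : shift (x, t) (r *: ebase b) = (shift x (r *: delta_mx 0 b), t) :> W.
    by rewrite /shift /ebase; congr (_, _); rewrite /= scaler0 add0r.
  by apply/funext => r; rewrite /F /G /comp e.
- by rewrite d2E; case: Cdd.
Qed.

Section on_slab.
Variables (lo hi : R).
Local Notation S := (slab `]lo, hi[ : set W).

Lemma dx_field a (f : 'rV[R]_3 -> R -> R) (h : W -> R) x t :
  (forall z, S z -> f z.1 z.2 = h z) -> S (x, t) -> dx a f x t = 'D_(ebase a) h (x, t).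
Proof. by move=> fh Sz; rewrite dxE; exact: (D_eq_on _ (@open_slab _ lo hi) Sz). Qed.

Lemma dt_field (f : 'rV[R]_3 -> R -> R) (h : W -> R) x t :
  (forall z, S z -> f z.1 z.2 = h z) -> S (x, t) -> dt f x t = 'D_etime h (x, t).
Proof. by move=> fh Sz; rewrite dtE; exact: (D_eq_on _ (@open_slab _ lo hi) Sz). Qed.

Variables (psi : 'rV[R]_19 -> R -> R) (O : set V) (g : V -> R).
Hypotheses (oO : open O) (O0 : forall z : V, 0 <= z.2 -> O z)
  (Cg : Cdiff 3 O g) (psiE : forall z : V, 0 <= z.2 -> psi z.1 z.2 = g z).
Variables (mu k : 'M[R]_3 -> R -> R) (U : state_field R) (u : @fields R).
Hypotheses (eX : forall z, S z -> fX u z = xi (U z.1 z.2))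
  (ev : forall i z, S z -> fv u i z = vel (U z.1 z.2) 0 i)
  (eth : forall z, S z -> fth u z = temp (U z.1 z.2))
  (emu : forall z, S z -> fmu u z = mu (Fpart (xi (U z.1 z.2))) (temp (U z.1 z.2)))
  (ek : forall z, S z -> fk u z = k (Fpart (xi (U z.1 z.2))) (temp (U z.1 z.2)))
  (th0 : forall z, S z -> 0 < temp (U z.1 z.2)).

(** The slab is open, so fields that agree on it have equal derivatives there; positivity of the
    temperature allows [psi] to be replaced by its extension [g]. *)
Lemma thermoviscoelastic_balanced : thermoviscoelastic psi mu k `]lo, hi[ U ->
  forall z, S z -> balanced g u z.
Proof.
move=> TV [x t] Sz; have [h1 h2 h3 h4] := TV x t Sz.
have eP B z : S z -> dxi psi B (xi (U z.1 z.2)) (temp (U z.1 z.2)) = fP g u B z.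
  by move=> Sy; rewrite (psi_dxi psiE)// ?ltW ?th0// /fP eX// eth.
have eA B i a z : S z -> dPhi B i a (Fpart (xi (U z.1 z.2))) = fA u B i a z.
  by move=> Sy; rewrite /fA eX.
have edv a i z : S z -> dx a (fun y s => vel (U y s) 0 i) z.1 z.2 = 'D_(ebase a) (fv u i) z.
  by case: z => y s Sy; apply: dx_field => // w Sw; rewrite ev.
have edth a z : S z -> dx a (fun y s => temp (U y s)) z.1 z.2 = 'D_(ebase a) (fth u) z.
  by case: z => y s Sy; apply: dx_field => // w Sw; rewrite eth.
have es i a z : S z -> \sum_(B < 19) dxi psi B (xi (U z.1 z.2)) (temp (U z.1 z.2))
    * dPhi B i a (Fpart (xi (U z.1 z.2))) = \sum_B fP g u B z * fA u B i a z.
  by move=> Sy; apply: eq_bigr => B _; rewrite (eP B _ Sy) (eA B i a _ Sy).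
split.
- move=> B; rewrite -[RHS](h1 B); congr (_ - _).
    by symmetry; apply: (dt_field _ Sz) => w Sw; rewrite eX.
  apply: eq_bigr => a _; symmetry; apply: (dx_field _ _ Sz) => w Sw.
  by apply: eq_bigr => i _; rewrite eA// ev.
- move=> i.
  have e1 : dt (fun y s => vel (U y s) 0 i) x t = 'D_etime (fv u i) (x, t).
    by apply: (dt_field _ Sz) => w Sw; rewrite ev.
  have e2 a : dx a (fun y s => \sum_(B < 19) dxi psi B (xi (U y s)) (temp (U y s))
          * dPhi B i a (Fpart (xi (U y s)))) x t
      = 'D_(ebase a) (fun y => \sum_B fP g u B y * fA u B i a y) (x, t).
    by apply: (dx_field _ _ Sz) => w Sw; exact: es.
  have e3 a : dx a (fun y s => mu (Fpart (xi (U y s))) (temp (U y s))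
        * dx a (fun y s => vel (U y s) 0 i) y s) x t
      = 'D_(ebase a) (fun y => fmu u y * 'D_(ebase a) (fv u i) y) (x, t).
    by apply: (dx_field _ _ Sz) => w Sw; rewrite (edv a i _ Sw) emu.
  rewrite -e1 -(eq_bigr _ (fun a _ => e2 a)) -(eq_bigr _ (fun a _ => e3 a)); exact: (h2 i).
- have e1 : dt (fun y s => 2^-1 * frob (vel (U y s)) ^+ 2
        + energy psi (xi (U y s)) (temp (U y s))) x t
      = 'D_etime (fun y => 2^-1 * (\sum_(i < 3) fv u i y ^+ 2)
          + (g (fX u y, fth u y) - fth u y * fE g u y)) (x, t).
    apply: (dt_field _ Sz) => w Sw; rewrite frob_sqr big_ord1 (psi_energy O0 Cg psiE _ (ltW (th0 Sw))).
    by rewrite /fE eX// eth//; congr (_ * _ + _); apply: eq_bigr => i _; rewrite ev.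
  have e2 a : dx a (fun y s => \sum_(i < 3) (\sum_(B < 19) dxi psi B (xi (U y s)) (temp (U y s))
          * dPhi B i a (Fpart (xi (U y s)))) * vel (U y s) 0 i) x t
      = 'D_(ebase a) (fun y => \sum_(i < 3)
            (\sum_B fP g u B y * fA u B i a y) * fv u i y) (x, t).
    by apply: (dx_field _ _ Sz) => w Sw; apply: eq_bigr => i _; rewrite (es i a _ Sw) ev.
  have e3 a : dx a (fun y s => \sum_(i < 3) mu (Fpart (xi (U y s))) (temp (U y s))
        * vel (U y s) 0 i * dx a (fun y s => vel (U y s) 0 i) y s) x t
      = 'D_(ebase a) (fun y => \sum_(i < 3)
            fmu u y * fv u i y * 'D_(ebase a) (fv u i) y) (x, t).
    by apply: (dx_field _ _ Sz) => w Sw; apply: eq_bigr => i _; rewrite (edv a i _ Sw) emu// ev.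
  have e4 a : dx a (fun y s => k (Fpart (xi (U y s))) (temp (U y s))
        * dx a (fun y s => temp (U y s)) y s) x t
      = 'D_(ebase a) (fun y => fk u y * 'D_(ebase a) (fth u) y) (x, t).
    by apply: (dx_field _ _ Sz) => w Sw; rewrite (edth a _ Sw) ek.
  rewrite -e1 -(eq_bigr _ (fun a _ => e2 a)) -(eq_bigr _ (fun a _ => e3 a))
    -(eq_bigr _ (fun a _ => e4 a)); exact: h3.
- move=> i a b; rewrite -[RHS](h4 i a b); congr (_ - _); symmetry; apply: (dx_field _ _ Sz) => w Sw;
    by rewrite eX.
Qed.

End on_slab.
End translation.

Section clamped_fields.
Context {R : realType}.
Local Notation V := ('rV[R]_19 * R)%type.
Local Notation W := ('rV[R]_3 * R)%type.
Variables (O : set V) (g : V -> R).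
Hypotheses (oO : open O) (O0 : forall z : V, 0 <= z.2 -> O z) (Cg : Cdiff 3 O g).
Variable T : R.
Hypothesis T0 : 0 < T.

Local Notation cz := (fun z : W => (z.1, clamp T z.2) : W).

Lemma clamp_slab (z : W) : slab `[0, T] (cz z).
Proof. by rewrite /slab /= in_itv /=; exact: clamp_in. Qed.

Record continuous_fields (u : @fields R) : Prop := ContinuousFields {
  cX : forall B, continuous (fun z => fX u (cz z) 0 B);
  cv : forall i, continuous (fun z => fv u i (cz z));
  cth : continuous (fun z => fth u (cz z));
  cth0 : forall z, slab `[0, T] z -> 0 < fth u z }.

Lemma continuous_comp_field (Q : set V) (f : V -> R) u : Cdiff 0 Q f ->
  (forall z : V, 0 < z.2 -> Q z) -> continuous_fields u -> continuous (fun z => f (fY u (cz z))).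
Proof.
move=> [cf _] Q0 cu z.
have h : {for z, continuous (fun y => (fX u (cz y), fth u (cz y)) : V)}.
  by apply: continuous_pair_row; [move=> j; exact: (@cX u cu j z) | exact: (@cth u cu z)].
have Qz : Q (fX u (cz z), fth u (cz z)) by apply: Q0; exact: (cth0 cu (clamp_slab z)).
exact: (cvg_comp (fun y => (fX u (cz y), fth u (cz y)) : V) f h (cf _ Qz)).
Qed.

(** At time 0 the solution is only continuous, so the formula itself is used; it contains no
    derivative of the fields, only derivatives of [g]. *)
Lemma continuous_relent u ub : continuous_fields u -> continuous_fields ub ->
  continuous (fun z => relent g u ub (cz z)).
Proof.
move=> cu cub.
have O0' (z : V) : 0 < z.2 -> O z by move=> /ltW; exact: O0.
have C0 m (f : V -> R) : Cdiff m O f -> Cdiff 0 O f by exact: Cdiff_le.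
have wE : (fun z => relent g u ub (cz z)) = (fun z =>
    g (fY u (cz z)) - g (fY ub (cz z))
    - (\sum_B (fX u (cz z) 0 B - fX ub (cz z) 0 B) * 'D_(ebase B) g (fY ub (cz z))
       + (fth u (cz z) - fth ub (cz z)) * 'D_etime g (fY ub (cz z)))
    - ('D_etime g (fY u (cz z)) - 'D_etime g (fY ub (cz z))) * (fth u (cz z) - fth ub (cz z))
    + 2^-1 * (\sum_(i < 3) (fv u i (cz z) - fv ub i (cz z)) * (fv u i (cz z) - fv ub i (cz z)))).
  apply/funext => z; rewrite /relent /Jrel; congr (_ - _ - _ + _ * _).
  rewrite (derive_coord oO O0 _ Cg) ?(ltW (cth0 cub (clamp_slab z)))//=; congr (_ + _).
  by apply: eq_bigr => B _; rewrite !mxE.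
have c1 m f : Cdiff m O f -> continuous (fun z => f (fY u (cz z))).
  by move=> Cf; exact: (continuous_comp_field (C0 _ _ Cf) O0' cu).
have c2 m f : Cdiff m O f -> continuous (fun z => f (fY ub (cz z))).
  by move=> Cf; exact: (continuous_comp_field (C0 _ _ Cf) O0' cub).
have CD v : Cdiff 2 O ('D_v g) := Cdiff_derive v Cg.
rewrite wE => z.
have dT : fth u (cz y) - fth ub (cz y) @[y --> z] --> fth u (cz z) - fth ub (cz z).
  by apply: cvgB; [exact: (@cth u cu z) | exact: (@cth ub cub z)].
have g1 : g (fY u (cz y)) @[y --> z] --> g (fY u (cz z)) by exact: (c1 _ _ Cg z).
have g2 : g (fY ub (cz y)) @[y --> z] --> g (fY ub (cz z)) by exact: (c2 _ _ Cg z).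
have e1 : 'D_etime g (fY u (cz y)) @[y --> z] --> 'D_etime g (fY u (cz z)).
  exact: (c1 _ _ (CD etime) z).
have e2 : 'D_etime g (fY ub (cz y)) @[y --> z] --> 'D_etime g (fY ub (cz z)).
  exact: (c2 _ _ (CD etime) z).
have s1 : \sum_B (fX u (cz y) 0 B - fX ub (cz y) 0 B) * 'D_(ebase B) g (fY ub (cz y)) @[y --> z]
    --> \sum_B (fX u (cz z) 0 B - fX ub (cz z) 0 B) * 'D_(ebase B) g (fY ub (cz z)).
  apply: cvg_sumr => B _; apply: cvgM; last exact: (c2 _ _ (CD (ebase B)) z).
  by apply: cvgB; [exact: (@cX u cu B z) | exact: (@cX ub cub B z)].
have s2 : \sum_(i < 3) (fv u i (cz y) - fv ub i (cz y)) * (fv u i (cz y) - fv ub i (cz y)) @[y --> z]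
    --> \sum_(i < 3) (fv u i (cz z) - fv ub i (cz z)) * (fv u i (cz z) - fv ub i (cz z)).
  have dv i : fv u i (cz y) - fv ub i (cz y) @[y --> z] --> fv u i (cz z) - fv ub i (cz z).
    by apply: cvgB; [exact: (@cv u cu i z) | exact: (@cv ub cub i z)].
  by apply: cvg_sumr => i _; apply: cvgM; exact: dv.
apply: cvgD; last by apply: cvgM; [exact: cvg_cst | exact: s2].
apply: cvgB; last by apply: cvgM; [apply: cvgB; [exact: e1 | exact: e2] | exact: dT].
apply: cvgB; first by apply: cvgB; [exact: g1 | exact: g2].
by apply: cvgD; [exact: s1 | apply: cvgM; [exact: dT | exact: e2]].
Qed.

Lemma clamped_at (h : W -> R) : (forall z, slab `[0, T] z -> {for z, continuous h}) ->
  continuous (fun z => h (cz z)).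
Proof. by move=> ch; apply: (clamped_continuous T0); exact: within_continuous_at. Qed.

End clamped_fields.

(** * Fields of the reference solution *)

Section reference.
Context {R : realType}.
Local Notation V := ('rV[R]_19 * R)%type.
Local Notation W := ('rV[R]_3 * R)%type.
Variables (psi : 'rV[R]_19 -> R -> R) (k : 'M[R]_3 -> R -> R) (kk : V -> R).
Hypotheses (Ckk : forall n, Cdiff n [set z : V | 0 < z.2] kk).
Variables (T M delta : R) (Ub : state_field R).
Hypotheses (T0 : 0 < T) (d0 : 0 < delta) (hUb : smooth_inviscid_solution psi k T Ub)
  (hGamma : forall x t, 0 <= t < T -> Gamma M delta (Ub x t)).

(** The reference states are confined to [Gamma] only for times before [T]; the lower bound on the
    temperature passes to time [T] by continuity. *)
Lemma ge_at_endpoint (h : W -> R) x c : (forall t, 0 <= t < T -> c <= h (x, t)) ->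
  {for (x, T), continuous h} -> c <= h (x, T).
Proof.
move=> hc ch; rewrite leNgt; apply/negP => hT.
have cs : {for T, continuous (fun t : R => h (x, t))}.
  exact: (cvg_comp (fun r => (x, r)) h (@continuous_pairr _ _ x T) ch).
have [e /= e0 He] : \forall s \near T, h (x, s) < c by exact: cvgr_lt cs _ hT.
pose s := T - Num.min (e / 2) T / 2.
have m0 : 0 < Num.min (e / 2) T by rewrite lt_min T0 divr_gt0.
have mT : Num.min (e / 2) T <= T by rewrite ge_min lexx orbT.
have me : Num.min (e / 2) T <= e / 2 by rewrite ge_min lexx.
move: (Num.min (e / 2) T) m0 mT me @s => m m0 mT me s.
have hs : h (x, s) < c.
  by apply: He; rewrite /ball /= /s opprB addrC subrK gtr0_norm ?divr_gt0//; lra.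
have hs' : 0 <= s < T by rewrite /s; apply/andP; split; lra.
by have := hc s hs'; rewrite leNgt hs.
Qed.

(** Smoothness up to the boundary means that the fields extend to an open neighbourhood of the
    closed slab. Working with the extensions gives derivatives that are continuous, hence bounded,
    on the closed cylinder. *)
Lemma reference_fields : exists (ub : @fields R) (Q : set W),
  [/\ open Q, slab `[0, T] `<=` Q, regular Q ub, fmu ub = fun=> 0
    & forall z, fk ub z = kk (fY ub z)] /\
  [/\ forall z, slab `[0, T] z -> fX ub z = xi (Ub z.1 z.2),
      forall i z, slab `[0, T] z -> fv ub i z = vel (Ub z.1 z.2) 0 i
    & forall z, slab `[0, T] z -> fth ub z = temp (Ub z.1 z.2)].
Proof.
have [_ [hX hv [Oth [gth [oth sth Cth thE]]]] _] := hUb.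
have /choice[OX /choice[gX HX]] : forall B : 'I_19, exists Q : set W, exists f : W -> R,
    [/\ open Q, slab `[0, T] `<=` Q, forall n, Cdiff n Q f
      & forall z, slab `[0, T] z -> xi (Ub z.1 z.2) 0 B = f z] := hX.
have /choice[Ov /choice[gv Hv]] : forall i : 'I_3, exists Q : set W, exists f : W -> R,
    [/\ open Q, slab `[0, T] `<=` Q, forall n, Cdiff n Q f
      & forall z, slab `[0, T] z -> vel (Ub z.1 z.2) 0 i = f z] := hv.
(* All extensions are defined and the temperature is positive here; the interior of [A] serves as
   the common open neighbourhood. *)
pose A : set W := [set z | (forall B, OX B z) /\ (forall i, Ov i z) /\ Oth z /\ 0 < gth z].
pose ub := @Fields R (fun z => \row_B gX B z) gv gth (fun=> 0)
  (fun z => kk (\row_B gX B z, gth z)).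
exists ub, A^°.
have AI : A^° `<=` A by exact: interior_subset.
have oA : open A^° by exact: open_interior.
have posT z : slab `[0, T] z -> 0 < gth z.
  move=> Sz; apply: (lt_le_trans d0); case: z Sz => x t; rewrite /slab /= in_itv /= => /andP[t0].
  have bd s : 0 <= s < T -> delta <= gth (x, s).
    move=> sT; have [_ _ _ _ /andP[h _]] := hGamma x sT; rewrite -thE//.
    by rewrite /slab /= in_itv /=; case/andP: sT => -> /ltW ->.
  rewrite le_eqVlt => /orP[/eqP ->|tT]; last by apply: bd; rewrite t0.
  apply: ge_at_endpoint bd _; have [cth _] := Cth 0%N; apply: cth; apply: sth.
  by rewrite /slab /= in_itv /= lexx ltW.
split; split; [exact: oA| | |by []|by []| | |].
- move=> z Sz.
  have n1 : \forall y \near z, forall B, OX B y.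
    have h B : nbhs z (OX B).
      by have [oQ sQ _ _] := HX B; apply: open_nbhs_nbhs; split=> //; exact: sQ.
    exact: (@filter_forall _ _ OX (nbhs z) (nbhs_filter z) h).
  have n2 : \forall y \near z, forall i, Ov i y.
    have h i : nbhs z (Ov i).
      by have [oQ sQ _ _] := Hv i; apply: open_nbhs_nbhs; split=> //; exact: sQ.
    exact: (@filter_forall _ _ Ov (nbhs z) (nbhs_filter z) h).
  have n3 : \forall y \near z, Oth y by apply: open_nbhs_nbhs; split=> //; exact: sth.
  have n4 : \forall y \near z, 0 < gth y.
    by have [cth _] := Cth 0%N; exact: cvgr_gt (cth _ (sth _ Sz)) _ (posT _ Sz).
  by near=> y; split; [near: y | split; [near: y | split; near: y]].
- have CX B d : C1dir A^° d (gX B).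
    have [_ _ C _] := HX B; apply: C1dir_sub (Cdiff_C1dir d (C 1%N)).
    by move=> z /AI[h _]; exact: h.
  have Cv' i n : Cdiff n A^° (gv i).
    by have [_ _ C _] := Hv i; apply: Cdiff_sub (C n) => z /AI[_ [h _]]; exact: h.
  have Cth' n : Cdiff n A^° gth.
    by apply: Cdiff_sub (Cth n) => z /AI[_ [_ [h _]]]; exact: h.
  have CX' B d : C1dir A^° d (fun z => fX ub z 0 B).
    by rewrite (_ : (fun z => _) = gX B)//; apply/funext => z; rewrite mxE.
  split=> //=.
  + by move=> i d; exact: Cdiff_C1dir (Cv' i 1%N).
  + by move=> d; exact: Cdiff_C1dir (Cth' 1%N).
  + by move=> i a b; exact: Cdiff_C1dir (Cdiff_derive (ebase a) (Cv' i 2%N)).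
  + by move=> a b; exact: Cdiff_C1dir (Cdiff_derive (ebase a) (Cth' 2%N)).
  + by move=> d; exact: C1dir_cst.
  + move=> d; apply: (@C1dir_chain _ _ _ _ oA _ [set z : V | 0 < z.2] kk 0 (fX ub) gth).
    * apply: (@open_comp _ _ (snd : V -> R) [set r | 0 < r]); last exact: open_gt.
      by move=> z _; exact: cvg_snd.
    * exact: Ckk.
    * by move=> z /AI[_ [_ [_ h]]].
    * by move=> B; exact: CX'.
    * exact: Cdiff_C1dir (Cth' 1%N).
  + by move=> z /AI[_ [_ [_ h]]].
- by move=> z Sz; apply/rowP => B; rewrite mxE; have [_ _ _ ->] := HX B.
- by move=> i z Sz; have [_ _ _ ->] := Hv i.
- by move=> z Sz; rewrite thE.
Unshelve. all: by end_near. Qed.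

End reference.

(** * Regularity, periodicity and balance for both solutions *)

Section solution.
Context {R : realType}.
Local Notation V := ('rV[R]_19 * R)%type.
Local Notation W := ('rV[R]_3 * R)%type.

Lemma regular_sub (S S' : set W) (u : @fields R) : S' `<=` S -> regular S u -> regular S' u.
Proof.
move=> sS ru; split=> [B d|i d|d|i a b|a b|d|d|z /sS Sz].
- exact: C1dir_sub sS (rX ru B d).
- exact: C1dir_sub sS (rv ru i d).
- exact: C1dir_sub sS (rth ru d).
- exact: C1dir_sub sS (rdv ru i a b).
- exact: C1dir_sub sS (rdth ru a b).
- exact: C1dir_sub sS (rmu ru d).
- exact: C1dir_sub sS (rk ru d).
- exact: (rpos ru Sz).
Qed.

Lemma open_pos_temp : open [set z : V | 0 < z.2].
Proof.
apply: (@open_comp _ _ (snd : V -> R) [set r | 0 < r]); last exact: open_gt.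
by move=> z _; exact: cvg_snd.
Qed.

Section one_solution.
Variables (psi : 'rV[R]_19 -> R -> R) (O : set V) (g : V -> R).
Hypotheses (oO : open O) (O0 : forall z : V, 0 <= z.2 -> O z)
  (Cg : Cdiff 3 O g) (psiE : forall z : V, 0 <= z.2 -> psi z.1 z.2 = g z).
Variables (mu k : 'M[R]_3 -> R -> R) (mm kk : V -> R).
Hypotheses (Cmm : forall n, Cdiff n [set z : V | 0 < z.2] mm)
  (Ckk : forall n, Cdiff n [set z : V | 0 < z.2] kk)
  (mmE : forall z : V, 0 < z.2 -> mm z = mu (Fpart z.1) z.2)
  (kkE : forall z : V, 0 < z.2 -> kk z = k (Fpart z.1) z.2).
Variables (T Tstar : R) (U : state_field R).
Hypotheses (T0 : 0 < T) (TT : T < Tstar) (hU : strong_solution psi mu k Tstar U)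
  (hpos : forall x t, 0 <= t < Tstar -> 0 < temp (U x t)).

(** The coefficients enter through the pullbacks [mm] and [kk], smooth in the full state and equal
    to [mu] and [k] wherever the temperature is positive. *)
Definition solution_field : @fields R := Fields
  (fun z => xi (U z.1 z.2)) (fun i z => vel (U z.1 z.2) 0 i) (fun z => temp (U z.1 z.2))
  (fun z => mm (xi (U z.1 z.2), temp (U z.1 z.2)))
  (fun z => kk (xi (U z.1 z.2), temp (U z.1 z.2))).
Local Notation u := solution_field.

Let sub_open : slab `]0, T[ `<=` (slab `]0, Tstar[ : set W).
Proof.
move=> z; rewrite /slab /= !in_itv /= => /andP[-> zT] /=; exact: lt_trans TT.
Qed.

Let sub_closed : slab `[0, T] `<=` (slab `[0, Tstar[ : set W).
Proof.
move=> z; rewrite /slab /= !in_itv /= => /andP[-> zT] /=; exact: le_lt_trans TT.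
Qed.

Let pos_closed z : slab `[0, T] z -> 0 < temp (U z.1 z.2).
Proof. by move=> /sub_closed; rewrite /slab /= in_itv; exact: hpos. Qed.

Let open_closed : slab `]0, T[ `<=` (slab `[0, T] : set W).
Proof. by move=> z; rewrite /slab /= !in_itv /= => /andP[/ltW -> /ltW ->]. Qed.

Lemma solution_regular : regular (slab `]0, T[) u.
Proof.
have [_ _ [hX hv hth] _] := hU; have oS := @open_slab R 0 T.
have cX B d : C1dir (slab `]0, T[) d (fun z : W => xi (U z.1 z.2) 0 B).
  exact: C1dir_sub sub_open (Cdiff_C1dir d (hX B)).
have cth d : C1dir (slab `]0, T[) d (fun z : W => temp (U z.1 z.2)).
  by case: hth => h _; exact: C1dir_sub sub_open (Cdiff_C1dir d h).
have ck (f : V -> R) d : (forall n, Cdiff n [set z : V | 0 < z.2] f) ->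
    C1dir (slab `]0, T[) d (fun z : W => f (xi (U z.1 z.2), temp (U z.1 z.2))).
  move=> Cf; apply: (@C1dir_chain _ _ _ _ oS _ [set z : V | 0 < z.2] f 0
    (fun z : W => xi (U z.1 z.2)) (fun z : W => temp (U z.1 z.2)) open_pos_temp (Cf 1%N)).
  - by move=> z /open_closed; exact: pos_closed.
  - by move=> j; exact: cX.
  - exact: cth.
split.
- by move=> B d; exact: cX.
- by move=> i d; case: (hv i) => h _; exact: C1dir_sub sub_open (Cdiff_C1dir d h).
- exact: cth.
- by move=> i a b; exact: C1dir_sub sub_open (C1_C2space_C1dir a b (hv i)).
- by move=> a b; exact: C1dir_sub sub_open (C1_C2space_C1dir a b hth).
- by move=> d; exact: ck.
- by move=> d; exact: ck.
- by move=> z /open_closed; exact: pos_closed.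
Qed.

Lemma solution_continuous : continuous_fields T u.
Proof.
have [_ [hX hv hth] _ _] := hU.
split.
- by move=> B; exact: (clamped_continuous T0 (continuous_subspaceW sub_closed (hX B))).
- by move=> i; exact: (clamped_continuous T0 (continuous_subspaceW sub_closed (hv i))).
- exact: (clamped_continuous T0 (continuous_subspaceW sub_closed hth)).
- exact: pos_closed.
Qed.

Lemma solution_periodic t : 0 < t < T -> periodic_fields u t.
Proof.
move=> /andP[t0 tT]; have [hp _ _ _] := hU.
have per x a : U (x + delta_mx 0 a) t = U x t.
  by apply: hp; rewrite /= in_itv /= (ltW t0) (lt_trans tT).
by split; rewrite /periodic_at /=; move=> *; rewrite per.
Qed.

Lemma solution_balanced z : slab `]0, T[ z -> balanced g u z.
Proof.
have [_ _ _ hTV] := hU.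
apply: (thermoviscoelastic_balanced O0 Cg psiE (mu := mu) (k := k) (U := U)) => //.
- by move=> y /open_closed/pos_closed p; rewrite /= mmE.
- by move=> y /open_closed/pos_closed p; rewrite /= kkE.
- by move=> y /open_closed/pos_closed.
- by move=> x t tT; apply: hTV; move: tT; rewrite /= !in_itv /= => /andP[-> h] /=; exact: lt_trans TT.
Qed.

End one_solution.

Section reference_facts.
Variables (psi : 'rV[R]_19 -> R -> R) (O : set V) (g : V -> R).
Hypotheses (oO : open O) (O0 : forall z : V, 0 <= z.2 -> O z)
  (Cg : Cdiff 3 O g) (psiE : forall z : V, 0 <= z.2 -> psi z.1 z.2 = g z).
Variables (k : 'M[R]_3 -> R -> R) (kk : V -> R).
Hypotheses (kkE : forall z : V, 0 < z.2 -> kk z = k (Fpart z.1) z.2).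
Variables (T : R) (Ub : state_field R) (ub : @fields R) (Q : set W).
Hypotheses (T0 : 0 < T) (hUb : smooth_inviscid_solution psi k T Ub).
Hypotheses (oQ : open Q) (sQ : slab `[0, T] `<=` Q) (rub : regular Q ub) (mub : fmu ub = fun=> 0)
  (kub : forall z, fk ub z = kk (fY ub z)).
Hypotheses (eX : forall z, slab `[0, T] z -> fX ub z = xi (Ub z.1 z.2))
  (ev : forall i z, slab `[0, T] z -> fv ub i z = vel (Ub z.1 z.2) 0 i)
  (eth : forall z, slab `[0, T] z -> fth ub z = temp (Ub z.1 z.2)).

Let open_closed : slab `]0, T[ `<=` (slab `[0, T] : set W).
Proof. by move=> z; rewrite /slab /= !in_itv /= => /andP[/ltW -> /ltW ->]. Qed.

Lemma reference_continuous : continuous_fields T ub.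
Proof.
split.
- move=> B; have H z (Sz : slab `[0, T] z) : {for z, continuous (fun z => fX ub z 0 B)}.
    by have [h _ _] := rX rub B etime; exact: h (sQ Sz).
  exact: (clamped_at T0 H).
- move=> i; have H z (Sz : slab `[0, T] z) : {for z, continuous (fv ub i)}.
    by have [h _ _] := rv rub i etime; exact: h (sQ Sz).
  exact: (clamped_at T0 H).
- have H z (Sz : slab `[0, T] z) : {for z, continuous (fth ub)}.
    by have [h _ _] := rth rub etime; exact: h (sQ Sz).
  exact: (clamped_at T0 H).
- by move=> z /sQ Qz; exact: (rpos rub Qz).
Qed.

Lemma reference_periodic t : 0 < t < T -> periodic_fields ub t.
Proof.
move=> /andP[t0 tT]; have [hp _ _] := hUb.
have It : `[0, T]%classic t by rewrite /= in_itv /= !ltW.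
have per x a : Ub (x + delta_mx 0 a) t = Ub x t by exact: hp.
have pX x a : fX ub (x + delta_mx 0 a, t) = fX ub (x, t) by rewrite !eX//= per.
have pth x a : fth ub (x + delta_mx 0 a, t) = fth ub (x, t) by rewrite !eth//= per.
split=> //.
- by move=> i x a; rewrite !ev//= per.
- by move=> x a; rewrite mub.
- by move=> x a; rewrite !kub /fY pX pth.
Qed.

Lemma reference_balanced z : slab `]0, T[ z -> balanced g ub z.
Proof.
have [_ _ hTV] := hUb.
have pos y : slab `[0, T] y -> 0 < temp (Ub y.1 y.2).
  by move=> Sy; rewrite -eth//; exact: (rpos rub (sQ Sy)).
apply: (thermoviscoelastic_balanced O0 Cg psiE (mu := fun _ _ => 0) (k := k) (U := Ub)) => //.
- by move=> y /open_closed; exact: eX.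
- by move=> i y /open_closed; exact: ev.
- by move=> y /open_closed; exact: eth.
- by move=> y _; rewrite mub.
- move=> y /open_closed Sy; rewrite kub kkE /fY /= ?eX ?eth//; exact: pos.
- by move=> y /open_closed; exact: pos.
Qed.

Lemma bounded_on_cylinder (I : finType) (F : I -> W -> R) :
  (forall i z, slab `[0, T] z -> {for z, continuous (F i)}) ->
  exists2 D : R, 0 < D & forall i y t, cube y -> 0 < t < T -> `|F i (point3 y, t)| <= D.
Proof.
move=> cF.
have [D D0 HD] : exists2 D : R, 0 < D & forall i z, (cube `*` `[0, T]) z ->
    `|F i (point3 z.1, z.2)| <= D.
  apply: (@compact_bound_fin R _ _ I (fun i z => F i (point3 z.1, z.2))).
    by apply: compact_setX; [exact: compact_cube | exact: segment_compact].
  move=> i; apply: within_continuous_at => z [_ zT].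
  have h0 : w.1 @[w --> z] --> z.1 by exact: cvg_fst.
  have h1 : point3 w.1 @[w --> z] --> point3 z.1 by exact: (cvg_comp _ _ h0 (@point3_continuous _ z.1)).
  have h2 : w.2 @[w --> z] --> z.2 by exact: cvg_snd.
  have h3 : (point3 w.1, w.2) @[w --> z] --> (point3 z.1, z.2) by exact: (cvg_pair h1 h2).
  exact: (cvg_comp (fun w => (point3 w.1, w.2)) (F i) h3 (cF i (point3 z.1, z.2) zT)).
exists D => // i y t Cy tT; apply: (HD i (y, t)); split=> //=.
by case/andP: tT => t0 tT; rewrite in_itv /= !ltW.
Qed.

Lemma reference_bounds : exists2 D : R, 0 < D & forall y t, cube y -> 0 < t < T ->
  let z := (point3 y, t) in
  [/\ forall B, `|'D_etime (fun y => fX ub y 0 B) z| <= D,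
      `|'D_etime (fth ub) z| <= D,
      forall i a, `|'D_(ebase a) (fv ub i) z| <= D,
      forall B a, `|'D_(ebase a) (fP g ub B) z| <= D
    & forall a, `|'D_(ebase a) (fth ub) z * (fth ub z)^-1| <= D].
Proof.
have [D1 D10 H1] : exists2 D : R, 0 < D & forall (B : 'I_19) y t, cube y -> 0 < t < T ->
    `|'D_etime (fun y => fX ub y 0 B) (point3 y, t)| <= D.
  apply: (@bounded_on_cylinder _ (fun B => 'D_etime (fun y => fX ub y 0 B))) => B z /sQ Qz.
  by have [_ _ h] := rX rub B etime; exact: h.
have [D2 D20 H2] : exists2 D : R, 0 < D & forall (i : unit) y t, cube y -> 0 < t < T ->
    `|'D_etime (fth ub) (point3 y, t)| <= D.
  apply: (@bounded_on_cylinder _ (fun=> 'D_etime (fth ub))) => i z /sQ Qz.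
  by have [_ _ h] := rth rub etime; exact: h.
have [D3 D30 H3] : exists2 D : R, 0 < D & forall (j : 'I_3 * 'I_3) y t, cube y -> 0 < t < T ->
    `|'D_(ebase j.2) (fv ub j.1) (point3 y, t)| <= D.
  apply: (@bounded_on_cylinder _ (fun j : 'I_3 * 'I_3 => 'D_(ebase j.2) (fv ub j.1))) => j z /sQ Qz.
  by have [_ _ h] := rv rub j.1 (ebase j.2); exact: h.
have [D4 D40 H4] : exists2 D : R, 0 < D & forall (j : 'I_19 * 'I_3) y t, cube y -> 0 < t < T ->
    `|'D_(ebase j.2) (fP g ub j.1) (point3 y, t)| <= D.
  apply: (@bounded_on_cylinder _ (fun j : 'I_19 * 'I_3 => 'D_(ebase j.2) (fP g ub j.1))) => j z /sQ Qz.
  by have [_ _ h] := C1dir_P oO O0 Cg oQ rub j.1 (ebase j.2); exact: h.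
have [D5 D50 H5] : exists2 D : R, 0 < D & forall (a : 'I_3) y t, cube y -> 0 < t < T ->
    `|'D_(ebase a) (fth ub) (point3 y, t) * (fth ub (point3 y, t))^-1| <= D.
  apply: (@bounded_on_cylinder _ (fun a z => 'D_(ebase a) (fth ub) z * (fth ub z)^-1)) => a z /sQ Qz.
  have [h1 _ h2] := rth rub (ebase a).
  by apply: cvgM; [exact: h2 | apply: cvgV; [rewrite gt_eqF// (rpos rub Qz) | exact: h1]].
exists (D1 + D2 + D3 + D4 + D5); first by rewrite !addr_gt0.
move=> y t Cy tT z.
have le1 : D1 <= D1 + D2 + D3 + D4 + D5 by lra.
have le2 : D2 <= D1 + D2 + D3 + D4 + D5 by lra.
have le3 : D3 <= D1 + D2 + D3 + D4 + D5 by lra.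
have le4 : D4 <= D1 + D2 + D3 + D4 + D5 by lra.
have le5 : D5 <= D1 + D2 + D3 + D4 + D5 by lra.
split.
- by move=> B; exact: le_trans (H1 B y t Cy tT) le1.
- exact: le_trans (H2 tt y t Cy tT) le2.
- by move=> i a; exact: le_trans (H3 (i, a) y t Cy tT) le3.
- by move=> B a; exact: le_trans (H4 (B, a) y t Cy tT) le4.
- by move=> a; exact: le_trans (H5 a y t Cy tT) le5.
Qed.

End reference_facts.
End solution.

(** * The two Gronwall estimates *)

Section main_estimate.
Context {R : realType}.
Local Notation V := ('rV[R]_19 * R)%type.
Local Notation W := ('rV[R]_3 * R)%type.
Variables (psi : 'rV[R]_19 -> R -> R) (p q r l : R) (k : 'M[R]_3 -> R -> R) (C' : R)
  (T M delta dlow : R) (Ub : state_field R).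
Hypotheses (hpsi : free_energy_C3 psi) (hconv : hess_xi_posdef psi) (heta : eta_th_pos psi)
  (hp : 4 <= p) (hq : 1 < q) (hr : 1 < r) (hl : 1 < l)
  (hG1 : growth1 p q r l psi) (hG2 : growth2 p q r l psi) (hG3 : growth3 p q r l psi)
  (hk : coefficient k) (T0 : 0 < T) (d0 : 0 < delta) (dlow0 : 0 < dlow)
  (hUb : smooth_inviscid_solution psi k T Ub)
  (hGamma : forall x t, 0 <= t < T -> Gamma M delta (Ub x t)).

(* The first bound keeps the viscous error, the second absorbs [mu * th <= C' * mu0 * |e|]
   into the relative entropy. *)
Lemma relative_entropy_estimates : exists K L : R, [/\ 0 < K, 0 <= L &
  forall (mu0 : R) (mu : 'M[R]_3 -> R -> R) (Tstar : R) (U : state_field R),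
    0 < mu0 -> viscous_solution psi k C' dlow T mu0 mu Tstar U ->
    [/\ (0 <= rel_entropy_int psi U Ub 0)%E,
        forall t, 0 <= t <= T -> (rel_entropy_int psi U Ub t
          <= (expR (K * T))%:E * (rel_entropy_int psi U Ub 0 + viscous_error mu T U Ub))%E
      & forall t, 0 <= t <= T -> (rel_entropy_int psi U Ub t
          <= (expR ((K + mu0 * L) * T))%:E * (rel_entropy_int psi U Ub 0 + (mu0 * L * T)%:E))%E]].
Proof.
have [Om [g [oO sO Cg gE]]] := hpsi.
have O0 (z : V) : 0 <= z.2 -> Om z by exact: sO.
have psiE (z : V) : 0 <= z.2 -> psi z.1 z.2 = g z by exact: gE.
have [kk Ckk kkE] := coefficient_pullback hk.
have kpos (z : V) : 0 < z.2 -> 0 < kk z by move=> z0; rewrite kkE//; exact: hk.2.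
have [ub [Q [[oQ sQ rub mub kub] [eX ev eth]]]] := reference_fields Ckk T0 d0 hUb hGamma.
have [D D0 HD] := reference_bounds oO O0 Cg oQ sQ rub (T := T).
(* The constant is fixed before [mu0], [mu] and the viscous solution are introduced. *)
have [K K0 HK] := residual_le oO O0 Cg psiE hp hq hr hl hG1 hG2 hG3 hconv heta
  M C' d0 dlow0 D0 (Ckk 1%N) kpos.
have [C1 C10 H1] := energy_linear O0 Cg psiE hG1.
have [C2 C20 H2] := sz_Jrel oO O0 Cg psiE hp hq hr hl hG1 hG3 hconv heta M.
(* [C1] bounds the energy by one plus the size, [C2] the latter by one plus the relative entropy;
   the last factor bounds the squared velocity gradient over the temperature of the reference
   solution, summed over nine entries. *)
pose L := `|C'| * C1 * C2 * (9%:R * (D ^+ 2 / delta)).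
have L0 : 0 <= L.
  have h : 0 <= D ^+ 2 / delta by rewrite ltW// divr_gt0// exprn_gt0.
  apply: mulr_ge0; last by apply: mulr_ge0.
  by apply: mulr_ge0; [apply: mulr_ge0 => //; exact: ltW | exact: ltW].
exists K, L; split=> // mu0 mu Tstar U mu00 [hmu TT hU hb].
have posU x t : 0 <= t < Tstar -> 0 < temp (U x t).
  by move=> tT; have [h _ _] := hb x t tT; exact: lt_le_trans h.
have [mm Cmm mmE] := coefficient_pullback hmu.
pose u := solution_field mm kk U.
have ru := solution_regular Cmm Ckk TT hU posU.
have cu : continuous_fields T u := solution_continuous mm kk T0 TT hU posU.
have cub := reference_continuous T0 sQ rub.
have open_closed : slab `]0, T[ `<=` (slab `[0, T] : set W).
  by move=> z; rewrite /slab /= !in_itv /= => /andP[/ltW -> /ltW ->].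
have rubS : regular (slab `]0, T[) ub.
  by apply: regular_sub rub => z /open_closed; exact: sQ.
have crel := continuous_relent oO O0 Cg T0 cu cub.
have inT (x : 'rV[R]_3) t : 0 <= t <= T -> slab `[0, T] (x, t) by move=> h; rewrite /slab /= in_itv.
have boxb x t : 0 <= t < T -> box delta M (fY ub (x, t)).
  move=> tT; have Sz : slab `[0, T] (x, t) by apply: inT; case/andP: tT => -> /ltW ->.
  rewrite /fY eX// eth//=; have [h1 h2 h3 _ h4] := hGamma x tT; split=> //= B.
  case: (ixP B) => [j b|j b|].
  - by rewrite -FpartE; exact: le_trans (frob_entry _ _ _) h1.
  - by rewrite -zpartE; exact: le_trans (frob_entry _ _ _) h2.
  - by rewrite -wpartE.
have box0 x t : 0 <= t < T -> box 0 M (fY ub (x, t)).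
  move=> /(boxb x)[h1 /andP[h2 h3]]; split=> //; rewrite h3 andbT; exact: le_trans (ltW d0) h2.
have J0 x t : 0 <= t < T -> 0 <= Jrel g (fY u (x, t)) (fY ub (x, t)).
  move=> tT; apply: (Jrel_ge0 oO O0 Cg psiE hp hq hr hl hconv heta _ (box0 x t tT)).
  by rewrite ltW// posU//; case/andP: tT => -> /lt_trans ->.
have JI x t : 0 <= t < T -> Jrel g (fY u (x, t)) (fY ub (x, t)) <= relent g u ub (x, t).
  move=> tT; rewrite /relent lerDl mulr_ge0 ?invr_ge0// sumr_ge0// => i _; exact: sqr_ge0.
(* The integrand of [viscous_error] in terms of the fields; it is the source term of the first
   Gronwall estimate. *)
pose e z := fmu u z * fth u z * (\sum_(i < 3) \sum_(a < 3) 'D_(ebase a) (fv ub i) z ^+ 2 / fth ub z).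
have mpos x t : 0 <= t < Tstar -> 0 < fmu u (x, t).
  by move=> tT; rewrite /u /= mmE//= ?posU//; apply: hmu.2; exact: posU.
have TTs t : 0 <= t <= T -> 0 <= t < Tstar by move=> /andP[-> h]; exact: le_lt_trans TT.
have e0 z : slab `[0, T] z -> 0 <= e z.
  case: z => x t; rewrite /slab /= in_itv /= => tT; rewrite /e.
  have b0 : 0 < fth ub (x, t) by exact: (rpos rub (sQ _ (inT x t tT))).
  apply: mulr_ge0; first by apply: mulr_ge0; rewrite ltW ?mpos ?TTs// /u /= posU ?TTs.
  apply: sumr_ge0 => i _; apply: sumr_ge0 => a _.
  by apply: mulr_ge0; [exact: sqr_ge0 | rewrite invr_ge0 ltW].
have ce : continuous (fun z : W => e (z.1, clamp T z.2)).
  move=> z; rewrite /e.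
  have m1 : fmu u (y.1, clamp T y.2) @[y --> z] --> fmu u (z.1, clamp T z.2).
    exact: (continuous_comp_field T0 (Cmm 0%N) (fun y h => h) cu).
  have m2 : fth u (y.1, clamp T y.2) @[y --> z] --> fth u (z.1, clamp T z.2).
    exact: (cth cu).
  have m3 : fth ub (y.1, clamp T y.2) @[y --> z] --> fth ub (z.1, clamp T z.2).
    exact: (cth cub).
  have m4 : (fth ub (y.1, clamp T y.2))^-1 @[y --> z] --> (fth ub (z.1, clamp T z.2))^-1.
    by apply: cvgV; [rewrite gt_eqF// (cth0 cub)//; exact: clamp_slab | exact: m3].
  have m5 i a : 'D_(ebase a) (fv ub i) (y.1, clamp T y.2) @[y --> z]
      --> 'D_(ebase a) (fv ub i) (z.1, clamp T z.2).
    have H w (Sw : slab `[0, T] w) : {for w, continuous ('D_(ebase a) (fv ub i))}.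
      by have [_ _ h] := rv rub i (ebase a); exact: h (sQ _ Sw).
    exact: (clamped_at T0 H).
  apply: cvgM; first by apply: cvgM; [exact: m1 | exact: m2].
  apply: cvg_sumr => i _; apply: cvg_sumr => a _; apply: cvgM; last exact: m4.
  by rewrite expr2; apply: cvgM; exact: m5.
have phi0 : 0 <= Tint (fun x => relent g u ub (x, 0)).
  apply: Tint_ge0 => y _; have h0 : (0 : R) <= 0 < T by rewrite lexx.
  exact: le_trans (J0 _ _ h0) (JI _ _ h0).
have res y t : cube y -> 0 < t < T ->
    fres g u ub (point3 y, t) <= K * relent g u ub (point3 y, t) + e (point3 y, t).
  move=> Cy tT; have tT' : 0 <= t < T by case/andP: tT => /ltW -> ->.
  have tTs : 0 <= t < Tstar by case/andP: tT' => -> /lt_trans ->.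
  have [h1 h2 h3 h4 h5] := HD y t Cy tT.
  have [b1 b2 _] := hb (point3 y) t tTs.
  have th0 := posU (point3 y) t tTs.
  apply: HK => //.
  - by rewrite ltW// mpos.
  - move: b2; rewrite -[k _ _](kkE (xi (U (point3 y) t), temp (U (point3 y) t)))//.
    by rewrite (psi_energy O0 Cg psiE)// ltW.
  - exact: boxb.
have relE t : 0 <= t <= T ->
    rel_entropy_int psi U Ub t = (Tint (fun x => relent g u ub (x, t)))%:E.
  move=> tT; rewrite -torus_intE; last exact: (slice_continuous tT crel).
  congr torus_int; apply/funext => x; have Sz := inT x t tT.
  have b0 : 0 < fth ub (x, t) by exact: (rpos rub (sQ _ Sz)).
  rewrite (rel_entropyE oO O0 Cg psiE) ?(ltW (posU _ _ (TTs _ tT)))// -?(eth (x, t) Sz) ?(ltW b0)//.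
  rewrite /relent /fY (eX (x, t) Sz) (eth (x, t) Sz); congr (_ + _ * _); rewrite frob_sqr big_ord1.
  by apply: eq_bigr => i _; rewrite !mxE (ev i _ Sz).
have errE : viscous_error mu T U Ub = (\int[lebesgue_measure]_(s in `[0%R, T])
    (Tint (fun x => e (x, s)))%:E)%E.
  apply: eq_integral => s; rewrite inE /= in_itv /= => sT.
  rewrite -torus_intE; last exact: (slice_continuous sT ce).
  congr torus_int; apply/funext => x; have Sz := inT x s sT.
  rewrite /e /u /= mmE/= ?posU ?TTs// (eth (x, s) Sz) /grad_vel_sq mulr_suml; congr (_ * _).
  apply: eq_bigr => i _; rewrite mulr_suml; apply: eq_bigr => a _; congr (_ ^+ 2 / _).
  have -> : dx a (fun y t => vel (Ub y t) 0 i) x s = dx a (fun y t => fv ub i (y, t)) x s.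
    by rewrite /dx; congr ('D__ _ _); apply/funext => y; rewrite (ev i _ (inT y s sT)).
  by rewrite dxE; congr ('D__ _ _); apply/funext => -[].
have bu := solution_balanced O0 Cg psiE mmE kkE TT hU posU.
have bub := reference_balanced O0 Cg psiE kkE hUb sQ rub mub kub eX ev eth.
have pu := solution_periodic mm kk TT hU.
have pub := reference_periodic hUb mub kub eX ev eth.
have T00 : (0 : R) <= 0 <= T by rewrite lexx ltW.
split.
- by rewrite relE.
- move=> t tT; rewrite !relE// errE.
  exact: (integrated_gronwall oO O0 Cg T0 ru rubS mub pu pub bu bub crel (ltW K0) ce e0 phi0 res tT).
(* The viscous source is traded for mu0 times one plus the relative entropy: its linear part joins
   the Gronwall constant and only [mu0 * L] stays as a source. *)
- have emu y s : cube y -> 0 < s < T ->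
      e (point3 y, s) <= mu0 * L * (1 + relent g u ub (point3 y, s)).
    move=> Cy sT; have sT' : 0 <= s < T by case/andP: sT => /ltW -> ->.
    have sTs : 0 <= s < Tstar by case/andP: sT' => -> /lt_trans ->.
    have [_ _ h3 _ _] := HD y s Cy sT.
    have [_ _ b3] := hb (point3 y) s sTs.
    have th0 := posU (point3 y) s sTs.
    set z := (point3 y, s); have JIz := JI (point3 y) s sT'.
    have I0 : 0 <= relent g u ub z := le_trans (J0 (point3 y) s sT') JIz.
    have en_le : `|energy psi (xi (U (point3 y) s)) (temp (U (point3 y) s))|
        <= C1 * C2 * (1 + relent g u ub z).
      rewrite (psi_energy O0 Cg psiE _ (ltW th0)).
      have [_ h] := H1 (fY u z) (ltW th0); apply: le_trans h _.
      have h2 := H2 (fY u z) (fY ub z) (ltW th0) (box0 (point3 y) s sT').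
      rewrite -[leRHS]mulrA ler_pM2l//; apply: le_trans h2 _.
      by rewrite ler_pM2l// lerD2l.
    have mu_le : fmu u z * fth u z <= mu0 * (`|C'| * (C1 * C2 * (1 + relent g u ub z))).
      rewrite /u /= mmE//=; apply: le_trans (ler_norm _) _; apply: le_trans b3 _.
      rewrite -[leLHS]mulrA [leLHS]mulrCA ler_pM2l//; apply: le_trans (ler_norm _) _.
      by rewrite normrM normr_id; apply: ler_wpM2l.
    have grad_le : \sum_(i < 3) \sum_(a < 3) 'D_(ebase a) (fv ub i) z ^+ 2 / fth ub z
        <= 3%:R * (3%:R * (D ^+ 2 / delta)).
      apply: sum_le_const => i; apply: sum_le_const => a.
      have [_ /andP[tb _]] := boxb (point3 y) s sT'; have tb0 : 0 < fth ub z := lt_le_trans d0 tb.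
      apply: ler_pM; [exact: sqr_ge0 | by rewrite invr_ge0 ltW | | by rewrite lef_pV2 ?posrE].
      by rewrite -(ler_sqrt _ (exprn_ge0 _ (ltW D0))) !sqrtr_sqr (ger0_norm (ltW D0)).
    have mt0 : 0 <= fmu u z * fth u z by apply: mulr_ge0; rewrite ltW// mpos.
    have g0 : 0 <= \sum_(i < 3) \sum_(a < 3) 'D_(ebase a) (fv ub i) z ^+ 2 / fth ub z.
      have [_ /andP[tb _]] := boxb (point3 y) s sT'; have tb0 : 0 < fth ub z := lt_le_trans d0 tb.
      apply: sumr_ge0 => i _; apply: sumr_ge0 => a _.
      by apply: mulr_ge0; [exact: sqr_ge0 | rewrite invr_ge0 ltW].
    apply: le_trans (ler_pM mt0 g0 mu_le grad_le) _.
    rewrite /L; move: (D ^+ 2 / delta) (relent g u ub z) => w I.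
    by rewrite -subr_ge0 le_eqVlt eq_sym; apply/orP; left; apply/eqP; ring.
  have res' y s : cube y -> 0 < s < T -> fres g u ub (point3 y, s)
      <= (K + mu0 * L) * relent g u ub (point3 y, s) + (fun _ : W => mu0 * L) (point3 y, s).
    move=> Cy sT; apply: le_trans (res y s Cy sT) _.
    by rewrite mulrDl -addrA lerD2l; apply: le_trans (emu y s Cy sT) _; rewrite mulrDr mulr1 addrC.
  have mL0 : 0 <= mu0 * L by rewrite mulr_ge0// ltW.
  have cc : continuous (fun z : W => (fun _ : W => mu0 * L) (z.1, clamp T z.2)).
    by move=> z; exact: cvg_cst.
  have KL0 : 0 <= K + mu0 * L by rewrite addr_ge0// ltW.
  move=> t tT; rewrite !relE//.
  have -> : (mu0 * L * T)%:E = (\int[lebesgue_measure]_(s in `[0%R, T])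
      (Tint (fun x => (fun _ : W => mu0 * L) (x, s)))%:E)%E.
    under eq_integral do rewrite Tint_cst.
    by rewrite integral_cst//= lebesgue_measure_itv /= lte_fin T0 oppr0 addr0 EFinM.
  exact: (integrated_gronwall oO O0 Cg T0 ru rubS mub pu pub bu bub crel KL0 cc
    (fun _ _ => mL0) phi0 res' tT).
Qed.

End main_estimate.

(** * Stability estimate and the zero-viscosity limit *)

Theorem theorem5p1 (R : realType)
    (psi : 'rV[R]_19 -> R -> R) (p q r l : R)
    (k : R -> 'M[R]_3 -> R -> R) (k0 : R) (C' : R -> R)
    (T M delta dlow : R) (Ub : state_field R)
    (hpsi : free_energy_C3 psi)
    (hconv : hess_xi_posdef psi)
    (heta : eta_th_pos psi)
    (hp : 4 <= p) (hq : 1 < q) (hr : 1 < r) (hl : 1 < l)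
    (hG1 : growth1 p q r l psi)
    (hG2 : growth2 p q r l psi)
    (hG3 : growth3 p q r l psi)
    (hk0 : 0 < k0) (hk : coefficient (k k0))
    (hT : 0 < T) (hM : 0 < M) (hdelta : 0 < delta) (hdlow : 0 < dlow)
    (hUb : smooth_inviscid_solution psi (k k0) T Ub)
    (hGamma : forall x t, 0 <= t < T -> Gamma M delta (Ub x t)) :
  exists C : R, [/\ 0 < C,
    forall (mu0 : R) (mu : 'M[R]_3 -> R -> R) (Tstar : R) (U : state_field R),
      0 < mu0 ->
      viscous_solution psi (k k0) (C' k0) dlow T mu0 mu Tstar U ->
      forall t, 0 <= t <= T ->
        (rel_entropy_int psi U Ub t
         <= C%:E * (rel_entropy_int psi U Ub 0 + viscous_error mu T U Ub))%E
  & forall (mu : R -> 'M[R]_3 -> R -> R) (Tstar : R -> R) (U : R -> state_field R),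
      (forall mu0, 0 < mu0 ->
         viscous_solution psi (k k0) (C' k0) dlow T mu0
           (mu mu0) (Tstar mu0) (U mu0)) ->
      rel_entropy_int psi (U mu0) Ub 0 @[mu0 --> 0^'+] --> 0%E ->
      ereal_sup [set rel_entropy_int psi (U mu0) Ub t | t in `[0, T[]
        @[mu0 --> 0^'+] --> 0%E].
Proof.
have [K [L [K0 L0 H]]] := relative_entropy_estimates (C' k0) hpsi hconv heta hp hq hr hl
  hG1 hG2 hG3 hk hT hdelta hdlow hUb hGamma.
exists (expR (K * T)); split; first exact: expR_gt0.
  by move=> mu0 mu Tstar U mu00 hU; have [_ h _] := H mu0 mu Tstar U mu00 hU.
move=> mu Tstar U hU h0.
(* For viscosity parameters at most 1 the exponent [K + m * L] is at most [K + L], so this majorant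
   has a fixed factor and tends to 0 with the initial relative entropy. *)
pose h m := ((expR ((K + L) * T))%:E * (rel_entropy_int psi (U m) Ub 0 + (m * L * T)%:E))%E.
apply: (@squeeze_cvge _ _ _ _ (fun=> 0%E) _ h).
- near=> m.
  have m0 : 0 < m by near: m; exact: nbhs_right_gt.
  have m1 : m <= 1 by near: m; exact: nbhs_right_le.
  have [r0 _ r2] := H m (mu m) (Tstar m) (U m) m0 (hU m m0).
  apply/andP; split.
    (* The supremum is nonnegative because it dominates its value at time 0. *)
    apply: (le_trans r0); apply: ereal_sup_ubound; exists 0 => //=.
    by rewrite in_itv /= lexx.
  apply: ge_ereal_sup => _ /= [t tT <-].
  have tT' : 0 <= t <= T by move: tT; rewrite in_itv /= => /andP[-> /ltW].
  apply: (le_trans (r2 t tT')); apply: lee_wpmul2r.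
    by rewrite adde_ge0// lee_fin !mulr_ge0// ltW.
  rewrite lee_fin ler_expR ler_pM2r// lerD2l; exact: ler_piMl.
- exact: cvg_cst.
- have m_cvg : m @[m --> (0 : R)^'+] --> (0 : R) by apply: cvg_at_right_filter; exact: cvg_id.
  have e_cvg : (m * L * T)%:E @[m --> (0 : R)^'+] --> (0%:E : \bar R).
    apply: cvg_EFin; first by near=> m.
    rewrite -[X in _ --> X](_ : 0 * L * T = 0); last by rewrite !mul0r.
    by apply: cvgM; [apply: cvgM; [exact: m_cvg | exact: cvg_cst] | exact: cvg_cst].
  have s_cvg := cvgeD _ h0 e_cvg.
  rewrite -[X in _ --> X](mule0 (expR ((K + L) * T))%:E).
  apply: cvgeZl => //; rewrite -[X in _ --> X]adde0; exact: s_cvg.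
Unshelve. all: by end_near. Qed.
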